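(* Any parabolic Monge-Ampère equation with real analytic coefficients admits (locally) a complete integral. In particular, it can be locally reduced by a contactomorphism to the form $$z_{yy}-2a\,z_{xy}+a^2z_{xx}=b$$ for some functions $a,b$ on $J^1(\tau)$.
   Context: Everything is local. $J^1(\tau)$ is the manifold of 1-jets of functions $z=z(x,y)$, with coordinates $(x,y,z,p,q)$, $p=z_x$, $q=z_y$. Its contact distribution is $\mathcal C=\{U=0\}$, $U=dz-p\,dx-q\,dy$. A contactomorphism is a (local) diffeomorphism of $J^1(\tau)$ preserving $\mathcal C$. A Monge-Ampère equation (MAE) is $N(z_{xx}z_{yy}-z_{xy}^2)+Az_{xx}+Bz_{xy}+Cz_{yy}+D=0$ with coefficients $A,B,C,D,N$ functions on (a domain of) $J^1(\tau)$ that are nowhere simultaneously zero; it is parabolic if $B^2-4AC+4ND=0$ identically. To a parabolic MAE associate $$\omega=D\,dx\wedge dy+\tfrac B2dx\wedge dp+C\,dx\wedge dq-A\,dy\wedge dp-\tfrac B2 dy\wedge dq+N\,dp\wedge dq ,$$ whose restriction to $\mathcal C$ is degenerate. A complete integral of the equation is a 2-dimensional integrable distribution $\widehat{\mathcal D}\subset\mathcal C$ with $\omega|_{\widehat{\mathcal D}_\theta}=0$ for every $\theta$ (i.e. a 2-dimensional foliation of $J^1(\tau)$ whose leaves are solutions). Reducing an equation to another by a contactomorphism means that the contactomorphism carries the exterior differential system $\{U=0,\omega=0\}$ of one to that of the other. *)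

(* Defs.v *)
From HB Require Import structures.
From mathcomp Require Import all_boot all_order all_algebra.
From mathcomp Require Import all_classical all_reals all_analysis.

Set Implicit Arguments.
Unset Strict Implicit.
Unset Printing Implicit Defensive.

Import Order.TTheory GRing.Theory Num.Theory.
Import numFieldNormedType.Exports.

Local Open Scope classical_set_scope.
Local Open Scope ring_scope.

Section Regularity.
Context {R : realType} {n : nat}.
Local Notation pt := 'rV[R]_n.+1.

Definition monomial (h : pt) (m : 'I_n.+1 -> nat) : R :=
  \prod_(i < n.+1) h 0 i ^+ m i.

(* On an open polydisc around x0, f is the sum of an absolutely convergent
   power series in n.+1 variables; multi-indices are finite functions, and
   the sum is the limit of the partial sums over the boxes {0, ..., N-1}^n.+1. *)
Definition analytic_at (f : pt -> R) (x0 : pt) : Prop :=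
  exists c : {ffun 'I_n.+1 -> nat} -> R, exists2 r : R, 0 < r &
    forall h : pt, (forall i, `|h 0 i| < r) ->
      summable setT (fun m => (c m * monomial h m)%:E) /\
      (fun N : nat => \sum_(k : {ffun 'I_n.+1 -> 'I_N})
          c [ffun i => nat_of_ord (k i)] * monomial h (fun i => nat_of_ord (k i)))
        @ \oo --> f (x0 + h).

Definition analytic_on (V : set pt) (f : pt -> R) : Prop :=
  forall x, V x -> analytic_at f x.

Definition iter_partial (s : seq 'I_n.+1) (f : pt -> R) : pt -> R :=
  foldr (fun i g x => 'D_(delta_mx 0 i) g x) f s.

(* C^infinity on an open set V: the iterated partial derivatives of all orders
   exist and are continuous on V. *)
Definition smooth_on (V : set pt) (f : pt -> R) : Prop :=
  forall (s : seq 'I_n.+1) (x : pt), V x ->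
    {for x, continuous (iter_partial s f)} /\
    forall i, derivable (iter_partial s f) x (delta_mx 0 i).

Definition smooth_map_on (V : set pt) (F : pt -> pt) : Prop :=
  forall i, smooth_on V (fun x => F x 0 i).

Definition diffeo (V W : set pt) (F : pt -> pt) : Prop :=
  [/\ open V, open W, smooth_map_on V F, (forall x, V x -> W (F x)) &
    exists G : pt -> pt, [/\ smooth_map_on W G, (forall y, W y -> V (G y)),
      (forall x, V x -> G (F x) = x) & (forall y, W y -> F (G y) = y)]].

End Regularity.

Section Forms.
Context {R : realType} {n : nat}.
Local Notation pt := 'rV[R]_n.+1.

(* A form takes the base point first, then tangent vectors. *)
Definition form1 := pt -> pt -> R.
Definition form2 := pt -> pt -> pt -> R.

Definition smooth_form1 (V : set pt) (a : form1) : Prop :=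
  (forall x, V x -> scalar (a x)) /\ (forall v, smooth_on V (fun x => a x v)).

Definition smooth_form2 (V : set pt) (b : form2) : Prop :=
  [/\ forall x v, V x -> scalar (b x v),
      forall x v w, V x -> b x v w = - b x w v &
      forall v w, smooth_on V (fun x => b x v w)].

Definition wedge (a b : pt -> R) (v w : pt) : R := a v * b w - a w * b v.

Definition ext_deriv (a : form1) : form2 :=
  fun x v w => 'D_v (fun y => a y w) x - 'D_w (fun y => a y v) x.

Definition pullback1 (F : pt -> pt) (a : form1) : form1 :=
  fun x v => a (F x) ('d F x v).

Definition pullback2 (F : pt -> pt) (b : form2) : form2 :=
  fun x v w => b (F x) ('d F x v) ('d F x w).

(* Flat charts: around every point of V there are local coordinates u in which
   the distribution is d u_i = 0 for i >= k, i.e. it is tangent to the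
   k-dimensional foliation {u_i = const, i >= k}. Smoothness of the
   distribution, and its rank being k, follow. *)
Definition integrable_distr (k : nat) (V : set pt) (D : pt -> {vspace pt})
    : Prop :=
  forall x0, V x0 -> exists (V' W' : set pt) (u : pt -> pt),
    [/\ V' x0, V' `<=` V, diffeo V' W' u &
      forall x, V' x -> forall v : pt,
        v \in D x <-> forall i : 'I_n.+1, (k <= i)%N -> ('d u x v : pt) 0 i = 0].

End Forms.

Arguments form1 : clear implicits.
Arguments form2 : clear implicits.

Section Jets.
Context {R : realType}.

(* Coordinates (x, y, z, p, q) on the 1-jet space. *)

Definition cx (t : 'rV[R]_5) : R := t 0 (@Ordinal 5 0 isT).
Definition cy (t : 'rV[R]_5) : R := t 0 (@Ordinal 5 1 isT).
Definition cz (t : 'rV[R]_5) : R := t 0 (@Ordinal 5 2 isT).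
Definition cp (t : 'rV[R]_5) : R := t 0 (@Ordinal 5 3 isT).
Definition cq (t : 'rV[R]_5) : R := t 0 (@Ordinal 5 4 isT).

(* The coordinates are linear, so the same functions, applied to tangent
   vectors, are their differentials. *)
Local Notation dx := cx.
Local Notation dy := cy.
Local Notation dz := cz.
Local Notation dp := cp.
Local Notation dq := cq.

Definition contact_form : form1 R 4 :=
  fun t v => dz v - cp t * dx v - cq t * dy v.

Definition contactomorphism (V W : set 'rV[R]_5) (F : 'rV[R]_5 -> 'rV[R]_5)
    : Prop :=
  diffeo V W F /\
  forall t, V t -> forall v,
    contact_form t v = 0 <-> contact_form (F t) ('d F t v) = 0.

(* Coefficients of N (z_xx z_yy - z_xy^2) + A z_xx + B z_xy + C z_yy + D = 0. *)
Record ma_equation := MAEquation {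
  coefN : 'rV[R]_5 -> R;
  coefA : 'rV[R]_5 -> R;
  coefB : 'rV[R]_5 -> R;
  coefC : 'rV[R]_5 -> R;
  coefD : 'rV[R]_5 -> R }.

(* Left-hand side of the equation at the 2-jet with first-order part t and
   second derivatives zxx, zxy, zyy. *)
Definition ma_lhs (E : ma_equation) (t : 'rV[R]_5) (zxx zxy zyy : R) : R :=
  coefN E t * (zxx * zyy - zxy ^+ 2) + coefA E t * zxx + coefB E t * zxy
  + coefC E t * zyy + coefD E t.

Definition nowhere_zero_on (V : set 'rV[R]_5) (E : ma_equation) : Prop :=
  forall t, V t ->
    ~ [/\ coefN E t = 0, coefA E t = 0, coefB E t = 0, coefC E t = 0
        & coefD E t = 0].

Definition parabolic_on (V : set 'rV[R]_5) (E : ma_equation) : Prop :=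
  forall t, V t ->
    coefB E t ^+ 2 - 4 * (coefA E t * coefC E t)
    + 4 * (coefN E t * coefD E t) = 0.

Definition analytic_coefs_on (V : set 'rV[R]_5) (E : ma_equation) : Prop :=
  [/\ analytic_on V (coefN E), analytic_on V (coefA E),
      analytic_on V (coefB E), analytic_on V (coefC E)
    & analytic_on V (coefD E)].

Definition ma_form (E : ma_equation) : form2 R 4 := fun t v w =>
  coefD E t * wedge dx dy v w + coefB E t / 2 * wedge dx dp v w
  + coefC E t * wedge dx dq v w - coefA E t * wedge dy dp v w
  - coefB E t / 2 * wedge dy dq v w + coefN E t * wedge dp dq v w.

Definition complete_integral (V : set 'rV[R]_5) (E : ma_equation)
    (Dh : 'rV[R]_5 -> {vspace 'rV[R]_5}) : Prop :=
  [/\ forall t, V t -> \dim (Dh t) = 2%N,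
      integrable_distr 2 V Dh,
      forall t, V t -> forall v, v \in Dh t -> contact_form t v = 0 &
      forall t, V t -> forall v w, v \in Dh t -> w \in Dh t ->
        ma_form E t v w = 0].

(* The exterior differential system {U = 0, omega = 0} is the differential
   ideal generated by U and omega. These are its components of degree 1 (where
   only U contributes) and 2; it contains every form of degree >= 3, since
   modulo U, on the 4-dimensional contact planes, such a form is a multiple
   of dU. *)
Definition eds1 (V : set 'rV[R]_5) (a : form1 R 4) : Prop :=
  exists2 f : 'rV[R]_5 -> R, smooth_on V f &
    forall t, V t -> forall v, a t v = f t * contact_form t v.

Definition eds2 (V : set 'rV[R]_5) (E : ma_equation) (b : form2 R 4) : Prop :=
  exists (f g : 'rV[R]_5 -> R) (eta : form1 R 4),
    [/\ smooth_on V f, smooth_on V g, smooth_form1 V eta &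
      forall t, V t -> forall v w,
        b t v w = f t * ma_form E t v w + g t * ext_deriv contact_form t v w
                  + wedge (eta t) (contact_form t) v w].

Definition carries_eds (V W : set 'rV[R]_5) (F : 'rV[R]_5 -> 'rV[R]_5)
    (E E' : ma_equation) : Prop :=
  (forall a, smooth_form1 W a -> (eds1 W a <-> eds1 V (pullback1 F a))) /\
  (forall b, smooth_form2 W b -> (eds2 W E' b <-> eds2 V E (pullback2 F b))).

Definition reduces_on (V W : set 'rV[R]_5) (F : 'rV[R]_5 -> 'rV[R]_5)
    (E E' : ma_equation) : Prop :=
  contactomorphism V W F /\ carries_eds V W F E E'.

Definition normal_form (a b : 'rV[R]_5 -> R) : ma_equation :=
  MAEquation (fun=> 0) (fun t => a t ^+ 2) (fun t => - (2 * a t)) (fun=> 1)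
    (fun t => - b t).

Lemma normal_formE a b t zxx zxy zyy :
  ma_lhs (normal_form a b) t zxx zxy zyy = 0 <->
  zyy - 2 * a t * zxy + a t ^+ 2 * zxx = b t.
Proof.
rewrite /ma_lhs /= mul0r add0r mul1r mulNr.
have -> : a t ^+ 2 * zxx - 2 * a t * zxy + zyy - b t =
          zyy - 2 * a t * zxy + a t ^+ 2 * zxx - b t.
  by congr (_ - _); rewrite addrC -addrA [- _ + _]addrC addrA addrAC.
by split=> [/eqP|->]; rewrite ?subr_eq0 ?subrr // => /eqP.
Qed.

End Jets.

Arguments ma_equation : clear implicits.

(* Main.v *)
Require Import Defs.
From HB Require Import structures.
From mathcomp Require Import all_boot all_order all_algebra.
From mathcomp Require Import all_classical all_reals all_analysis.
From mathcomp Require Import ring lra.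
Set Implicit Arguments.
Unset Strict Implicit.
Unset Printing Implicit Defensive.
Import Order.TTheory GRing.Theory Num.Theory.
Import numFieldNormedType.Exports.
Local Open Scope classical_set_scope.
Local Open Scope ring_scope.

(** Write U for the contact form and om for the 2-form of the equation. On a
   contact plane the degenerate form om has a 2-dimensional kernel. In a
   symplectic frame of the contact planes it is spanned by fields xi0 and phi,
   and every Lagrangian plane that meets the kernel in a line and is not too
   far from a fixed one is spanned by

     xi = xi0 + l phi      and      eta = E1 - m phi + l psi

   for two numbers l and m. Since xi lies in the kernel, om vanishes on such a
   plane whatever l and m are. So a complete integral is a choice of functions
   l, m that makes the planes integrable. Computing the bracket
   ([bracket_xi_eta]) shows that this is a quasilinear first-order system of
   two equations for two unknowns, of the form xi l = ..., xi m = ..., with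
   right-hand sides that differentiate l and m only along eta. When xi is
   transverse to a coordinate hyperplane {tau = const} and eta is tangent to
   it, the Cauchy-Kovalevskaya theorem applies; this is where analyticity of
   the coefficients is used. Some coefficient is nonzero at the base point, and
   a suitable constant symplectic basis moves it to the position that provides
   this transversality ([basis_C], [basis_A], [basis_D], [basis_N]).

   For a solution (l, m) one has [xi, eta] = rho eta. The leaves are then the
   common level sets of three functions X, Y, Z killed by xi and eta: solve
   xi X = 0 with initial data on {tau = const} killed by eta there; then
   xi (eta X) = rho (eta X) with zero initial data, so eta X = 0
   ([leaf_functions], [leaf_jets]). Suitable initial data make (X, Y, Z)
   independent, which yields the foliation ([leaf_complete_integral]).

   For the normal form, U vanishes on the leaves and hence is a combination of
   dX, dY, dZ; solving for the coefficients gives functions P, Q, ell with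
   dZ - P dX - Q dY = ell U. Thus F = (X, Y, Z, P, Q) is a contact map, a
   diffeomorphism near the base point because ell is nonzero
   ([contact_map_inj], [inverse_function]), and it sends the complete integral
   to the foliation by the fibres {x, y, z constant}. A parabolic equation that
   has these fibres as solutions and a nonzero coefficient of z_yy, which the
   choice of the initial data ensures, is given up to a factor and modulo U by
   the decomposable form (dx + a dy) /\ (dq - a dp - b dy), which is the form
   of z_yy - 2 a z_xy + a^2 z_xx = b. The functions a and b are read off from
   the condition that both factors kill phi ([wedge_frame], [reduction]).

   The analytic part is done with formal series: [jet] is the ring of series
   at a point, [cauchy_kovalevskaya] solves the system with bounds on the
   coefficients, and the sums of convergent series are smooth functions on a
   ball ([jsum_smooth]) on which the sum commutes with the ring operations and
   the derivations, so that identities between series become identities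
   between functions ([dd_realize]). *)

(** * Formal power series, encoded by their iterated partial derivatives *)

Section Jets.
Context {R : realType} {n : nat}.
Local Notation I := 'I_n.+1.

(** The word [:: i1; ...; ik] stores the value at the base point of the
   derivative D_i1 ... D_ik. Words are used instead of multi-indices so that
   differentiating is prefixing a letter and the Leibniz rule is a structural
   recursion; symmetry under exchange of adjacent letters is the price. *)
Record jet := Jet {
  jcoef :> seq I -> R;
  jet_swap : forall v i j w, jcoef (v ++ i :: j :: w) = jcoef (v ++ j :: i :: w) }.

Lemma jetP (U V : jet) : (forall w, U w = V w) -> U = V.
Proof.
case: U V => u su [v sv] /= /funext uv; subst v.
by congr Jet; exact: Prop_irrelevance.
Qed.

HB.instance Definition _ := gen_eqMixin jet.
HB.instance Definition _ := gen_choiceMixin jet.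

Fact jderiv_swap j (U : jet) v i k w :
  U (j :: v ++ i :: k :: w) = U (j :: v ++ k :: i :: w).
Proof. exact: (jet_swap U (j :: v)). Qed.

Definition jderiv j (U : jet) : jet :=
  @Jet (fun w => U (j :: w)) (jderiv_swap j U).

Lemma jderivC i j U : jderiv i (jderiv j U) = jderiv j (jderiv i U).
Proof. by apply: jetP => w; exact: (jet_swap U [::] j i). Qed.

Definition jconst (c : R) : jet.
Proof. by exists (fun w => if w is [::] then c else 0) => -[|k v] i j w. Defined.

Definition jadd (U V : jet) : jet.
Proof. by exists (fun w => U w + V w) => v i j w; rewrite !(jet_swap _ _ i). Defined.

Definition jopp (U : jet) : jet.
Proof. by exists (fun w => - U w) => v i j w; rewrite !(jet_swap _ _ i). Defined.

(** The Leibniz rule, read as a definition of the product. *)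
Fixpoint jmulc (U V : jet) (w : seq I) : R :=
  if w is j :: w' then jmulc (jderiv j U) V w' + jmulc U (jderiv j V) w'
  else U [::] * V [::].

Fact jmulc_swap U V v i j w :
  jmulc U V (v ++ i :: j :: w) = jmulc U V (v ++ j :: i :: w).
Proof.
elim: v U V => [|k v IH] U V /=; last by rewrite !IH.
by rewrite (jderivC i j U) (jderivC i j V) addrACA.
Qed.

Definition jmul U V := @Jet (jmulc U V) (jmulc_swap U V).

Fact jaddA : associative jadd.
Proof. by move=> U V W; apply: jetP => w /=; rewrite addrA. Qed.
Fact jaddC : commutative jadd.
Proof. by move=> U V; apply: jetP => w /=; rewrite addrC. Qed.
Fact jadd0 : left_id (jconst 0) jadd.
Proof. by move=> U; apply: jetP => -[|i w] /=; rewrite add0r. Qed.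
Fact jaddN : left_inverse (jconst 0) jopp jadd.
Proof. by move=> U; apply: jetP => -[|i w] /=; rewrite addNr. Qed.

HB.instance Definition _ := GRing.isZmodule.Build jet jaddA jaddC jadd0 jaddN.

Fact jderivD j : {morph jderiv j : U V / U + V}.
Proof. by move=> U V; apply: jetP. Qed.

Fact jmulC : commutative jmul.
Proof.
move=> U V; apply: jetP => w /=.
by elim: w U V => [|j w IH] U V /=; rewrite ?(mulrC (U _)) // addrC !(IH _ V) (IH U).
Qed.

Fact jmulcDl w U U' V : jmulc (U + U') V w = jmulc U V w + jmulc U' V w.
Proof.
elim: w U U' V => [|j w IH] U U' V /=; first by rewrite mulrDl.
by rewrite jderivD !IH addrACA.
Qed.

Fact jmulDl : left_distributive jmul +%R.
Proof. by move=> U V W; apply: jetP => w; rewrite /= jmulcDl. Qed.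

Lemma jderivM j U V : jderiv j (jmul U V) = jmul (jderiv j U) V + jmul U (jderiv j V).
Proof. by apply: jetP. Qed.

Fact jmulA : associative jmul.
Proof.
move=> U V W; apply: jetP => w.
elim: w U V W => [|j w IH] U V W; first by rewrite /= mulrA.
have S (A B : jet) : jmul A B (j :: w) = jmul (jderiv j A) B w + jmul A (jderiv j B) w by [].
have DR (A B C : jet) : jmul A (B + C) w = jmul A B w + jmul A C w.
  by rewrite !(jmulC A) jmulDl.
have DL (A B C : jet) : jmul (A + B) C w = jmul A C w + jmul B C w.
  by rewrite jmulDl.
by rewrite !S !jderivM DR DL !IH addrA.
Qed.

Fact jmul1 : left_id (jconst 1) jmul.
Proof.
move=> U; apply: jetP => w /=.
have jd0 j c : jderiv j (jconst c) = 0 by apply: jetP; case.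
have j0 V v : jmulc 0 V v = 0.
  elim: v V => [|j v IH] V; first exact: mul0r.
  have -> : jmulc 0 V (j :: v) = jmulc (jderiv j 0) V v + jmulc 0 (jderiv j V) v by [].
  by rewrite (jd0 j 0) !IH addr0.
by elim: w U => [|j w IH] U /=; rewrite ?mul1r // jd0 j0 IH add0r.
Qed.

Fact jone_neq0 : jconst 1 != 0.
Proof.
by apply/eqP => /(congr1 (fun U : jet => U [::]))/eqP; rewrite /= oner_eq0.
Qed.

HB.instance Definition _ := GRing.Zmodule_isComNzRing.Build jet
  jmulA jmulC jmul1 jmulDl jone_neq0.

Lemma jderiv_is_zmod j : zmod_morphism (jderiv j).
Proof. by move=> U V; apply: jetP. Qed.
HB.instance Definition _ j :=
  GRing.isZmodMorphism.Build jet jet (jderiv j) (jderiv_is_zmod j).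

Lemma jcoefD (U V : jet) w : (U + V) w = U w + V w. Proof. by []. Qed.
Lemma jcoefN (U : jet) w : (- U) w = - U w. Proof. by []. Qed.
Lemma jcoefM_nil (U V : jet) : (U * V) [::] = U [::] * V [::]. Proof. by [].  Qed.
Lemma jcoefM_cons (U V : jet) j w :
  (U * V) (j :: w) = (jderiv j U * V) w + (U * jderiv j V) w.
Proof. by []. Qed.
Lemma jderiv_mul j (U V : jet) : jderiv j (U * V) = jderiv j U * V + U * jderiv j V.
Proof. exact: jderivM. Qed.
Lemma jderiv_const j c : jderiv j (jconst c) = 0.
Proof. by apply: jetP; case. Qed.

End Jets.
Arguments jet : clear implicits.

(** * Causal recursions, primitives, and majorants of products *)

Section Recursion.
Context {R : realType} {n : nat}.
Local Notation I := 'I_n.+1.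
Local Notation jet := (jet R n).

(** The measure m counts derivatives, in one direction or in all. *)
Definition agree (m : seq I -> nat) k (U V : jet) :=
  forall w, (m w < k)%N -> U w = V w.

Section CausalFixpoint.
Variables (T : Type) (m : seq I -> nat) (F : (T -> jet) -> T -> jet).
Hypothesis m_swap : forall v i j w, m (v ++ i :: j :: w) = m (v ++ j :: i :: w).
Hypothesis F_causal : forall k u v,
  (forall i, agree m k (u i) (v i)) -> forall i, agree m k.+1 (F u i) (F v i).

Let it k := iter k F (fun=> 0).

Lemma it_agree k l i : (k <= l)%N -> agree m k (it l i) (it k i).
Proof.
elim: k l i => [|k IH] [|l] i // kl.
by apply: F_causal => t; apply: IH.
Qed.

Fact itlim_swap t v i j w :
  it (m (v ++ i :: j :: w)).+1 t (v ++ i :: j :: w) =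
  it (m (v ++ j :: i :: w)).+1 t (v ++ j :: i :: w).
Proof. by rewrite m_swap jet_swap. Qed.

Let lim t : jet := @Jet R n (fun w => it (m w).+1 t w) (itlim_swap t).

(** An operator whose coefficients at level k use only lower levels has a fixed
   point: the coefficient at w is stable under iteration from step m w + 1 on.
   The second conclusion lets bounds pass from the iterates to the fixed point. *)
Lemma causal_fixpoint : exists u : T -> jet,
  (forall i, F u i = u i) /\ forall i w, exists k, u i w = iter k F (fun=> 0) i w.
Proof.
exists lim; split=> [t|t w]; last by exists (m w).+1.
apply: jetP => w.
have limk k i : agree m k (lim i) (it k i).
  by move=> v vk /=; rewrite (it_agree _ vk).
by rewrite (@F_causal (m w) lim (it (m w))).
Qed.

End CausalFixpoint.
End Recursion.

Section Cauchy.
Context {R : realType} {n : nat} (tau : 'I_n.+1).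
Local Notation I := 'I_n.+1.
Local Notation jet := (jet R n).
Local Notation agr := (@agree R n (count_mem tau)).

Lemma rem_cat_notin (x : I) v w : x \notin v -> rem x (v ++ w) = v ++ rem x w.
Proof.
by elim: v => //= y v IH; rewrite inE negb_or eq_sym => /andP[/negPf-> /IH ->].
Qed.

Lemma rem_cat_in (x : I) v w : x \in v -> rem x (v ++ w) = rem x v ++ w.
Proof.
elim: v => //= y v IH; rewrite inE eq_sym; case: eqP => //= _ /IH ->; by [].
Qed.

Fact jint_swap (U : jet) v i j w :
  (if tau \in v ++ i :: j :: w then U (rem tau (v ++ i :: j :: w)) else 0) =
  (if tau \in v ++ j :: i :: w then U (rem tau (v ++ j :: i :: w)) else 0).
Proof.
rewrite !mem_cat !inE [(_ == i) || _]orbCA; case: ifP => // _.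
case: (boolP (tau \in v)) => tv; first by rewrite !rem_cat_in // jet_swap.
rewrite !rem_cat_notin //=.
case: (eqVneq i tau) => [ei|_]; case: (eqVneq j tau) => [ej|_];
  by rewrite ?ei ?ej // jet_swap.
Qed.

(** The primitive along tau that vanishes on the hyperplane through the base
   point. Symmetry of jets allows to remove the first occurrence of tau. *)
Definition jint (U : jet) : jet := @Jet R n
  (fun w => if tau \in w then U (rem tau w) else 0) (jint_swap U).

Lemma jderiv_jint U : jderiv tau (jint U) = U.
Proof. by apply: jetP => w /=; rewrite inE eqxx. Qed.

Lemma agreeD k U U' V V' : agr k U U' -> agr k V V' -> agr k (U + V) (U' + V').
Proof. by move=> hU hV w wk; rewrite !jcoefD hU ?hV. Qed.

Lemma agreeN k U U' : agr k U U' -> agr k (- U) (- U').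
Proof. by move=> hU w wk; rewrite !jcoefN hU. Qed.

Lemma agree_deriv k U U' j : agr k U U' ->
  agr (k - (j == tau)) (jderiv j U) (jderiv j U').
Proof. by move=> hU w wk; apply: hU; rewrite /= -ltn_subRL. Qed.

Lemma agree_deriv_neq k U U' j : j != tau -> agr k U U' ->
  agr k (jderiv j U) (jderiv j U').
Proof. by move=> /negPf jt /(agree_deriv (j := j)); rewrite jt subn0. Qed.

Lemma agreeM k U U' V V' : agr k U U' -> agr k V V' -> agr k (U * V) (U' * V').
Proof.
move=> hU hV w; elim: w k U U' V V' hU hV => [|j w IH] k U U' V V' hU hV wk.
  by rewrite !jcoefM_nil hU // hV.
rewrite !jcoefM_cons; congr (_ + _); apply: (IH (k - (j == tau))%N).
- exact: agree_deriv.
- by move=> v vk; apply: hV; apply: leq_trans vk (leq_subr _ _).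
- by rewrite ltn_subRL.
- by move=> v vk; apply: hU; apply: leq_trans vk (leq_subr _ _).
- exact: agree_deriv.
- by rewrite ltn_subRL.
Qed.

Lemma agree_jint k U U' : agr k U U' -> agr k.+1 (jint U) (jint U').
Proof.
move=> hU w wk /=; case: ifP => // tw; apply: hU.
have : (0 < count_mem tau w)%N by rewrite -has_count has_pred1.
by rewrite count_rem tw /= eqxx => ?; rewrite -ltnS subn1 prednK.
Qed.

Lemma sum_pascal (u v : nat -> R) d :
  \sum_(i < d.+2) 'C(d.+1, i)%:R * (u i * v (d.+1 - i)%N) =
  \sum_(i < d.+1) 'C(d, i)%:R * (u i.+1 * v (d - i)%N) +
  \sum_(i < d.+1) 'C(d, i)%:R * (u i * v (d - i).+1).
Proof.
rewrite big_ord_recl /=.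
under eq_bigr do rewrite /bump /= add1n binS natrD mulrDl subSS.
rewrite big_split /= addrA addrC; congr (_ + _).
rewrite [X in _ + X]big_ord_recr /= (@bin_small d d.+1) // mul0r addr0 [RHS]big_ord_recl.
rewrite !bin0 !subn0; congr (_ + _); apply: eq_bigr => i _.
by rewrite -subnSK.
Qed.

(** The Leibniz rule over all subwords of w groups by length, since the bounds
   depend on a word only through its length and its number of letters tau. *)
Lemma mul_majorant (kap : R) (u v : nat -> R) (U V : jet) w : 0 <= kap ->
  (forall w, `|U w| <= kap ^+ count_mem tau w * u (size w)) ->
  (forall w, `|V w| <= kap ^+ count_mem tau w * v (size w)) ->
  `|(U * V) w| <= kap ^+ count_mem tau w *
     \sum_(i < (size w).+1) 'C(size w, i)%:R * (u i * v (size w - i)%N).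
Proof.
move=> kap0; elim: w u v U V => [|j w IH] u v U V hU hV.
  rewrite jcoefM_nil normrM big_ord1 /= bin0 !mul1r.
  by apply: ler_pM; rewrite ?normr_ge0 //; [have := hU [::]|have := hV [::]];
    rewrite /= expr0 mul1r.
rewrite jcoefM_cons (le_trans (ler_normD _ _))//.
set k := kap ^+ (j == tau).
have k0 : 0 <= k by rewrite exprn_ge0.
have hdU v' : `|jderiv j U v'| <= kap ^+ count_mem tau v' * (k * u (size v').+1).
  by apply: le_trans (hU (j :: v')) _; rewrite /= exprD -/k -mulrA mulrCA.
have hdV v' : `|jderiv j V v'| <= kap ^+ count_mem tau v' * (k * v (size v').+1).
  by apply: le_trans (hV (j :: v')) _; rewrite /= exprD -/k -mulrA mulrCA.
apply: le_trans (lerD (IH (fun s => k * u s.+1) v _ _ hdU hV)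
  (IH u (fun s => k * v s.+1) _ _ hU hdV)) _.
rewrite -mulrDr /= exprD -/k [k * _]mulrC -mulrA; apply: ler_wpM2l.
  by rewrite exprn_ge0.
rewrite sum_pascal mulrDr !mulr_sumr.
by rewrite le_eqVlt; apply/orP; left; apply/eqP; congr (_ + _);
  apply: eq_bigr => i _; ring.
Qed.

End Cauchy.

(** * Submultiplicative weights *)

Section Weights.
Context {R : realType}.

(** The factor 1 / (k + 1)^2 makes the sequence submultiplicative under
   convolution, as in Lax's proof of the Cauchy-Kovalevskaya theorem; the
   constant 8 normalizes the bound to 1. *)
Definition lax (d : nat) : R := (8 * (d%:R + 1) ^+ 2)^-1.

Lemma lax_gt0 d : 0 < lax d.
Proof. by rewrite invr_gt0 mulr_gt0 // exprn_gt0 // ltr_wpDl. Qed.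

Lemma sum_inv_sqr d : \sum_(i < d) ((i%:R + 1 : R) ^+ 2)^-1 <= 2 - d%:R^-1.
Proof.
elim: d => [|d IH]; first by rewrite big_ord0 invr0; lra.
rewrite big_ord_recr /=; case: d IH => [|d] IH.
  by rewrite big_ord0 add0r -natr1 add0r expr1n invr1; lra.
apply: le_trans (lerD IH (lexx _)) _.
have d0 : 0 <= d%:R :> R by [].
rewrite -!natr1; set x : R := d%:R in d0 *.
have x1 : 0 < x + 1 by lra.
have x2 : 0 < x + 1 + 1 by lra.
suff : (x + 1)^-1 - (x + 1 + 1)^-1 - ((x + 1 + 1) ^+ 2)^-1 >= 0 by lra.
have -> : (x + 1)^-1 - (x + 1 + 1)^-1 - ((x + 1 + 1) ^+ 2)^-1 =
  ((x + 1) * (x + 1 + 1) ^+ 2)^-1 by field; rewrite !gt_eqF.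
by rewrite invr_ge0 mulr_ge0 ?exprn_ge0 // ltW.
Qed.

(** From (x + y)^2 <= 2 (x^2 + y^2), divided by x^2 y^2 (x + y)^2, with x = i + 1
   and y = d - i + 1, and the bound 2 for the sum of inverse squares. *)
Lemma lax_conv d : \sum_(i < d.+1) lax i * lax (d - i) <= lax d.
Proof.
have d0 : 0 <= d%:R :> R by [].
set c : R := (32 * (d%:R + 2) ^+ 2)^-1.
have c0 : 0 <= c by rewrite invr_ge0 mulr_ge0 // exprn_ge0 //; lra.
pose g (i : nat) : R := ((i%:R + 1 : R) ^+ 2)^-1.
have H (i : 'I_d.+1) : lax i * lax (d - i) <= c * (g i + g (d - i)%N).
  rewrite /lax /g /c natrB -1?ltnS //.
  have i0 : 0 <= i%:R :> R by [].
  have id : i%:R <= d%:R :> R by rewrite ler_nat -ltnS.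
  have dE : d%:R = i%:R + (d%:R - i%:R) :> R by lra.
  move: (d%:R - i%:R : R) dE => y dE; have y0 : 0 <= y by lra.
  rewrite dE; move: (i%:R : R) i0 => x x0.
  rewrite -subr_ge0.
  have x1 : x + 1 != 0 by rewrite gt_eqF //; lra.
  have y1 : y + 1 != 0 by rewrite gt_eqF //; lra.
  have xy : x + y + 2 != 0 by rewrite gt_eqF //; lra.
  have -> : (32 * (x + y + 2) ^+ 2)^-1 * (((x + 1) ^+ 2)^-1 + ((y + 1) ^+ 2)^-1)
     - (8 * (x + 1) ^+ 2)^-1 * (8 * (y + 1) ^+ 2)^-1 =
     ((x - y) / (8 * ((x + 1) * (y + 1)) * (x + y + 2))) ^+ 2.
    by field; rewrite x1 y1 xy.
  exact: sqr_ge0.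
apply: le_trans (ler_sum _ (fun i _ => H i)) _.
rewrite -mulr_sumr big_split /=.
have -> : \sum_(i < d.+1) g (d - i)%N = \sum_(i < d.+1) g i.
  rewrite [RHS](reindex_inj rev_ord_inj) /=; apply: eq_bigr => i _.
  by rewrite subSS.
have S2 : \sum_(i < d.+1) g i <= 2.
  by apply: le_trans (sum_inv_sqr _) _; rewrite lerBlDr lerDl invr_ge0.
apply: (@le_trans _ _ (c * 4)); first by apply: ler_wpM2l => //; lra.
rewrite /c /lax invfM -mulrA mulrCA [X in _ <= X]invfM mulrC.
have -> : (32 : R)^-1 * 4 = 8^-1 by lra.
apply: ler_wpM2l; first by rewrite invr_ge0.
rewrite lef_pV2 ?posrE ?exprn_gt0 //; try lra.
Qed.

Lemma laxS d : lax d <= 4 * lax d.+1.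
Proof.
rewrite /lax -[d.+1%:R]natr1; have : 0 <= d%:R :> R by [].
move: (d%:R : R) => x x0; rewrite -subr_ge0.
have x1 : x + 1 != 0 by rewrite gt_eqF //; lra.
have x2 : x + 1 + 1 != 0 by rewrite gt_eqF //; lra.
have -> : 4 * (8 * (x + 1 + 1) ^+ 2)^-1 - (8 * (x + 1) ^+ 2)^-1 =
  (3 * x + 4) * x * ((8 * (x + 1) ^+ 2) * (x + 1 + 1) ^+ 2)^-1.
  by field; rewrite x1 x2.
rewrite !mulr_ge0 ?invr_ge0 ?mulr_ge0 ?exprn_ge0 //; lra.
Qed.

Lemma lax_le1 d : lax d <= 1.
Proof.
rewrite invf_le1 ?mulr_gt0 ?exprn_gt0 ?ltr_wpDl //.
have d0 : 0 <= d%:R :> R by [].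
have : 1 <= (d%:R + 1 : R) ^+ 2 by apply: exprn_ege1; lra.
lra.
Qed.

(** Passing from plain geometric bounds to weighted ones only costs a factor 4
   in the rate of growth. *)
Lemma lax_ge d : 8^-1 * (4 ^+ d)^-1 <= lax d.
Proof.
rewrite /lax invfM ler_wpM2l ?invr_ge0 //.
rewrite lef_pV2 ?posrE ?exprn_gt0 ?ltr_wpDl // natr1 -!natrX ler_nat.
by rewrite -[4%N]/(2 ^ 2)%N -expnM mulnC expnM leq_exp2r // ltn_expl.
Qed.

End Weights.

(** * The Cauchy-Kovalevskaya theorem for formal series *)

Section CauchyKovalevskaya.
Context {R : realType} {n : nat} (tau : 'I_n.+1).
Local Notation I := 'I_n.+1.
Local Notation jet := (jet R n).
Local Notation agr := (@agree R n (count_mem tau)).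

Definition weight (L : R) d : R := L ^+ d * (d`!%:R * lax d).

(** L measures the growth in all directions and kap the additional growth along
   tau; e shifts the weight by the number of derivatives that may be lost. *)
Definition wball (e : nat) (L kap K : R) (U : jet) := forall w,
  `|U w| <= K * (kap ^+ count_mem tau w * weight L (size w + e)).

Section Balls.
Variables (L : R) (L1 : 1 <= L).
Let L0 : 0 <= L := le_trans ler01 L1.

Lemma weight_ge0 d : 0 <= weight L d.
Proof.
by rewrite !mulr_ge0 ?exprn_ge0 ?ler0n // ltW ?lax_gt0.
Qed.

Lemma weightS d : weight L d <= 4 * weight L d.+1.
Proof.
have l0 k : 0 <= lax k :> R by rewrite ltW ?lax_gt0.
rewrite /weight [X in _ <= X]mulrCA; apply: ler_pM; rewrite ?exprn_ge0 ?mulr_ge0 //.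
  by rewrite exprS ler_peMl // exprn_ge0.
rewrite [X in _ <= X]mulrCA; apply: ler_pM => //; last exact: laxS.
by rewrite ler_nat factS leq_pmull.
Qed.

(** This makes weighted balls closed under products. *)
Lemma weight_conv d e :
  \sum_(i < d.+1) 'C(d, i)%:R * (weight L i * weight L (d - i + e)) <= weight L (d + e).
Proof.
have l0 k : 0 <= lax k :> R by rewrite ltW ?lax_gt0.
have H (i : 'I_d.+1) : 'C(d, i)%:R * (weight L i * weight L (d - i + e)) <=
   L ^+ (d + e) * (d + e)`!%:R * (lax i * lax (d + e - i)).
  have id : (i <= d)%N by rewrite -ltnS.
  have -> : (d + e - i = d - i + e)%N by rewrite addnBAC.
  have -> : L ^+ (d + e) = L ^+ i * L ^+ (d - i + e) by rewrite -exprD addnA subnKC.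
  rewrite /weight.
  have -> : forall (c a b x y f g : R),
     c * (a * (x * f) * (b * (y * g))) = a * b * (f * g) * (c * x * y).
    by move=> *; ring.
  rewrite [X in _ <= X]mulrAC; apply: ler_wpM2l.
    by rewrite !mulr_ge0 ?exprn_ge0 ?l0.
  rewrite -!natrM ler_nat -mulnA -(@bin_fact (d + e) i) ?(leq_trans id (leq_addr e d)) //.
  by rewrite addnBAC // leq_mul2r leq_bin2l ?orbT // leq_addr.
apply: le_trans (ler_sum _ (fun i _ => H i)) _.
rewrite -mulr_sumr -mulrA; apply: ler_wpM2l; first by rewrite exprn_ge0.
apply: ler_wpM2l => //; apply: le_trans (lax_conv _).
rewrite -addSn (big_ord_widen _ (fun i => lax i * lax (d + e - i)) (leq_addr e d.+1)).
rewrite big_mkcond /=; apply: ler_sum => i _.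
by case: ifP => // _; rewrite mulr_ge0.
Qed.

Variables (kap : R) (kap1 : 1 <= kap).
Let kap0 : 0 < kap := lt_le_trans ltr01 kap1.
Let kap0' : 0 <= kap := ltW kap0.

Lemma wball_le e K K' U : K <= K' -> wball e L kap K U -> wball e L kap K' U.
Proof.
move=> KK h w; apply: le_trans (h w) _; apply: ler_wpM2r => //.
by rewrite mulr_ge0 ?weight_ge0 ?exprn_ge0.
Qed.

Lemma wballD e K K' U V : wball e L kap K U -> wball e L kap K' V ->
  wball e L kap (K + K') (U + V).
Proof.
move=> hU hV w; rewrite jcoefD mulrDl (le_trans (ler_normD _ _)) //.
by rewrite lerD // ?hU ?hV.
Qed.

Lemma wballN e K U : wball e L kap K U -> wball e L kap K (- U).
Proof. by move=> hU w; rewrite jcoefN normrN; apply: hU. Qed.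

Lemma wballM e K K' U V : 0 <= K -> 0 <= K' ->
  wball 0 L kap K U -> wball e L kap K' V -> wball e L kap (K * K') (U * V).
Proof.
move=> K0 K'0 hU hV w.
apply: le_trans (@mul_majorant R n tau kap (fun d => K * weight L d)
   (fun d => K' * weight L (d + e)) U V w kap0' _ _) _.
- by move=> v; rewrite mulrCA -[size v]addn0; apply: hU.
- by move=> v; rewrite mulrCA; apply: hV.
rewrite [X in _ <= X]mulrCA; apply: ler_wpM2l; first by rewrite exprn_ge0.
apply: le_trans (ler_wpM2l (mulr_ge0 K0 K'0) (weight_conv (size w) e)).
rewrite mulr_sumr le_eqVlt; apply/orP; left; apply/eqP.
by apply: eq_bigr => i _ /=; ring.
Qed.

(** A derivative transverse to tau moves the bound from shift 0 to shift 1. *)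
Lemma wball_deriv K U j : j != tau -> wball 0 L kap K U ->
  wball 1 L kap K (jderiv j U).
Proof.
move=> jt hU w; apply: le_trans (hU (j :: w)) _.
by rewrite /= (negPf jt) add0n addn0 addn1.
Qed.

(** Integrating along tau undoes the shift and gains a factor 1 / kap, the
   source of smallness in the existence theorem. *)
Lemma wball_jint K U : 0 <= K -> wball 1 L kap K U -> wball 0 L kap (K / kap) (jint tau U).
Proof.
move=> K0 hU w.
rewrite /=; case: ifP => tw; last first.
  by rewrite normr0 !mulr_ge0 ?weight_ge0 ?exprn_ge0 ?invr_ge0 ?(ltW kap0).
apply: le_trans (hU _) _.
have c0 : (0 < count_mem tau w)%N by rewrite -has_count has_pred1.
have s0 : (0 < size w)%N by case: w tw c0.
have kE : kap ^+ count_mem tau w = kap * kap ^+ (count_mem tau w).-1.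
  by rewrite -exprS prednK.
rewrite count_rem tw /= eqxx size_rem // addn1 addn0 prednK // subn1 kE.
by rewrite le_eqVlt; apply/orP; left; apply/eqP; field; rewrite gt_eqF.
Qed.

Lemma wball_up K U : 0 <= K -> wball 0 L kap K U -> wball 1 L kap (4 * K) U.
Proof.
move=> K0 hU w; apply: le_trans (hU w) _; rewrite [4 * K]mulrC -mulrA.
apply: ler_wpM2l => //; rewrite [X in _ <= X]mulrCA; apply: ler_wpM2l.
  by rewrite exprn_ge0.
by rewrite addn0 addn1 weightS.
Qed.

Lemma wball_kap K U : 0 <= K -> wball 0 L 1 K U -> wball 0 L kap K U.
Proof.
move=> K0 h w; apply: le_trans (h w) _; apply: ler_wpM2l => //.
by apply: ler_wpM2r; rewrite ?weight_ge0 // expr1n exprn_ege1.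
Qed.

End Balls.

Section Admissible.
Variables (L : R) (L1 : 1 <= L) (T : finType).

(** The operators that the existence theorem can handle: causal in the order of
   differentiation along tau, and bounded uniformly in kap. *)
Definition admissible e (A : (T -> jet) -> jet) :=
  (forall k u v, (forall i, agr k (u i) (v i)) -> agr k (A u) (A v)) /\
  forall K, 0 <= K -> exists2 K', 0 <= K' & forall kap, 1 <= kap ->
    forall u, (forall i, wball 0 L kap K (u i)) -> wball e L kap K' (A u).

Lemma adm_const K U : 0 <= K -> wball 0 L 1 K U -> admissible 0 (fun=> U).
Proof.
move=> K0 hU; split=> // K' _; exists K => // kap kap1 u _; exact: wball_kap.
Qed.

Lemma adm_proj i : admissible 0 (fun u => u i).
Proof. by split=> [k u v h|K K0]; [exact: h|exists K]. Qed.

Lemma adm_deriv i j : j != tau -> admissible 1 (fun u => jderiv j (u i)).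
Proof.
move=> jt; split=> [k u v h|K K0]; first exact/agree_deriv_neq/h.
by exists K => // kap kap1 u hu; apply: wball_deriv.
Qed.

Lemma admD e A B : admissible e A -> admissible e B ->
  admissible e (fun u => A u + B u).
Proof.
move=> [Ac Ab] [Bc Bb]; split=> [k u v h|K K0].
  by apply: agreeD; [apply: Ac|apply: Bc].
have [K1 K10 h1] := Ab _ K0; have [K2 K20 h2] := Bb _ K0.
exists (K1 + K2) => [|kap kap1 u hu]; first exact: addr_ge0.
by apply: wballD; [apply: h1|apply: h2].
Qed.

Lemma admN e A : admissible e A -> admissible e (fun u => - A u).
Proof.
move=> [Ac Ab]; split=> [k u v h|K K0]; first by apply: agreeN; apply: Ac.
have [K1 K10 h1] := Ab _ K0; exists K1 => // kap kap1 u hu.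
by apply: wballN; apply: h1.
Qed.

Lemma admM e A B : admissible 0 A -> admissible e B ->
  admissible e (fun u => A u * B u).
Proof.
move=> [Ac Ab] [Bc Bb]; split=> [k u v h|K K0].
  by apply: agreeM; [apply: Ac|apply: Bc].
have [K1 K10 h1] := Ab _ K0; have [K2 K20 h2] := Bb _ K0.
exists (K1 * K2) => [|kap kap1 u hu]; first exact: mulr_ge0.
by apply: wballM => //; [apply: h1|apply: h2].
Qed.

Lemma adm_up A : admissible 0 A -> admissible 1 A.
Proof.
move=> [Ac Ab]; split=> // K K0; have [K1 K10 h1] := Ab _ K0.
exists (4 * K1) => [|kap kap1 u hu]; first exact: mulr_ge0.
by apply: wball_up => //; apply: h1.
Qed.

(** For kap large compared with the bounds of F on the ball of radius K0 + 1, the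
   operator u |-> phi + jint (F u) maps that ball to itself. Since it is causal,
   its fixed point needs no contraction argument: the iterates stabilize
   coefficientwise and stay in the ball. *)
Theorem cauchy_kovalevskaya (F : T -> (T -> jet) -> jet) (phi : T -> jet) K0 :
  (forall i, admissible 1 (F i)) -> 0 <= K0 -> (forall i, wball 0 L 1 K0 (phi i)) ->
  exists (u : T -> jet) (kap : R), [/\ 1 <= kap,
    forall i, u i = phi i + jint tau (F i u) &
    forall i, wball 0 L kap (K0 + 1) (u i)].
Proof.
move=> Fadm K00 hphi.
have K1 : 0 <= K0 + 1 by lra.
have {}Fadm' i : exists2 K', 0 <= K' & forall kap, 1 <= kap ->
    forall u, (forall i, wball 0 L kap (K0 + 1) (u i)) -> wball 1 L kap K' (F i u).
  by have [_ /(_ _ K1)] := Fadm i.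
pose M i := sval (cid2 (Fadm' i)).
have M0 i : 0 <= M i by rewrite /M; case: cid2.
have hM i kap : 1 <= kap -> forall u, (forall i, wball 0 L kap (K0 + 1) (u i)) ->
    wball 1 L kap (M i) (F i u) by rewrite /M; case: cid2 => ? ? h; apply: h.
(* Large enough for M i / kap <= 1, so that the primitives have bound 1. *)
pose kap := 1 + \sum_i M i.
have kap1 : 1 <= kap by rewrite lerDl sumr_ge0.
have Mk i : M i / kap <= 1.
  rewrite ler_pdivrMr ?mul1r; last by lra.
  by rewrite /kap (bigD1 i) //= addrCA lerDl addr_ge0 // sumr_ge0.
pose G u i := phi i + jint tau (F i u).
have [||u [uG uit]] := @causal_fixpoint R n T (count_mem tau) G.
- by move=> v i j w; rewrite !count_cat /=; congr addn; exact: addnCA.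
- move=> k u v uv i; apply: agreeD => //; apply: agree_jint.
  by have [+ _] := Fadm i; apply.
exists u, kap; split=> [//|i|i w]; first by rewrite -[LHS]uG.
have itball k j : wball 0 L kap (K0 + 1) (iter k G (fun=> 0) j).
  elim: k j => [|k IH] j.
    move=> v; rewrite -[X in `|X|]/((0 : jet) v).
    have -> : (0 : jet) v = 0 by case: v.
    rewrite normr0; apply: mulr_ge0 => //; apply: mulr_ge0; last exact: weight_ge0.
    exact/exprn_ge0/(le_trans ler01).
  rewrite iterS /G; apply: wballD; first exact: wball_kap.
  apply: (@wball_le L L1 kap kap1 _ _ _ _ (Mk j)).
  by apply: wball_jint => //; apply: hM.
by have [k ->] := uit i w; apply: itball.
Qed.

End Admissible.
End CauchyKovalevskaya.

(** * The ring of convergent series *)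

Section Convergent.
Context {R : realType} {n : nat}.
Local Notation I := 'I_n.+1.
Local Notation jet := (jet R n).

(** Series with a positive radius of convergence: a coefficient at w is a
   derivative, hence the factorial. *)
Definition convergent (U : jet) := exists L K : R,
  [/\ 1 <= L, 0 <= K & forall w, `|U w| <= K * (L ^+ size w * (size w)`!%:R)].

Lemma convergent_wball tau U : convergent U -> exists L0 K : R,
  [/\ 1 <= L0, 0 <= K & forall L, L0 <= L -> wball tau 0 L 1 K U].
Proof.
move=> [L [K [L1 K0 h]]]; exists (4 * L), (8 * K).
split=> [||L' LL w]; [lra|lra|].
rewrite expr1n mul1r addn0; apply: le_trans (h w) _.
set d := size w.
have H : L ^+ d <= 8 * (L' ^+ d * lax d).
  apply: (@le_trans _ _ (8 * ((4 * L) ^+ d * (8^-1 * (4 ^+ d)^-1)))).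
    rewrite exprMn le_eqVlt; apply/orP; left; apply/eqP; field.
    by rewrite expf_neq0.
  apply: ler_wpM2l => //; apply: ler_pM; rewrite ?lax_ge //.
  - by apply: exprn_ge0; lra.
  - by rewrite lerXn2r ?nnegrE //; lra.
have -> : 8 * K * weight L' d = K * ((8 * (L' ^+ d * lax d)) * d`!%:R).
  by rewrite /weight; ring.
by apply: ler_wpM2l => //; apply: ler_wpM2r.
Qed.

Lemma wball_convergent tau L kap K U : 1 <= L -> 1 <= kap -> 0 <= K ->
  wball tau 0 L kap K U -> convergent U.
Proof.
move=> L1 kap1 K0 h; exists (kap * L), K; split=> // [|w].
  by rewrite -[1]mulr1 ler_pM.
apply: le_trans (h w) _; apply: ler_wpM2l => //.
rewrite addn0 exprMn -mulrA; apply: ler_pM; rewrite ?exprn_ge0 ?weight_ge0 //; first lra.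
  by rewrite ler_weXn2l // count_size.
apply: ler_wpM2l; first by rewrite exprn_ge0 //; lra.
by rewrite ler_piMr // lax_le1.
Qed.

Lemma convergentD U V : convergent U -> convergent V -> convergent (U + V).
Proof.
move=> [L [K [L1 K0 h]]] [L' [K' [L1' K0' h']]].
have : L <= Num.max L L' by rewrite le_max lexx.
have : L' <= Num.max L L' by rewrite le_max lexx orbT.
move: (Num.max L L') => M L'M LM.
exists M, (K + K'); split=> [||w]; [lra|exact: addr_ge0|].
rewrite jcoefD mulrDl (le_trans (ler_normD _ _)) // lerD //.
- apply: le_trans (h w) _; apply: ler_wpM2l => //; apply: ler_wpM2r => //.
  by rewrite lerXn2r ?nnegrE //; lra.
- apply: le_trans (h' w) _; apply: ler_wpM2l => //; apply: ler_wpM2r => //.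
  by rewrite lerXn2r ?nnegrE //; lra.
Qed.

Lemma convergentN U : convergent U -> convergent (- U).
Proof.
by move=> [L [K [L1 K0 h]]]; exists L, K; split=> // w; rewrite jcoefN normrN.
Qed.

Lemma convergentB U V : convergent U -> convergent V -> convergent (U - V).
Proof. by move=> hU hV; apply/convergentD/convergentN. Qed.

Lemma convergentM U V : convergent U -> convergent V -> convergent (U * V).
Proof.
move=> /(convergent_wball ord0)[L [K [L1 K0 h]]] /(convergent_wball ord0)[L' [K' [L1' K0' h']]].
have LL : 1 <= Num.max L L' by rewrite le_max L1.
apply: (@wball_convergent ord0 (Num.max L L') 1 (K * K')); rewrite ?mulr_ge0 //.
by apply: wballM => //; [apply: h|apply: h']; rewrite le_max lexx ?orbT.
Qed.

Lemma convergent_const c : convergent (jconst c).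
Proof.
exists 1, `|c|; split=> // -[|j w] /=; first by rewrite expr0 fact0 !mulr1.
by rewrite normr0 !mulr_ge0 // exprn_ge0.
Qed.

Lemma convergent_deriv j U : convergent U -> convergent (jderiv j U).
Proof.
move=> [L [K [L1 K0 h]]]; exists (2 * L), (K * L); split=> [||w]; first lra.
  by rewrite mulr_ge0 //; lra.
apply: le_trans (h (j :: w)) _; rewrite -mulrA; apply: ler_wpM2l => //=.
set d := size w; rewrite exprS exprMn factS natrM.
have -> : L * L ^+ d * (d.+1%:R * d`!%:R) = d.+1%:R * (L * L ^+ d * d`!%:R) by ring.
have -> : L * (2 ^+ d * L ^+ d * d`!%:R) = 2 ^+ d * (L * L ^+ d * d`!%:R) by ring.
apply: ler_wpM2r; last by rewrite -natrX ler_nat ltn_expl.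
by rewrite !mulr_ge0 ?exprn_ge0 //; lra.
Qed.

(** The coordinate centered at the base point. *)
Definition jcoord (i : I) : jet.
Proof.
exists (fun w => if w is [:: j] then (j == i)%:R else 0).
by case=> [|k [|l v]] j k' w //=; case: v.
Defined.

Lemma jderiv_coord i j : jderiv j (jcoord i) = jconst (j == i)%:R.
Proof. by apply: jetP => -[|k w]. Qed.

Lemma convergent_coord i : convergent (jcoord i).
Proof.
exists 1, 1; split=> // w; rewrite expr1n !mul1r.
case: w => [|j [|k w]] /=; rewrite ?normr0 ?ler0n // normr_nat.
by case: eqP.
Qed.

Lemma vanishM (U V : jet) a b :
  (forall w, (size w < a)%N -> U w = 0) -> (forall w, (size w < b)%N -> V w = 0) ->
  forall w, (size w < a + b)%N -> (U * V) w = 0.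
Proof.
move=> hU hV w; elim: w U V a b hU hV => [|j w IH] U V a b hU hV.
  rewrite jcoefM_nil; case: a hU => [|a] hU; last by rewrite hU // mul0r.
  by case: b hV => [|b] hV // _; rewrite hV // mulr0.
move=> wab; rewrite jcoefM_cons; rewrite /= in wab.
rewrite (IH _ _ a.-1 b) ?(IH _ _ a b.-1) ?addr0 //.
- by move=> v va; apply: hV; case: b va {wab} => // b.
- by case: b wab {hV} => [|b] /=; rewrite ?addnS //; rewrite addn0 => /ltnW.
- by move=> v va; apply: hU; case: a va {wab} => // a.
- by case: a wab {hU} => [|a] //= /ltnW.
Qed.

(** With c = U(0) and D = U - c, the inverse solves V = (1 - D V) / c. As D
   vanishes at the base point, this recursion is causal for the degree. D has
   arbitrarily small bound e once the rate L' is large, and for e = |c| / 16 the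
   recursion preserves a ball. *)
Lemma convergent_inv U : convergent U -> U [::] != 0 ->
  exists2 V, convergent V & U * V = 1.
Proof.
move=> hU; set c := U [::] => c0.
pose D := U - jconst c.
have D0 w : (size w < 1)%N -> D w = 0.
  by case: w => // _; rewrite jcoefD jcoefN /= subrr.
have [L [K [L1 K0 hD]]] : convergent D by apply/convergentB/convergent_const.
have nc : 0 < `|c| by rewrite normr_gt0.
pose e := `|c| / 16; have e0 : 0 < e by rewrite divr_gt0.
(* The factor 4 pays for [lax_ge]; the last factor occurs at least once in each
   coefficient of D, as D vanishes at the base point, and turns K into e. *)
pose L' := 4 * L * (1 + 8 * K / e).
have Ke : 0 <= K / e by rewrite divr_ge0 // ltW.
have L'4 : 4 * L <= L' by rewrite /L' ler_peMr //; lra.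
have L'1 : 1 <= L' by lra.
have bD : wball ord0 0 L' 1 e D.
  move=> w; rewrite expr1n mul1r addn0; case: (posnP (size w)) => [w0|w0].
    by rewrite D0 ?w0 // normr0 mulr_ge0 ?weight_ge0 // ltW.
  apply: le_trans (hD w) _; move: (size w) w0 => d d0.
  have H : K * L ^+ d <= e * (L' ^+ d * (8^-1 * (4 ^+ d)^-1)).
    rewrite /L' !exprMn.
    have -> : e * (4 ^+ d * L ^+ d * (1 + 8 * K / e) ^+ d * (8^-1 * (4 ^+ d)^-1)) =
      (e / 8 * (1 + 8 * K / e) ^+ d) * L ^+ d by field; rewrite expf_neq0.
    apply: ler_wpM2r; first by rewrite exprn_ge0 //; lra.
    apply: (@le_trans _ _ (e / 8 * (1 + 8 * K / e))).
      have -> : e / 8 * (1 + 8 * K / e) = e / 8 + K by field; rewrite gt_eqF.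
      lra.
    apply: ler_wpM2l; first lra.
    by rewrite -[X in X <= _]expr1 ler_weXn2l //; lra.
  rewrite mulrA; apply: (@le_trans _ _ (e * (L' ^+ d * (8^-1 * (4 ^+ d)^-1)) * d`!%:R)).
    exact: ler_wpM2r.
  have -> : e * weight L' d = e * (L' ^+ d * lax d) * d`!%:R by rewrite /weight; ring.
  apply: ler_wpM2r => //; apply: ler_wpM2l; first exact: ltW.
  by apply: ler_wpM2l; rewrite ?lax_ge // exprn_ge0 //; lra.
have bc (x : R) : wball ord0 0 L' 1 (8 * `|x|) (jconst x : jet).
  move=> [|j w]; rewrite expr1n mul1r addn0 /=.
    rewrite /weight /= expr0 fact0 !mul1r /lax add0r expr1n mulr1.
    by rewrite mulrAC divff ?mul1r // pnatr_eq0.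
  by rewrite normr0; apply: mulr_ge0; [exact: mulr_ge0|exact: weight_ge0].
pose F (u : unit -> jet) (i : unit) := jconst c^-1 * (1 - D * u tt).
have [||u [uF uit]] := @causal_fixpoint R n unit size F.
- by move=> v i j w; rewrite !size_cat.
- move=> k u v uv i w wk; apply/eqP; rewrite -subr_eq0; apply/eqP.
  rewrite -jcoefN -jcoefD.
  have -> : F u i - F v i = jconst c^-1 * (D * (v tt - u tt)) by rewrite /F; ring.
  apply: (@vanishM _ _ 0 k.+1) => //; apply: (@vanishM _ _ 1 k) => // x xk.
  by rewrite jcoefD jcoefN uv ?subrr.
exists (u tt).
  (* The bound B = 128 / |c| solves (8 / |c|) (8 + e B) = B. *)
  have B k : wball ord0 0 L' 1 (128 / `|c|) (iter k F (fun=> 0) tt).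
    elim: k => [|k IH].
      rewrite /= -[X in wball _ _ _ _ _ X]/(jconst 0).
      by apply: (wball_le L'1 (lexx 1) _ (bc 0)); rewrite ?normr0 ?mulr0 ?divr_ge0.
    rewrite iterS /F.
    have K1 : 0 <= 128 / `|c| by rewrite divr_ge0.
    apply: (wball_le L'1 (lexx 1)); last first.
      apply: (wballM L'1 (lexx 1) _ _ (bc c^-1) (wballD (bc 1) (wballN (wballM L'1 (lexx 1) _ _ bD IH)))) => //.
      - by rewrite normr1 addr_ge0 // mulr_ge0 // ltW.
      - exact: ltW.
    rewrite normr1 normfV.
    by rewrite le_eqVlt; apply/orP; left; apply/eqP; rewrite /e; field; rewrite gt_eqF.
  apply: (@wball_convergent ord0 L' 1 (128 / `|c|)) => //.
  by move=> w; have [k ->] := uit tt w; apply: B.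
have cc : jconst c * jconst c^-1 = 1 :> jet.
  apply: jetP => -[|j w]; first by rewrite jcoefM_nil /= divff.
  by rewrite jcoefM_cons !jderiv_const mul0r mulr0 -jcoefD addr0; case: w.
have UE : U = D + jconst c by rewrite /D subrK.
have uE : u tt = jconst c^-1 * (1 - D * u tt) by rewrite -[LHS]uF.
rewrite {1}UE mulrDl {2}uE mulrA cc mul1r; ring.
Qed.

End Convergent.

(** * Mean value estimates in several variables *)

Section Calculus.
Context {R : realType}.

Definition between (s t : R) := (0 <= s <= t) || (t <= s <= 0).

Lemma between_norm s t : between s t -> `|s| <= `|t|.
Proof.
rewrite /between => /orP[] /andP[a b].
- by rewrite !ger0_norm // (le_trans a).
- by rewrite !ler0_norm ?lerN2 // (le_trans a).
Qed.

Lemma between_ball s t a b r : between s t ->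
  `|a - b| < r -> `|a + t - b| < r -> `|a + s - b| < r.
Proof. by rewrite /between !ltr_norml => /orP[] /andP[? ?] /andP[? ?] /andP[? ?]; lra. Qed.

Lemma between_trans s t u : between s t -> between t u -> between s u.
Proof. by rewrite /between => /orP[] /andP[? ?] /orP[] /andP[? ?]; lra. Qed.

(** The interval may lie on either side of 0, which is what [between] expresses. *)
Lemma MVT_le (f df : R -> R) (B t : R) :
  (forall s : R, between s t -> is_derive s 1 f (df s)) ->
  (forall s : R, between s t -> `|df s| <= B) -> `|f t - f 0| <= B * `|t|.
Proof.
move=> fd fB; have [t0|/ltW t0] := leP 0 t.
  have inb c : c \in `[0, t]%R -> between c t by rewrite in_itv /between /= => ->.
  have [||c cab] := @MVT_segment R f df 0 t t0.
  - by move=> c cab; apply/fd/inb/subset_itv_oo_cc.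
  - apply: derivable_within_continuous => c cab.
    by have [] := fd c (inb _ cab).
  by rewrite subr0 => ->; rewrite normrM ler_wpM2r // fB // inb.
have inb c : c \in `[t, 0]%R -> between c t.
  by rewrite in_itv /between /= => ->; rewrite orbT.
have [||c cab] := @MVT_segment R f df t 0 t0.
- by move=> c cab; apply/fd/inb/subset_itv_oo_cc.
- apply: derivable_within_continuous => c cab.
  by have [] := fd c (inb _ cab).
by rewrite sub0r distrC => ->; rewrite normrM normrN ler_wpM2r // fB // inb.
Qed.

Lemma taylor1_le (f f1 f2 : R -> R) (B t : R) :
  (forall s : R, between s t -> is_derive s 1 f (f1 s)) ->
  (forall s : R, between s t -> is_derive s 1 f1 (f2 s)) ->
  (forall s : R, between s t -> `|f2 s| <= B) ->
  `|f t - f 0 - t * f1 0| <= B * t ^+ 2.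
Proof.
move=> d1 d2 f2B.
have B0 : 0 <= B.
  apply: le_trans (normr_ge0 _) (f2B 0 _).
  by rewrite /between !lexx !andbT le_total.
have -> : B * t ^+ 2 = (B * `|t|) * `|t| by rewrite -mulrA -normrM ger0_norm ?sqr_ge0.
have := @MVT_le (fun s => f s - s * f1 0) (fun s => f1 s - f1 0) (B * `|t|) t.
rewrite mul0r subr0 (addrAC (f t)); apply=> s st.
  have ds := d1 _ st.
  have := @is_deriveB _ _ _ f (fun s => s * f1 0) s 1 _ (f1 0) ds _; apply.
  have -> : (fun s : R => s * f1 0) = f1 0 \*: (@id R).
    by apply/funext => x /=; rewrite /GRing.scale /= mulrC.
  by have := @is_deriveZ _ _ _ (@id R) (f1 0) s 1 1 _; rewrite /GRing.scale /= mulr1; apply.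
apply: le_trans (MVT_le (df := f2) _ _) _.
- by move=> u us; apply: d2; apply: between_trans us st.
- by move=> u us; apply: f2B; apply: between_trans us st.
- by rewrite ler_wpM2l // between_norm.
Qed.

Lemma is_derive_line (V : normedModType R) (f : V -> R) (x e : V) (s df : R) :
  is_derive (x + s *: e) e f df -> is_derive s 1 (fun s => f (x + s *: e)) df.
Proof.
move=> [fd fv].
have E : (fun h : R => h^-1 *: ((f \o shift (x + s *: e)) (h *: e) - f (x + s *: e))) =
  (fun h : R => h^-1 *: (((fun s => f (x + s *: e)) \o shift s) (h *: 1) - f (x + s *: e))).
  by apply/funext => h /=; rewrite scalerDl addrCA (_ : h *: (1 : R) = h) //; exact: mulr1.
by split; [rewrite /derivable -E|rewrite -fv /derive -E].
Qed.

Context {n : nat}.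
Local Notation pt := 'rV[R]_n.+1.
Local Notation e i := (delta_mx 0 i : pt).

Lemma coord_le_norm (x : pt) i : `|x 0 i| <= `|x|.
Proof.
rewrite {2}/Num.Def.normr /= mx_normrE.
by apply: le_trans (le_bigmax _ (fun i => `|x i.1 i.2|) (0, i)).
Qed.

Lemma norm_le_coord (x : pt) (B : R) : 0 <= B -> (forall i, `|x 0 i| <= B) -> `|x| <= B.
Proof.
move=> B0 h; rewrite /Num.Def.normr /= mx_normrE; apply: bigmax_le => // -[i j] _ /=.
by rewrite ord1.
Qed.

Lemma norm_lt_coord (x : pt) (B : R) : 0 < B -> (forall i, `|x 0 i| < B) -> `|x| < B.
Proof.
move=> B0 h; rewrite /Num.Def.normr /= mx_normrE; apply: bigmax_lt => // -[i j] _ /=.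
by rewrite ord1.
Qed.

(** Walk from x to y one coordinate at a time; the norm is the supremum norm, so
   the intermediate points stay in the ball. *)
Lemma partial_lipschitz (f : pt -> R) (df : 'I_n.+1 -> pt -> R) (x0 : pt) (r B : R) :
  (forall x i, `|x - x0| < r -> is_derive x (e i) f (df i x)) ->
  (forall x i, `|x - x0| < r -> `|df i x| <= B) ->
  forall x y, `|x - x0| < r -> `|y - x0| < r ->
    `|f y - f x| <= n.+1%:R * B * `|y - x|.
Proof.
move=> fd fB x y xr yr.
have r0 : 0 < r by apply: le_lt_trans xr.
have B0 : 0 <= B by apply: le_trans (fB x ord0 xr).
pose z k : pt := \row_j (if (j < k)%N then y 0 j else x 0 j).
have zS (i : 'I_n.+1) : z i.+1 = z i + (y 0 i - x 0 i) *: e i.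
  apply/rowP => j; rewrite !mxE eqxx /= ltnS leq_eqVlt.
  have [->|ij] := eqVneq j i; first by rewrite eqxx ltnn mulr1; ring.
  by rewrite (inj_eq val_inj) (negPf ij) mulr0 addr0.
have zr (i : 'I_n.+1) (s : R) : between s (y 0 i - x 0 i) -> `|(z i + s *: e i) - x0| < r.
  move=> hs; apply: norm_lt_coord => // j; rewrite !mxE eqxx /=.
  have xj : `|x 0 j - x0 0 j| < r.
    by apply: le_lt_trans xr; have := coord_le_norm (x - x0) j; rewrite !mxE.
  have yj : `|y 0 j - x0 0 j| < r.
    by apply: le_lt_trans yr; have := coord_le_norm (y - x0) j; rewrite !mxE.
  have [ij|ij] := eqVneq j i; last by rewrite mulr0 addr0; case: ifP.
  rewrite ij ltnn mulr1 -ij; rewrite -ij in hs.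
  by apply: between_ball hs xj _; rewrite (addrC (x 0 j)) subrK.
have step (i : 'I_n.+1) : `|f (z i.+1) - f (z i)| <= B * `|y - x|.
  rewrite zS; set t := y 0 i - x 0 i.
  have := @MVT_le (fun s => f (z i + s *: e i)) (fun s => df i (z i + s *: e i)) B t.
  rewrite scale0r addr0 => H; apply: le_trans (H _ _) _.
  - by move=> s st; apply/is_derive_line/fd/zr.
  - by move=> s st; apply/fB/zr.
  - by rewrite ler_wpM2l //; have := coord_le_norm (y - x) i; rewrite !mxE.
have -> : f y - f x = \sum_(i < n.+1) (f (z i.+1) - f (z i)).
  rewrite -(big_mkord xpredT (fun i => f (z i.+1) - f (z i))) telescope_sumr //.
  by congr (f _ - f _); apply/rowP => j; rewrite mxE ?ltn_ord.
apply: le_trans (ler_norm_sum _ _ _) _.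
apply: le_trans (ler_sum _ (fun i _ => step i)) _.
by rewrite sumr_const card_ord -[X in X <= _]mulr_natl mulrA.
Qed.

Lemma partial_continuous (f : pt -> R) (df : 'I_n.+1 -> pt -> R) (x0 : pt) (r B : R) :
  0 < r -> (forall x i, `|x - x0| < r -> is_derive x (e i) f (df i x)) ->
  (forall x i, `|x - x0| < r -> `|df i x| <= B) -> {for x0, continuous f}.
Proof.
move=> r0 fd fB; apply/(@cvgrPdist_le _ _ _ (nbhs x0)) => /= eps eps0.
have x00 : `|x0 - x0| < r by rewrite subrr normr0.
have B0 : 0 <= B by apply: le_trans (fB x0 ord0 x00).
have c0 : 0 < n.+1%:R * B + 1 by rewrite ltr_wpDl // mulr_ge0.
apply/nbhs_ballP; exists (Num.min r (eps / (n.+1%:R * B + 1))).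
  by rewrite /= lt_min r0 divr_gt0.
move=> x; rewrite -ball_normE /= lt_min distrC => /andP[xr h]; rewrite distrC.
apply: le_trans (partial_lipschitz fd fB x00 xr) _.
move: h; rewrite ltr_pdivlMr // => /ltW h; apply: le_trans h.
by rewrite mulrC ler_wpM2l // lerDl.
Qed.

End Calculus.

(** * Series with geometric decay *)

Section Geometric.
Context {R : realType}.
Local Notation q := (4^-1 : R).

Lemma series_recr (u : nat -> R) N : series u N.+1 = series u N + u N.
Proof. by rewrite /series /= big_nat_recr. Qed.

Lemma cvg_norm_le (u : nat -> R) (l c : R) :
  u @ \oo --> l -> (forall N, `|u N| <= c) -> `|l| <= c.
Proof.
move=> ul uc; have nl : (fun N => `|u N|) @ \oo --> `|l| by apply: cvg_norm.
rewrite -(cvg_lim _ nl) //; apply: limr_le; first by apply/cvg_ex; exists `|l|.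
exact: nearW.
Qed.

Variables (a : nat -> R) (M : R).
Hypothesis aM : forall d, `|a d| <= M * q ^+ d.

Lemma geo_part k m : (k <= m)%N -> `|series a m - series a k| <= 2 * M * (q ^+ k - q ^+ m).
Proof.
have M0 : 0 <= M by have := aM 0; rewrite expr0 mulr1; apply: le_trans.
elim: m => [|m IH]; first by rewrite leqn0 => /eqP->; rewrite !subrr normr0 mulr0.
rewrite leq_eqVlt => /predU1P[->|]; first by rewrite !subrr normr0 mulr0.
rewrite ltnS => /IH {}IH.
have -> : series a m.+1 - series a k = (series a m - series a k) + a m.
  by rewrite series_recr; ring.
apply: le_trans (ler_normD _ _) _; apply: le_trans (lerD IH (aM m)) _.
have q0 : 0 <= q ^+ m by rewrite exprn_ge0 // invr_ge0.
have Mx : 0 <= M * q ^+ m by rewrite mulr_ge0.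
rewrite exprS -subr_ge0; move: Mx; set x := q ^+ m; set y := q ^+ k => Mx.
have -> : 2 * M * (y - 4^-1 * x) - (2 * M * (y - x) + M * x) = 2^-1 * (M * x) by field.
lra.
Qed.

Lemma geo_cvg : series a @ \oo --> limn (series a).
Proof.
apply: normed_cvg.
apply: (@series_le_cvg R _ (geometric M q)).
- by move=> d; exact: normr_ge0.
- by move=> d; apply: le_trans (aM d).
- by move=> d; exact: aM.
- by apply: is_cvg_geometric_series; rewrite ger0_norm ?invr_ge0 // invf_lt1 // ltr1n.
Qed.

Lemma geo_tail k : `|limn (series a) - series a k| <= 2 * M * q ^+ k.
Proof.
have M0 : 0 <= M by have := aM 0; rewrite expr0 mulr1; apply: le_trans.
apply: (@cvg_norm_le (fun N => series a (N + k)%N - series a k)).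
  apply: cvgB; last exact: cvg_cst.
  by have := geo_cvg; rewrite -(cvg_shiftn k).
move=> N; apply: le_trans (geo_part (leq_addl N k)) _.
apply: ler_wpM2l; first exact: mulr_ge0.
by rewrite lerBlDr lerDl exprn_ge0 // invr_ge0.
Qed.

End Geometric.

(** The difference between the N-th partial sum and (the N-th partial sum of a) times
   the sum of b is a sum of N terms of size 4^-N. *)
Lemma cauchy_product {R : realType} (a b : nat -> R) (M M' : R) :
  (forall d, `|a d| <= M * 4^-1 ^+ d) -> (forall d, `|b d| <= M' * 4^-1 ^+ d) ->
  series (fun d => \sum_(i < d.+1) a i * b (d - i)%N) @ \oo -->
  limn (series a) * limn (series b).
Proof.
move=> aM bM.
have M0 : 0 <= M by have := aM 0; rewrite expr0 mulr1; apply: le_trans.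
have M'0 : 0 <= M' by have := bM 0; rewrite expr0 mulr1; apply: le_trans.
set B := limn (series b); set c := fun d => _.
have cE N : series c N = \sum_(i < N) a i * series b (N - i)%N.
  elim: N => [|N IH]; first by rewrite /series /= big_geq // big_ord0.
  rewrite series_recr IH big_ord_recr /= subSnn.
  rewrite /c big_ord_recr /= subnn addrA -big_split /=; congr (_ + _ * _).
    apply: eq_bigr => i _; rewrite -mulrDr; congr (_ * _).
    by rewrite subSn ?(ltnW (ltn_ord i)) // series_recr.
  by rewrite series_recr /series /= big_geq // add0r.
have key N : `|series c N - series a N * B| <= 2 * M * M' * (2^-1) ^+ N.
  have -> : series c N - series a N * B = \sum_(i < N) a i * (series b (N - i)%N - B).
    rewrite cE [series a N]/series /= big_mkord mulr_suml -sumrB; apply: eq_bigr => i _.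
    by rewrite mulrBr.
  apply: le_trans (ler_norm_sum _ _ _) _.
  apply: (@le_trans _ _ (\sum_(i < N) 2 * M * M' * 4^-1 ^+ N)).
    apply: ler_sum => i _; rewrite normrM distrC.
    apply: le_trans (ler_pM _ _ (aM i) (geo_tail bM (N - i)%N)) _ => //.
    rewrite -[in leRHS](subnKC (ltnW (ltn_ord i))) exprD le_eqVlt; apply/orP; left.
    by apply/eqP; ring.
  rewrite sumr_const card_ord -[leLHS]mulr_natr -[leLHS]mulrA; apply: ler_wpM2l.
    by rewrite !mulr_ge0.
  have -> : (4^-1 : R) = 2^-1 * 2^-1 by field.
  rewrite exprMn -mulrA -[leRHS]mulr1; apply: ler_wpM2l.
    by rewrite exprn_ge0 // invr_ge0.
  rewrite exprVn mulrC ler_pdivrMr ?exprn_gt0 // mul1r -natrX ler_nat.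
  exact/ltnW/ltn_expl.
have z : (fun N => 2 * M * M' * (2^-1) ^+ N) @ \oo --> (0 : R).
  by apply: cvg_geometric; rewrite ger0_norm ?invr_ge0 // invf_lt1 // ltr1n.
have d0 : (fun N => series c N - series a N * B) @ \oo --> (0 : R).
  apply/norm_cvg0P; apply: (squeeze_cvgr _ (cvg_cst 0) z).
  by apply: nearW => N; rewrite normr_ge0 key.
have -> : series c = (fun N => (series c N - series a N * B) + series a N * B).
  by apply/funext => N; rewrite subrK.
rewrite -[X in _ --> X]add0r; apply: cvgD => //.
by apply: cvgM; [exact: geo_cvg aM|exact: cvg_cst].
Qed.

(** * Smoothness by coinduction; partial sums of a series *)

Section SmoothCoind.
Context {R : realType} {n : nat}.
Local Notation pt := 'rV[R]_n.+1.
Local Notation e i := (delta_mx 0 i : pt).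

(** A class of functions whose partial derivatives stay in the class consists of
   smooth functions. The iterated derivatives of [smooth_on] are total functions,
   equal to members of the class on V only; openness of V lets one
   differentiate these equalities. *)
Lemma smooth_coind (V : set pt) (K : (pt -> R) -> Prop) : open V ->
  (forall f, K f -> (forall x, V x -> {for x, continuous f}) /\
     forall i, exists2 g, K g & forall x, V x -> is_derive x (e i) f (g x)) ->
  forall f, K f -> smooth_on V f.
Proof.
move=> oV hK f Kf.
have nV x : V x -> \forall y \near x, V y by move=> Vx; apply: open_nbhs_nbhs.
have it s : exists2 g, K g & forall x, V x -> iter_partial s f x = g x.
  elim: s => [|i s [g Kg fg]]; first by exists f.
  have [_ /(_ i)[g' Kg' gg']] := hK _ Kg; exists g' => // x Vx /=.
  have [_ <-] := gg' _ Vx; apply: near_eq_derive.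
  by near=> y; apply: fg; near: y; exact: nV.
move=> s x Vx; have [g Kg fg] := it s.
have fgx : \near x, g x = iter_partial s f x.
  by near=> y; rewrite fg //; near: y; exact: nV.
have [gc gd] := hK _ Kg; split.
  suff : iter_partial s f @ x --> iter_partial s f x by [].
  rewrite [X in _ --> X]fg //; apply: cvg_trans (gc _ Vx).
  by apply: (@near_eq_cvg _ _ (nbhs x) _ g (iter_partial s f)); exact: fgx.
move=> i; have [g' _ gg'] := gd i; have [gd' _] := gg' _ Vx.
by apply: near_eq_derivable gd'.
Unshelve. all: by end_near. Qed.

End SmoothCoind.

Section Evaluation.
Context {R : realType} {n : nat}.
Local Notation I := 'I_n.+1.
Local Notation jet := (jet R n).
Local Notation pt := 'rV[R]_n.+1.
Local Notation e i := (delta_mx 0 i : pt).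

(** Homogeneous parts of the Taylor series. Euler's identity
   d h_d = sum_j h_j (D_j h)_(d-1) serves as definition, which avoids
   multi-indices. *)
Fixpoint hom d (U : jet) (h : pt) : R :=
  if d is d'.+1 then d%:R^-1 * \sum_(j < n.+1) h 0 j * hom d' (jderiv j U) h
  else U [::].

Lemma homS d U h :
  d.+1%:R * hom d.+1 U h = \sum_(j < n.+1) h 0 j * hom d (jderiv j U) h.
Proof. by rewrite /= mulVKf. Qed.

Lemma homD d U V h : hom d (U + V) h = hom d U h + hom d V h.
Proof.
elim: d U V => // d IH U V /=; rewrite -mulrDr -big_split /=; congr (_ * _).
by apply: eq_bigr => j _; rewrite jderivD IH mulrDr.
Qed.

Lemma homN d U h : hom d (- U) h = - hom d U h.
Proof.
elim: d U => // d IH U /=; rewrite -mulrN -sumrN; congr (_ * _).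
by apply: eq_bigr => j _; rewrite raddfN IH mulrN.
Qed.

(** Euler's operator is a derivation, and it multiplies the part of degree d by d. *)
Lemma homM d U V h :
  hom d (U * V) h = \sum_(i < d.+1) hom i U h * hom (d - i)%N V h.
Proof.
elim: d U V => [|d IH] U V; first by rewrite big_ord1; exact: jcoefM_nil.
apply: (@mulfI _ d.+1%:R); first by rewrite pnatr_eq0.
rewrite homS.
have -> : \sum_(j < n.+1) h 0 j * hom d (jderiv j (U * V)) h =
   \sum_(i < d.+1) i.+1%:R * hom i.+1 U h * hom (d - i)%N V h +
   \sum_(i < d.+1) hom i U h * ((d - i).+1%:R * hom (d - i).+1 V h).
  under [X in _ = X + _]eq_bigr do rewrite homS mulr_suml.
  under [X in _ = _ + X]eq_bigr do rewrite homS mulr_sumr.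
  rewrite [X in _ = X + _]exchange_big /=.
  rewrite [X in _ = _ + X]exchange_big /= -big_split /=; apply: eq_bigr => j _.
  rewrite jderiv_mul homD !IH mulrDr !mulr_sumr; congr (_ + _).
    by apply: eq_bigr => i _; rewrite mulrA.
  by apply: eq_bigr => i _; rewrite mulrCA.
have -> : \sum_(i < d.+1) i.+1%:R * hom i.+1 U h * hom (d - i) V h =
   \sum_(i < d.+2) i%:R * hom i U h * hom (d.+1 - i)%N V h.
  by rewrite [RHS]big_ord_recl !mul0r add0r; apply: eq_bigr => i _.
have -> : \sum_(i < d.+1) hom i U h * ((d - i).+1%:R * hom (d - i).+1 V h) =
   \sum_(i < d.+2) hom i U h * ((d.+1 - i)%:R * hom (d.+1 - i)%N V h).
  rewrite [RHS]big_ord_recr /= subnn mul0r mulr0 addr0; apply: eq_bigr => i _.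
  by rewrite subSn // -ltnS.
rewrite -big_split /= mulr_sumr; apply: eq_bigr => i _.
have -> : d.+1%:R = i%:R + (d.+1 - i)%:R :> R by rewrite -natrD subnKC // -ltnS.
by ring.
Qed.

Definition psum N U h := series (fun d => hom d U h) N.
Definition jsum U h : R := limn (series (fun d => hom d U h)).

Lemma is_derive_coord (x : pt) j k :
  is_derive x (e j) (fun h : pt => h 0 k) (j == k)%:R.
Proof.
have E : \forall h \near 0^', h^-1 *: ((h *: e j + x) 0 k - x 0 k) = (j == k)%:R :> R.
  near=> h; have h0 : h != 0 by near: h; exact: nbhs_dnbhs_neq.
  by rewrite !mxE eqxx /= addrK /GRing.scale /= mulKf // eq_sym.
by split; [apply: (is_cvg_near_cst _ E) | apply/lim_near_cst].
Unshelve. all: by end_near. Qed.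

Lemma is_derive_mul (f g : pt -> R) (x v : pt) (df dg : R) :
  is_derive x v f df -> is_derive x v g dg ->
  is_derive x v (fun y => f y * g y) (f x * dg + df * g x).
Proof.
move=> hf hg; have := @is_deriveM _ _ f g x v df dg hf hg.
by rewrite /GRing.scale /= [g x * df]mulrC.
Qed.

Lemma is_derive_sum' (T : finType) (f : T -> pt -> R) (x v : pt) (df : T -> R) :
  (forall i, is_derive x v (f i) (df i)) ->
  is_derive x v (fun y => \sum_i f i y) (\sum_i df i).
Proof.
move=> hf; rewrite /index_enum; elim: (Finite.enum T) => [|i s IH].
  rewrite big_nil; have -> : (fun y => \sum_(i <- [::]) f i y) = cst 0.
    by apply/funext => y; rewrite big_nil.
  exact: is_derive_cst.
rewrite big_cons; have -> : (fun y => \sum_(j <- i :: s) f j y) =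
    f i + (fun y => \sum_(j <- s) f j y).
  by apply/funext => y; rewrite big_cons.
exact: is_deriveD.
Qed.

Lemma hom_derive d U (x : pt) j :
  is_derive x (e j) (hom d U) (if d is d'.+1 then hom d' (jderiv j U) x else 0).
Proof.
elim: d U => [|d IH] U; first exact: is_derive_cst.
have dk (k : I) := is_derive_mul (is_derive_coord x j k) (IH (jderiv k U)).
have := is_derive_mul (is_derive_cst (d.+1%:R^-1 : R) x (e j)) (is_derive_sum' dk).
rewrite mul0r addr0 big_split /=.
set s1 := \sum_i _; set s2 := \sum_i _.
have -> : s2 = hom d (jderiv j U) x.
  rewrite /s2 (bigD1 j) //= eqxx mul1r big1 ?addr0 // => k kj.
  by rewrite eq_sym (negPf kj) mul0r.
suff -> : s1 = d%:R * hom d (jderiv j U) x.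
  rewrite -{2}[hom d _ _]mul1r -mulrDl natr1 mulKf ?pnatr_eq0 //; exact.
rewrite /s1; case: d {s1 s2 dk IH} => [|d].
  by rewrite mul0r big1 // => k _; rewrite mulr0.
by rewrite homS; apply: eq_bigr => k _; rewrite jderivC.
Qed.

Lemma psum_derive N U (x : pt) j :
  is_derive x (e j) (psum N.+1 U) (psum N (jderiv j U) x).
Proof.
have -> : psum N.+1 U = fun y => \sum_(d < N.+1) hom d U y.
  by apply/funext => y; rewrite /psum /series /= big_mkord.
have := is_derive_sum' (fun d : 'I_N.+1 => hom_derive d U x j).
by rewrite big_ord_recl add0r /psum /series /= big_mkord.
Qed.

End Evaluation.

(** * Sums of convergent series on a small ball *)

Section Bounded.
Context {R : realType} {n : nat}.
Local Notation I := 'I_n.+1.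
Local Notation jet := (jet R n).
Local Notation pt := 'rV[R]_n.+1.
Local Notation e i := (delta_mx 0 i : pt).

(** Unlike in [convergent], the rate L is fixed and the shift p is free. For a
   fixed L this class is closed under ring operations and derivations, so that
   one ball serves all the series obtained from finitely many ones. *)
Definition gevrey (L : R) (U : jet) := exists (K : R) p,
  0 <= K /\ forall w, `|U w| <= K * (L ^+ size w * (size w + p)`!%:R).

Section Closure.
Variables (L : R) (L0 : 0 <= L).

Lemma gevrey_deriv j U : gevrey L U -> gevrey L (jderiv j U).
Proof.
move=> [K [p [K0 h]]]; exists (K * L), p.+1; split=> [|w]; first exact: mulr_ge0.
apply: le_trans (h (j :: w)) _ => /=.
by rewrite addnS exprS -!mulrA.
Qed.

Lemma gevreyN U : gevrey L U -> gevrey L (- U).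
Proof.
by move=> [K [p [K0 h]]]; exists K, p; split=> // w; rewrite jcoefN normrN.
Qed.

Lemma gevreyD U V : gevrey L U -> gevrey L V -> gevrey L (U + V).
Proof.
move=> [K [p [K0 h]]] [K' [p' [K0' h']]]; exists (K + K'), (p + p')%N.
split=> [|w]; first exact: addr_ge0.
rewrite jcoefD mulrDl (le_trans (ler_normD _ _)) // lerD //.
- apply: le_trans (h w) _; apply: ler_wpM2l => //.
  apply: ler_wpM2l; first exact: exprn_ge0.
  by rewrite ler_nat leq_fact // leq_add2l leq_addr.
- apply: le_trans (h' w) _; apply: ler_wpM2l => //.
  apply: ler_wpM2l; first exact: exprn_ge0.
  by rewrite ler_nat leq_fact // leq_add2l leq_addl.
Qed.

Lemma gevreyB U V : gevrey L U -> gevrey L V -> gevrey L (U - V).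
Proof. by move=> hU hV; apply/gevreyD/gevreyN. Qed.

(** The binomial convolution of (i + p)! and (k - i + p')! equals
   p! p'! (k + p + p' + 1)! / (p + p' + 1)! by a Vandermonde identity. The
   induction on words proves it along the way: both terms of the Leibniz rule
   are instances with p or p' increased. *)
Lemma gevreyM U V : gevrey L U -> gevrey L V -> gevrey L (U * V).
Proof.
move=> [K [p [K0 h]]] [K' [p' [K0' h']]].
exists (K * K' * (p`!%:R * p'`!%:R / (p + p').+1`!%:R)), (p + p').+1.
split=> [|w]; first by rewrite !mulr_ge0 // invr_ge0.
elim: w K K' p p' U V K0 K0' h h' => [|j w IH] K K' p p' U V K0 K0' h h'.
  rewrite jcoefM_nil normrM expr0 mul1r add0n -mulrA divfK ?pnatr_eq0 -?lt0n ?fact_gt0 //.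
  have := h [::]; have := h' [::]; rewrite /= !expr0 !mul1r !add0n => u v.
  by rewrite mulrACA; apply: ler_pM.
rewrite jcoefM_cons (le_trans (ler_normD _ _)) //.
have dh v : `|jderiv j U v| <= K * L * (L ^+ size v * (size v + p.+1)`!%:R).
  by apply: le_trans (h (j :: v)) _; rewrite /= addnS exprS -!mulrA.
have dh' v : `|jderiv j V v| <= K' * L * (L ^+ size v * (size v + p'.+1)`!%:R).
  by apply: le_trans (h' (j :: v)) _; rewrite /= addnS exprS -!mulrA.
apply: le_trans (lerD (IH _ _ _ _ _ _ (mulr_ge0 K0 L0) K0' dh h')
                      (IH _ _ _ _ _ _ K0 (mulr_ge0 K0' L0) h dh')) _.
rewrite le_eqVlt; apply/orP; left; apply/eqP; set d := size w.
rewrite /= -/d !addSn !addnS ?addSn exprS.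
have E q : (q.+1)`!%:R = (q%:R + 1) * q`!%:R :> R by rewrite factS natrM natr1.
rewrite [((p + p').+2)`!%:R]E [(p.+1)`!%:R]E [(p'.+1)`!%:R]E.
have -> : (p + p').+1%:R = p%:R + p'%:R + 1 :> R by rewrite -[_.+1%:R]natr1 natrD.
have : ((p + p').+1)`!%:R != 0 :> R by rewrite pnatr_eq0 -lt0n fact_gt0.
have : p%:R + p'%:R + 1 + 1 != 0 :> R by rewrite -natrD !natr1 pnatr_eq0.
move: (p%:R : R) (p'%:R : R) (((p + p').+1)`!%:R : R) (L ^+ d) => P P' c l h1 h2.
by field; rewrite h1 h2.
Qed.

Lemma gevrey_const c : gevrey L (jconst c).
Proof.
exists `|c|, 0%N; split=> // -[|j w] /=; first by rewrite expr0 addn0 fact0 !mulr1.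
by rewrite normr0 !mulr_ge0 // exprn_ge0.
Qed.

End Closure.

Lemma convergent_gevrey U : convergent U ->
  exists L0 : R, forall L, L0 <= L -> gevrey L U.
Proof.
move=> [L [K [L1 K0 h]]]; exists L => L' LL; exists K, 0%N; split=> // w.
apply: le_trans (h w) _; rewrite addn0; apply: ler_wpM2l => //.
by apply: ler_wpM2r => //; rewrite lerXn2r ?nnegrE //; lra.
Qed.

Lemma bin_le_exp m k : ('C(m, k) <= 2 ^ m)%N.
Proof.
elim: m k => [|m IH] [|k]; rewrite ?bin0 ?expn_gt0 //.
by rewrite binS expnS mul2n -addnn leq_add.
Qed.

Section Radius.
Variables (L r : R).
Hypotheses (L0 : 0 <= L) (r0 : 0 < r) (Lr : n.+1%:R * L * r <= 8^-1).

(** By induction on d through Euler's identity; each step costs at most n + 1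
   terms, a factor L and a factor r. *)
Lemma hom_bound d (U : jet) (K : R) p (h : pt) : 0 <= K -> `|h| <= r ->
  (forall w, `|U w| <= K * (L ^+ size w * (size w + p)`!%:R)) ->
  `|hom d U h| <= K * ((n.+1%:R * L * r) ^+ d * ((d + p)`!%:R / d`!%:R)).
Proof.
move=> K0 hr; elim: d U K p K0 => [|d IH] U K p K0 hU.
  by have := hU [::]; rewrite /= !expr0 divr1.
have dh j v : `|jderiv j U v| <= K * L * (L ^+ size v * (size v + p.+1)`!%:R).
  by apply: le_trans (hU (j :: v)) _; rewrite /= addnS exprS -!mulrA.
rewrite /= normrM ger0_norm ?invr_ge0 //.
have S : `|\sum_(j < n.+1) h 0 j * hom d (jderiv j U) h| <=
    n.+1%:R * (r * (K * L * ((n.+1%:R * L * r) ^+ d * ((d + p.+1)`!%:R / d`!%:R)))).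
  apply: le_trans (ler_norm_sum _ _ _) _.
  apply: (@le_trans _ _ (\sum_(j < n.+1) (r * (K * L * ((n.+1%:R * L * r) ^+ d * ((d + p.+1)`!%:R / d`!%:R)))))).
    apply: ler_sum => j _; rewrite normrM; apply: ler_pM => //.
      exact: le_trans (coord_le_norm _ _) hr.
    by apply: IH => //; exact: mulr_ge0.
  by rewrite sumr_const card_ord -[leLHS]mulr_natl.
apply: le_trans (ler_wpM2l _ S) _; first by rewrite invr_ge0.
rewrite le_eqVlt; apply/orP; left; apply/eqP.
rewrite addnS -addSn factS natrM exprS.
have : d.+1%:R != 0 :> R by rewrite pnatr_eq0.
have : d`!%:R != 0 :> R by rewrite pnatr_eq0 -lt0n fact_gt0.
move: (d`!%:R : R) (d.+1%:R : R) (n.+1%:R : R) => a b c a0 b0.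
by field; rewrite a0 b0.
Qed.

(** The smallness of r turns the bound of [hom_bound] into a geometric one: the
   quotient of factorials is at most 2^(d + p) p!, and 2 / 8 = 1 / 4. *)
Lemma hom_geo U : gevrey L U -> exists2 M : R, 0 <= M &
  forall (h : pt) d, `|h| <= r -> `|hom d U h| <= M * 4^-1 ^+ d.
Proof.
move=> [K [p [K0 hU]]]; exists (K * (2 ^ p * p`!)%:R) => [|h d hr]; first exact: mulr_ge0.
apply: le_trans (hom_bound d K0 hr hU) _; rewrite -[leRHS]mulrA; apply: ler_wpM2l => //.
have -> : (d + p)`!%:R / d`!%:R = ('C(d + p, p) * p`!)%:R :> R.
  rewrite -(@bin_fact (d + p) p) ?leq_addl // addnK mulnA natrM mulfK //.
have nLr : 0 <= n.+1%:R * L * r by rewrite !mulr_ge0 // ltW.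
apply: (@le_trans _ _ (8^-1 ^+ d * (2 ^ (d + p) * p`!)%:R)).
  apply: ler_pM => //; rewrite ?exprn_ge0 //.
    by rewrite lerXn2r ?nnegrE // invr_ge0.
  by rewrite ler_nat leq_mul2r bin_le_exp orbT.
rewrite expnD -mulnA natrM mulrA mulrC; apply: ler_wpM2l => //.
rewrite natrX -exprMn le_eqVlt; apply/orP; left; apply/eqP; congr (_ ^+ _).
by field.
Qed.

Lemma jsum_cvg U (h : pt) : gevrey L U -> `|h| <= r ->
  series (fun d => hom d U h) @ \oo --> jsum U h.
Proof. by move=> /hom_geo[M M0 hM] hr; apply: (@geo_cvg _ _ M) => d; apply: hM. Qed.

Lemma psum_bound U : gevrey L U -> exists2 M : R, 0 <= M &
  forall (h : pt) N, `|h| <= r -> `|psum N U h| <= M.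
Proof.
move=> /hom_geo[M M0 hM]; exists (2 * M) => [|h N hr]; first exact: mulr_ge0.
have := @geo_part _ (fun d => hom d U h) M (fun d => hM h d hr) 0 N (leq0n N).
rewrite /psum [X in _ - X]/series /= big_geq // subr0 => /le_trans; apply.
rewrite ler_piMr ?mulr_ge0 // expr0 lerBlDr lerDl exprn_ge0 //.
Qed.

Lemma jsum_bound U : gevrey L U -> exists2 M : R, 0 <= M &
  forall h : pt, `|h| <= r -> `|jsum U h| <= M.
Proof.
move=> gU; have [M M0 hM] := psum_bound gU; exists M => // h hr.
by apply: cvg_norm_le (jsum_cvg gU hr) _ => N; apply: hM.
Qed.

Lemma jsumD U V (h : pt) : gevrey L U -> gevrey L V -> `|h| <= r ->
  jsum (U + V) h = jsum U h + jsum V h.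
Proof.
move=> gU gV hr; apply: cvg_lim => //.
have -> : series (fun d => hom d (U + V) h) =
   (fun N => series (fun d => hom d U h) N + series (fun d => hom d V h) N).
  apply/funext => N; rewrite /series /= -big_split /=.
  by apply: eq_bigr => d _; rewrite homD.
by apply: cvgD; apply: jsum_cvg.
Qed.

Lemma jsumN U (h : pt) : gevrey L U -> `|h| <= r -> jsum (- U) h = - jsum U h.
Proof.
move=> gU hr; apply: cvg_lim => //.
have -> : series (fun d => hom d (- U) h) = (fun N => - series (fun d => hom d U h) N).
  by apply/funext => N; rewrite /series /= -sumrN; apply: eq_bigr => d _; rewrite homN.
by apply: cvgN; apply: jsum_cvg.
Qed.

Lemma jsumM U V (h : pt) : gevrey L U -> gevrey L V -> `|h| <= r ->
  jsum (U * V) h = jsum U h * jsum V h.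
Proof.
move=> /hom_geo[M M0 hM] /hom_geo[M' M'0 hM'] hr; apply: cvg_lim => //.
rewrite (_ : (fun d => hom d (U * V) h) =
  fun d => \sum_(i < d.+1) hom i U h * hom (d - i)%N V h); last first.
  by apply/funext => d; rewrite homM.
exact: (cauchy_product (fun d => hM h d hr) (fun d => hM' h d hr)).
Qed.

Lemma hom_eq0 d (U : jet) (h : pt) :
  (forall j, hom d (jderiv j U) h = 0) -> hom d.+1 U h = 0.
Proof. by move=> H; rewrite /= big1 ?mulr0 // => j _; rewrite H mulr0. Qed.

Lemma hom_const d c (h : pt) : hom d.+1 (jconst c : jet) h = 0.
Proof.
have h0 k : hom k (0 : jet) h = 0.
  by elim: k => [//|k IH]; apply: hom_eq0 => j; rewrite raddf0.
by apply: hom_eq0 => j; rewrite jderiv_const.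
Qed.

Lemma jsum_const c (h : pt) : jsum (jconst c) h = c.
Proof.
apply: cvg_lim => //; rewrite -(cvg_shiftS (series _)) /=.
rewrite (_ : (fun N => _) = cst c); first exact: cvg_cst.
apply/funext => N; rewrite /series /= big_nat_recl // big1 ?addr0 // => d _.
exact: hom_const.
Qed.

Lemma jsum_coord i (h : pt) : jsum (jcoord i) h = h 0 i.
Proof.
apply: cvg_lim => //; rewrite -(cvg_shiftn 2 (series _)) /=.
rewrite (_ : (fun N => _) = cst (h 0 i)); first exact: cvg_cst.
apply/funext => N; rewrite addn2 /series /= big_nat_recl // big_nat_recl // big1 ?addr0 => [|d _].
  rewrite /= add0r invr1 mul1r (bigD1 i) //= eqxx mulr1 big1 ?addr0 // => j ji.
  by rewrite (negPf ji) mulr0.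
by apply: hom_eq0 => j; rewrite jderiv_coord hom_const.
Qed.

(** The second-order Taylor estimate holds for partial sums with a constant
   independent of the order, and passes to the limit. *)
Lemma jsum_derive U (x : pt) j : gevrey L U -> `|x| < r ->
  is_derive x (e j) (jsum U) (jsum (jderiv j U) x).
Proof.
move=> gU xr.
have gU1 := gevrey_deriv L0 j gU; have gU2 := gevrey_deriv L0 j gU1.
have [M M0 hM] := psum_bound gU2.
have dr : 0 < r - `|x| by rewrite subr_gt0.
have ne1 t : `|t *: e j| <= `|t|.
  apply: norm_le_coord => // k; rewrite !mxE eqxx /= normrM.
  by rewrite ler_piMr // normr_nat; case: eqP.
have key t : `|t| <= r - `|x| ->
    `|jsum U (x + t *: e j) - jsum U x - t * jsum (jderiv j U) x| <= M * t ^+ 2.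
  move=> tr.
  have inr s : between s t -> `|x + s *: e j| <= r.
    move=> /between_norm st; apply: le_trans (ler_normD _ _) _.
    by have := ne1 s; lra.
  have inr0 : `|x| <= r by exact: ltW.
  have inrt : `|x + t *: e j| <= r.
    by apply: le_trans (ler_normD _ _) _; have := ne1 t; lra.
  apply: (@cvg_norm_le _ (fun N => psum N.+2 U (x + t *: e j) - psum N.+2 U x
           - t * psum N.+1 (jderiv j U) x)).
    apply: cvgB; first apply: cvgB.
    - by have := jsum_cvg gU inrt; rewrite -(cvg_shiftn 2) /=; under eq_fun do rewrite addn2.
    - by have := jsum_cvg gU inr0; rewrite -(cvg_shiftn 2) /=; under eq_fun do rewrite addn2.
    - apply: cvgM; first exact: cvg_cst.
      by have := jsum_cvg gU1 inr0; rewrite -(cvg_shiftS).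
  move=> N.
  have := @taylor1_le _ (fun s => psum N.+2 U (x + s *: e j))
    (fun s => psum N.+1 (jderiv j U) (x + s *: e j))
    (fun s => psum N (jderiv j (jderiv j U)) (x + s *: e j)) M t.
  rewrite scale0r addr0; apply=> s st.
  - exact/is_derive_line/psum_derive.
  - exact/is_derive_line/psum_derive.
  - by apply: hM; apply: inr.
have cv : h^-1 *: ((jsum U \o shift x) (h *: e j) - jsum U x) @[h --> 0^'] -->
   jsum (jderiv j U) x.
  apply/cvgrPdist_le => eps eps0; near=> t.
  have t0 : t != 0 by near: t; exact: nbhs_dnbhs_neq.
  have t1 : `|t| <= r - `|x| by near: t; apply: dnbhs0_le.
  have t2 : `|t| <= eps / (M + 1).
    by near: t; apply: dnbhs0_le; rewrite divr_gt0 // ltr_wpDl.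
  have H := key t t1; rewrite distrC /= [_ + x]addrC.
  have -> : t^-1 *: (jsum U (x + t *: e j) - jsum U x) - jsum (jderiv j U) x =
    t^-1 * (jsum U (x + t *: e j) - jsum U x - t * jsum (jderiv j U) x).
    by rewrite [in RHS]mulrBr mulrA mulVf // mul1r.
  rewrite normrM normfV ler_pdivrMl ?normr_gt0 //; apply: le_trans H _.
  rewrite -[t ^+ 2]ger0_norm ?sqr_ge0 // normrX expr2 mulrCA; apply: ler_wpM2l => //.
  rewrite ler_pdivlMr ?ltr_wpDl // in t2; apply: le_trans t2.
  by rewrite mulrC ler_wpM2l // lerDl.
by split; [apply/cvg_ex; exists (jsum (jderiv j U) x)|apply: cvg_lim].
Unshelve. all: by end_near. Qed.

Lemma jsum_continuous U (x : pt) : gevrey L U -> `|x| < r ->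
  {for x, continuous (jsum U)}.
Proof.
move=> gU xr; have dr : 0 < r - `|x| by rewrite subr_gt0.
have inr y : `|y - x| < r - `|x| -> `|y| < r.
  by move=> h; have := ler_normD (y - x) x; rewrite subrK; lra.
have gd i := gevrey_deriv L0 i gU.
pose M i := sval (cid2 (jsum_bound (gd i))).
have M0 i : 0 <= M i by rewrite /M; case: cid2.
have hM i h : `|h| <= r -> `|jsum (jderiv i U) h| <= M i.
  by rewrite /M; case: cid2 => ? ? h'; apply: h'.
apply: (@partial_continuous _ _ _ (fun i => jsum (jderiv i U)) x _ (\sum_i M i) dr).
- by move=> y i /inr yr; apply: jsum_derive.
- move=> y i /inr /ltW yr; apply: le_trans (hM i y yr) _.
  by rewrite (bigD1 i) //= lerDl sumr_ge0.
Qed.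

Lemma jsum_smooth U (x0 : pt) : gevrey L U ->
  smooth_on [set x | `|x - x0| < r] (fun x => jsum U (x - x0)).
Proof.
move=> gU.
pose K (f : pt -> R) := exists2 U, gevrey L U & f = fun x => jsum U (x - x0).
apply: (@smooth_coind _ _ _ K); last by exists U.
  rewrite (_ : [set x | _] = ball x0 r); first exact: ball_open.
  by apply/seteqP; split => y; rewrite -ball_normE /= distrC.
move=> f [{gU}U gU ->]; split=> [x xr|i].
  suff : {for x, continuous (jsum U \o (fun x => x - x0))} by [].
  apply: continuous_comp; last exact: jsum_continuous.
  by apply: continuousB; [exact: cvg_id|exact: cst_continuous].
exists (fun x => jsum (jderiv i U) (x - x0)).
  by exists (jderiv i U) => //; apply: gevrey_deriv.
move=> x xr; have [d1 d2] := jsum_derive i gU xr.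
have E : (fun h : R => h^-1 *: (((fun x => jsum U (x - x0)) \o shift x) (h *: e i) - jsum U (x - x0))) =
  (fun h : R => h^-1 *: ((jsum U \o shift (x - x0)) (h *: e i) - jsum U (x - x0))).
  by apply/funext => h /=; rewrite addrA.
by split; [rewrite /derivable E|rewrite -d2 /derive E].
Qed.

End Radius.
End Bounded.

(** * Analytic functions are sums of convergent series *)

Section Taylor.
Context {R : realType} {n : nat}.
Local Notation I := 'I_n.+1.
Local Notation jet := (jet R n).
Local Notation pt := 'rV[R]_n.+1.
Local Notation multi := {ffun I -> nat}.

Definition content (w : seq I) : multi := [ffun i => count_mem i w].

(** A coefficient of a power series times the factorials of its multi-index is the
   corresponding derivative. *)
Definition taylor_coef (c : multi -> R) (w : seq I) : R :=
  (\prod_i (content w i)`!)%:R * c (content w).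

Fact taylor_swap c v i j w :
  taylor_coef c (v ++ i :: j :: w) = taylor_coef c (v ++ j :: i :: w).
Proof.
rewrite /taylor_coef (_ : content _ = content (v ++ j :: i :: w)) //.
by apply/ffunP => k; rewrite !ffunE !count_cat /=; congr addn; exact: addnCA.
Qed.

Definition taylor_jet c : jet := @Jet R n (taylor_coef c) (taylor_swap c).

Definition incrm (j : I) (m : multi) : multi := [ffun i => ((i == j) + m i)%N].

Lemma content_cons j w : content (j :: w) = incrm j (content w).
Proof. by apply/ffunP => i; rewrite !ffunE /= eq_sym. Qed.

Lemma prod_fact_incrm j (m : multi) :
  (\prod_i (incrm j m i)`! = (m j).+1 * \prod_i (m i)`!)%N.
Proof.
rewrite (bigD1 j) //= [X in _ = (_ * X)%N](bigD1 j) //= mulnA; congr muln.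
  by rewrite ffunE eqxx add1n factS.
by apply: eq_bigr => i ij; rewrite ffunE (negPf ij).
Qed.

Lemma jderiv_taylor j c :
  jderiv j (taylor_jet c) = taylor_jet (fun m => (m j).+1%:R * c (incrm j m)).
Proof.
apply: jetP => w /=; rewrite /taylor_coef content_cons prod_fact_incrm natrM.
by ring.
Qed.

Lemma sum_content w : (\sum_i content w i = size w)%N.
Proof.
elim: w => [|j w IH]; first by rewrite big1 // => i _; rewrite ffunE.
rewrite content_cons /= -IH (bigD1 j) //= [in RHS](bigD1 j) //= ffunE eqxx add1n addSn.
by congr (_ + _).+1; apply: eq_bigr => i ij; rewrite ffunE (negPf ij).
Qed.

Lemma prod_fact_content w : (\prod_i (content w i)`! <= (size w)`!)%N.
Proof.
elim: w => [|j w IH]; first by rewrite big1 // => i _; rewrite ffunE.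
rewrite content_cons prod_fact_incrm /= factS leq_mul // ltnS -sum_content.
by rewrite (bigD1 j) //= leq_addr.
Qed.

Definition deg N (k : {ffun I -> 'I_N}) := (\sum_i k i)%N.
Definition multi_of N (k : {ffun I -> 'I_N}) : multi := [ffun i => nat_of_ord (k i)].

Lemma monomialS (h : pt) j (m : multi) : monomial h (incrm j m) = h 0 j * monomial h m.
Proof.
rewrite /monomial (bigD1 j) //= [in RHS](bigD1 j) //= ffunE eqxx add1n exprS -mulrA.
by congr (_ * (_ * _)); apply: eq_bigr => i ij; rewrite ffunE (negPf ij).
Qed.

(** The change of index k |-> k + 1_j behind termwise differentiation. The sums run
   over a box of exponents at most N, so the change of index stays in the box
   only because the degree is at most N. *)
Lemma sum_degS N d j (F : multi -> R) : (d < N)%N ->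
  \sum_(k : {ffun I -> 'I_N.+1} | deg k == d.+1) (k j)%:R * F (multi_of k) =
  \sum_(k : {ffun I -> 'I_N.+1} | deg k == d) (k j).+1%:R * F (incrm j (multi_of k)).
Proof.
move=> dN.
pose up (k : {ffun I -> 'I_N.+1}) : {ffun I -> 'I_N.+1} :=
  [ffun i => inord ((i == j) + k i)].
pose down (k : {ffun I -> 'I_N.+1}) : {ffun I -> 'I_N.+1} :=
  [ffun i => inord (k i - (i == j))].
rewrite (bigID (fun k : {ffun I -> 'I_N.+1} => 0 < k j)%N) /= [X in _ + X]big1 ?addr0; last first.
  by move=> k /andP[_]; rewrite -eqn0Ngt => /eqP->; rewrite mul0r.
rewrite (reindex_onto up down) /=; last first.
  move=> k /andP[_ kj]; apply/ffunP => i; apply: val_inj; rewrite !ffunE /=.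
  have E : ((i == j) + (k i - (i == j)) = k i)%N.
    by case: eqP => [->|_]; rewrite ?subnKC ?subn0.
  have L : (k i - (i == j) < N.+1)%N by apply: leq_ltn_trans (leq_subr _ _) _.
  by rewrite inordK inordK // E.
have upE (k : {ffun I -> 'I_N.+1}) : (k j < N)%N -> multi_of (up k) = incrm j (multi_of k).
  move=> kj; apply/ffunP => i; rewrite !ffunE inordK //.
  by case: eqP => [->|_]; [rewrite add1n ltnS|rewrite add0n].
have degE (k : {ffun I -> 'I_N.+1}) : (k j < N)%N -> deg (up k) = (deg k).+1.
  move=> kj; have := upE k kj => /ffunP E; rewrite /deg.
  transitivity (\sum_i incrm j (multi_of k) i)%N.
    by apply: eq_bigr => i _; rewrite -E !ffunE.
  rewrite (bigD1 j) //= [in RHS](bigD1 j) //= !ffunE eqxx add1n addSn.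
  by congr (_ + _).+1; apply: eq_bigr => i ij; rewrite !ffunE (negPf ij).
apply: eq_big => [k|k /andP[/andP[_ upj] _]].
  have [kj|kj] := ltnP (k j) N.
    rewrite degE // eqSS; case: eqP => //= _; apply/andP; split.
      by rewrite ffunE eqxx inordK ?add1n.
    apply/eqP/ffunP => i; apply: val_inj; rewrite !ffunE /= inordK.
      rewrite inordK; first by rewrite addKn.
      by case: eqP => [->|_]; [rewrite add1n ltnS|rewrite add0n].
    by apply: leq_ltn_trans (leq_subr _ _) _.
  have -> : (0 < up k j)%N = false.
    have -> : up k j = ord0.
      rewrite ffunE eqxx add1n; apply: val_inj.
      by rewrite /inord /insubd insubF // ltnS ltnNge -ltnS; apply/negbF.
    by [].
  rewrite andbF; apply/esym/negbTE; rewrite neq_ltn; apply/orP; right.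
  by apply: leq_trans dN _; apply: leq_trans kj _; rewrite /deg (bigD1 j) //= leq_addr.
have kj : (k j < N)%N.
  rewrite ltnNge; apply/negP => kj; move: upj; have -> : up k j = ord0.
    rewrite ffunE eqxx add1n; apply: val_inj.
    by rewrite /inord /insubd insubF // ltnS ltnNge -ltnS; apply/negbF.
  by [].
by rewrite upE // ffunE eqxx inordK add1n // ltnS.
Qed.

Lemma hom_taylor d N c (h : pt) : (d <= N)%N -> hom d (taylor_jet c) h =
  \sum_(k : {ffun I -> 'I_N.+1} | deg k == d) c (multi_of k) * monomial h (multi_of k).
Proof.
elim: d c => [|d IH] c dN.
  rewrite (big_pred1 [ffun=> ord0]) => [|k].
    have E : multi_of ([ffun=> ord0] : {ffun I -> 'I_N.+1}) = content [::].
      by apply/ffunP => i; rewrite !ffunE.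
    rewrite E /= /taylor_coef /monomial !big1 ?mul1r ?mulr1 // => i _.
      by rewrite ffunE expr0.
    by rewrite ffunE.
  rewrite sum_nat_eq0; apply/forallP/eqP => [k0|->]; last by move=> i; rewrite ffunE.
  by apply/ffunP => i; apply: val_inj; have := k0 i; rewrite ffunE => /eqP.
apply: (@mulfI _ d.+1%:R); first by rewrite pnatr_eq0.
rewrite homS.
under eq_bigr do rewrite jderiv_taylor (IH _ (ltnW dN)) mulr_sumr.
have -> : d.+1%:R * \sum_(k : {ffun I -> 'I_N.+1} | deg k == d.+1)
     c (multi_of k) * monomial h (multi_of k) =
   \sum_j \sum_(k : {ffun I -> 'I_N.+1} | deg k == d.+1)
      (k j)%:R * (c (multi_of k) * monomial h (multi_of k)).
  rewrite exchange_big /= mulr_sumr; apply: eq_bigr => k /eqP <-.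
  by rewrite -mulr_suml -natr_sum.
apply: eq_bigr => j _; rewrite (sum_degS j (fun m => c m * monomial h m) dN).
by apply: eq_bigr => k _; rewrite monomialS ffunE; ring.
Qed.

Lemma psum_taylor N c (h : pt) : psum N.+1 (taylor_jet c) h =
  \sum_(k : {ffun I -> 'I_N.+1} | (deg k < N.+1)%N)
     c (multi_of k) * monomial h (multi_of k).
Proof.
rewrite /psum /series /= big_mkord.
rewrite (partition_big (fun k : {ffun I -> 'I_N.+1} => inord (deg k) : 'I_N.+1) xpredT) //=.
apply: eq_bigr => d _; rewrite (hom_taylor _ _ (ltn_ord d : (d <= N)%N)).
apply: eq_bigl => k; apply/eqP/andP => [kd|[kN /eqP <-]]; last by rewrite inordK.
by rewrite kd ltn_ord; split=> //; apply/eqP/val_inj; rewrite /= inordK.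
Qed.

(** Absolute convergence at one point with nonzero coordinates bounds the
   coefficients geometrically. On a smaller ball, the sums over boxes and over
   degrees have the same limit: they differ by the terms of the box of size
   N of degree larger than N, at most (N + 1)^(n + 1) terms that decay
   geometrically. *)
Lemma analytic_jet (f : pt -> R) (x0 : pt) : analytic_at f x0 ->
  exists2 U : jet, convergent U & exists2 r : R, 0 < r &
    forall h : pt, `|h| < r -> f (x0 + h) = jsum U h.
Proof.
move=> [c [r r0 hc]]; pose s := r / 2; have s0 : 0 < s by rewrite divr_gt0.
have mono_s (m : multi) : monomial (const_mx s : pt) m = \prod_i s ^+ m i.
  by apply: eq_bigr => i _; rewrite mxE.
have [M M0 hM] : exists2 M : R, 0 <= M & forall m, `|c m| * \prod_i s ^+ m i <= M.
  have [|sm _] := hc (const_mx s).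
    by move=> i; rewrite mxE gtr0_norm // /s ltr_pdivrMr // mulr_natr mulr2n ltrDl.
  have sfin : \esum_(m in [set: multi]) `|(c m * monomial (const_mx s : pt) m)%:E|%E
     \is a fin_num by rewrite -summableE.
  exists (fine (\esum_(m in [set: multi]) `|(c m * monomial (const_mx s : pt) m)%:E|%E)).
    by apply: fine_ge0; apply: esum_ge0.
  move=> m; rewrite -lee_fin fineK //.
  have p0 : 0 <= \prod_i s ^+ m i by apply: prodr_ge0 => i _; rewrite exprn_ge0 // ltW.
  apply: esum_ge; exists [set m]; first by split; [exact: finite_set1|].
  by rewrite fsbig_set1 /= lee_fin normrM mono_s (ger0_norm p0).
exists (taylor_jet c).
  exists (1 + s^-1), M; split=> // [|w].
    by rewrite lerDl invr_ge0 ltW.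
  have E : \prod_i s ^+ content w i = s ^+ size w by rewrite prodrXr sum_content.
  have := hM (content w); rewrite E => H.
  rewrite /= /taylor_coef normrM normr_nat mulrC.
  apply: (@le_trans _ _ (M * (s^-1 ^+ size w) * (size w)`!%:R)).
    apply: ler_pM => //; last by rewrite ler_nat prod_fact_content.
    by rewrite exprVn ler_pdivlMr ?exprn_gt0.
  rewrite -mulrA; apply: ler_wpM2l => //; apply: ler_wpM2r => //.
  by rewrite lerXn2r ?nnegrE ?addr_ge0 ?invr_ge0 ?(ltW s0) // lerDr.
(* One factor 1 / 2 per degree for convergence, and n + 1 more to compensate for
   the number of terms of the box. *)
pose q : R := 2^-1 ^+ n.+2; have q0 : 0 < q by rewrite exprn_gt0 // invr_gt0.
have q1 : q <= 1 by rewrite exprn_ile1 ?invr_ge0 // invf_le1 // ler1n.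
exists (q * s) => [|h hq]; first exact: mulr_gt0.
have hi i : `|h 0 i| <= q * s by apply: le_trans (coord_le_norm h i) (ltW hq).
have [|_ fh] := hc h.
  move=> i; apply: le_lt_trans (hi i) _; apply: (@le_lt_trans _ _ s).
    by rewrite ler_piMl // ltW.
  by rewrite /s ltr_pdivrMr // mulr_natr mulr2n ltrDl.
have mono_h (m : multi) : `|c m * monomial h m| <= M * q ^+ (\sum_i m i).
  rewrite normrM /monomial normr_prod.
  apply: (@le_trans _ _ (`|c m| * \prod_i (q * s) ^+ m i)).
    apply: ler_wpM2l => //; apply: ler_prod => i _; rewrite normr_ge0 /= normrX.
    by rewrite lerXn2r ?nnegrE // mulr_ge0 // ltW.
  under eq_bigr do rewrite exprMn.
  rewrite big_split /= prodrXr mulrCA mulrC; apply: ler_wpM2r => //.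
  by rewrite exprn_ge0 // ltW.
set B := (fun N : nat => _) in fh.
have BE N : B N.+1 = psum N.+1 (taylor_jet c) h +
   \sum_(k : {ffun I -> 'I_N.+1} | ~~ (deg k < N.+1)%N)
     c (multi_of k) * monomial h (multi_of k).
  rewrite psum_taylor.
  transitivity (\sum_(k : {ffun I -> 'I_N.+1}) c (multi_of k) * monomial h (multi_of k));
    last by rewrite (bigID (fun k : {ffun I -> 'I_N.+1} => (deg k < N.+1)%N)).
  apply: eq_bigr => k _; congr (_ * _); apply: eq_bigr => i _.
  by rewrite ffunE.
have tail N : `|B N.+1 - psum N.+1 (taylor_jet c) h| <= M * 2^-1 ^+ N.+1.
  rewrite BE addrC addKr; apply: le_trans (ler_norm_sum _ _ _) _.
  apply: (@le_trans _ _ (\sum_(k : {ffun I -> 'I_N.+1}) M * q ^+ N.+1)).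
    rewrite big_mkcond /=; apply: ler_sum => k _; case: ifP => [kN|_]; last first.
      by rewrite mulr_ge0 // exprn_ge0 // ltW.
    apply: le_trans (mono_h _) _; apply: ler_wpM2l => //.
    apply: ler_wiXn2l => //; first exact: ltW.
    rewrite leqNgt; apply: contra kN => kN; apply: leq_trans kN.
    by rewrite ltnS /deg; apply: leq_sum => i _; rewrite ffunE.
  rewrite sumr_const card_ffun !card_ord -[leLHS]mulr_natr -[leLHS]mulrA.
  apply: ler_wpM2l => //.
  have -> : q ^+ N.+1 = 2^-1 ^+ N.+1 * (2^-1 ^+ N.+1) ^+ n.+1.
    by rewrite /q -!exprM -exprD mulSn mulnC.
  rewrite natrX -mulrA -exprMn ler_piMr ?exprn_ge0 ?invr_ge0 // exprn_ile1 //.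
  rewrite exprVn mulrC ler_pdivrMr ?exprn_gt0 // mul1r -natrX ler_nat ltnW //.
  exact: ltn_expl.
apply/esym; apply: cvg_lim => //.
rewrite -(cvg_shiftS (series _)) /=.
have z : (fun N => M * (2^-1) ^+ N.+1) @ \oo --> (0 : R).
  have := @cvg_geometric R M 2^-1; rewrite ger0_norm ?invr_ge0 // invf_lt1 // ltr1n.
  by move=> /(_ isT); rewrite -cvg_shiftS.
have d0 : (fun N => B N.+1 - psum N.+1 (taylor_jet c) h) @ \oo --> (0 : R).
  apply/norm_cvg0P; apply: (squeeze_cvgr _ (cvg_cst 0) z).
  by apply: nearW => N; rewrite normr_ge0 tail.
rewrite (_ : (fun N => _) = (fun N => B N.+1 - (B N.+1 - psum N.+1 (taylor_jet c) h))).
  have bc : (fun N => B N.+1) @ \oo --> f (x0 + h) by rewrite (cvg_shiftS B).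
  by have := cvgB bc d0; rewrite subr0; apply.
by apply/funext => N; rewrite opprB addrC subrK.
Qed.

End Taylor.

(** * Vector fields and transport equations *)

Section Bracket.
Variable A : comNzRingType.

Definition derivation (d : A -> A) :=
  (forall x y, d (x + y) = d x + d y) /\ (forall x y, d (x * y) = d x * y + x * d y).

Lemma derivationN d x : derivation d -> d (- x) = - d x.
Proof.
move=> [dD _]; apply/eqP; rewrite -addr_eq0 -dD addNr.
by have /eqP := dD 0 0; rewrite addr0 -[X in X == _]addr0 (inj_eq (addrI _)) eq_sym.
Qed.

Lemma derivation1 d : derivation d -> d 1 = 0.
Proof.
move=> [_ dM]; have /eqP := dM 1 1.
by rewrite !mulr1 mul1r -[X in X == _]addr0 (inj_eq (addrI _)) eq_sym => /eqP.
Qed.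

Variables (e1 e2 f1 f2 : A -> A) (N b D l m : A).
Hypotheses (d1 : derivation e1) (d2 : derivation e2).
Hypotheses (d3 : derivation f1) (d4 : derivation f2).

Let xi x := (b - l * N) * e1 x + e2 x + l * f1 x - (D + l * b) * f2 x.
Let eta x := (1 + m * N) * e1 x - m * f1 x + (l + m * b) * f2 x.
Let rho := m * xi N + l * eta N - eta b.

Hypothesis xil : xi l = rho * l - m * xi b - eta D - l * eta b.
Hypothesis xim : xi m = rho * m - eta l.

(** With e1, e2, f1, f2 satisfying the relations of contact vector fields, where
   z is the derivative along the Reeb direction, the bracket [xi, eta] is a
   combination of e1, f1, f2 and z. It has no z component as xi and eta span a
   Lagrangian plane; the equations for l and m say that the remaining part is
   rho eta. *)
Lemma bracket_xi_eta x z :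
  e1 (f1 x) = f1 (e1 x) - z -> e2 (f2 x) = f2 (e2 x) - z ->
  e1 (e2 x) = e2 (e1 x) -> e1 (f2 x) = f2 (e1 x) ->
  e2 (f1 x) = f1 (e2 x) -> f1 (f2 x) = f2 (f1 x) ->
  xi (eta x) = rho * eta x + eta (xi x).
Proof.
move=> c11 c22 ce c12 c21 cf.
have [a1 m1] := d1; have [a2 m2] := d2; have [a3 m3] := d3; have [a4 m4] := d4.
have E (d : A -> A) : derivation d -> d 1 = 0 /\ forall x, d (- x) = - d x.
  by move=> dd; split=> [|y]; [exact: derivation1|exact: derivationN].
have [u1 n1] := E _ d1; have [u2 n2] := E _ d2.
have [u3 n3] := E _ d3; have [u4 n4] := E _ d4.
move: xil xim; rewrite /rho /xi /eta.
rewrite !(a1, a2, a3, a4, n1, n2, n3, n4, m1, m2, m3, m4, u1, u2, u3, u4).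
rewrite c11 c22 ce c12 c21 cf => H1 H2.
have K1 := congr1 (fun y => y - ((b - l * N) * e1 l + l * f1 l - (D + l * b) * f2 l)) H1.
have K2 := congr1 (fun y => y - ((b - l * N) * e1 m + l * f1 m - (D + l * b) * f2 m)) H2.
have E2l : e2 l = (b - l * N) * e1 l + e2 l + l * f1 l - (D + l * b) * f2 l -
  ((b - l * N) * e1 l + l * f1 l - (D + l * b) * f2 l) by ring.
have E2m : e2 m = (b - l * N) * e1 m + e2 m + l * f1 m - (D + l * b) * f2 m -
  ((b - l * N) * e1 m + l * f1 m - (D + l * b) * f2 m) by ring.
rewrite E2l E2m K1 K2; ring.
Qed.

End Bracket.

Lemma jcoef0 {R : realType} {n} w : (0 : jet R n) w = 0.
Proof. by case: w. Qed.

(** By symmetry any letter of a word can be moved to the front. *)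
Lemma jet_front {R : realType} {n} (U : jet R n) v j w :
  U (v ++ j :: w) = U (j :: v ++ w).
Proof.
elim: v U => //= x v IH U; rewrite [LHS](IH (jderiv x U)) /=.
exact: (jet_swap U [::]).
Qed.

Section Fields.
Context {R : realType} {n : nat}.
Local Notation I := 'I_n.+1.
Local Notation jet := (jet R n).
Implicit Types (v : I -> jet) (X : jet).

Definition lie v X : jet := \sum_j v j * jderiv j X.

Lemma lie_derivation v : derivation (lie v).
Proof.
split=> X Y; rewrite /lie.
  by rewrite -big_split /=; apply: eq_bigr => j _; rewrite jderivD mulrDr.
rewrite mulr_suml mulr_sumr -big_split /=; apply: eq_bigr => j _.
by rewrite jderiv_mul; ring.
Qed.

Variable tau : I.
Local Notation agr := (@agree R n (count_mem tau)).

Lemma lie_split v X : v tau = 1 ->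
  jderiv tau X = lie v X - \sum_(j | j != tau) v j * jderiv j X.
Proof. by move=> vt; rewrite /lie (bigD1 tau) //= vt mul1r addrK. Qed.

Lemma agree_sum k (P : pred I) (U V : I -> jet) :
  (forall j, P j -> agr k (U j) (V j)) ->
  agr k (\sum_(j | P j) U j) (\sum_(j | P j) V j).
Proof.
move=> UV; elim/big_rec2: _ => // j x y Pj xy; exact/agreeD/xy/UV.
Qed.

(** Solving for the derivative along tau, the coefficients with k + 1 letters tau
   are determined by those with at most k. *)
Lemma transport_unique v (c V : jet) : v tau = 1 -> lie v V = c * V ->
  agr 1 V 0 -> V = 0.
Proof.
move=> vt vV V0.
have H k : agr k V 0.
  elim: k => [|k IH] w wk //; case: k IH wk => [|k] IH wk; first exact: V0.
  have dV : agr k.+1 (jderiv tau V) 0.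
    suff : agr k.+1 (c * V - \sum_(j | j != tau) v j * jderiv j V)
                    (c * 0 - \sum_(j | j != tau) v j * jderiv j (0 : jet)).
      have Z : \sum_(j | j != tau) v j * jderiv j (0 : jet) = 0.
        by rewrite big1 // => j _; rewrite raddf0 mulr0.
      by rewrite (lie_split _ vt) vV mulr0 Z subr0.
    apply: agreeD; first exact: agreeM.
    by apply: agreeN; apply: agree_sum => j jt; apply: agreeM => //;
      apply: agree_deriv_neq.
  have [|tw] := boolP (tau \in w); last first.
    by apply: V0; move: tw; rewrite -has_pred1 has_count -leqNgt leqn0 => /eqP->.
  move=> /splitPr tw; case: w / tw wk => u w wk; rewrite jet_front.
  rewrite [LHS](dV (u ++ w)) ?jcoef0 //.
  by move: wk; rewrite !count_cat /= eqxx add1n addnS ltnS.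
apply: jetP => w; rewrite jcoef0.
by have := H (count_mem tau w).+1 w (ltnSn _); rewrite jcoef0.
Qed.

Lemma near_adm_const (T : finType) X : convergent X ->
  \forall L \near +oo, admissible tau L 0 (fun _ : T -> jet => X).
Proof.
move=> /(convergent_wball tau)[L0 [K [L01 K0 hX]]].
near=> L; have LL : L0 <= L by near: L; exact/nbhs_pinfty_ge/num_real.
have L1 : 1 <= L by lra.
apply: (adm_const L1 T K0); exact: hX.
Unshelve. all: by end_near. Qed.

Lemma adm_sum (T : finType) L e (P : pred I) (B : I -> (T -> jet) -> jet) :
  1 <= L -> (e <= 1)%N -> (forall j, P j -> admissible tau L e (B j)) ->
  admissible tau L e (fun u => \sum_(j | P j) B j u).
Proof.
move=> L1 e1 hB.
have Z0 : admissible tau L 0 (fun _ : T -> jet => 0).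
  apply: (adm_const L1 T (lexx 0)) => w.
  by rewrite jcoef0 normr0 mul0r.
have Z : admissible tau L e (fun _ : T -> jet => 0).
  by case: e e1 {hB} => [//|[|//]] _; apply: adm_up.
rewrite /index_enum; elim: (Finite.enum I) => [|i s IH].
  by rewrite (_ : (fun u => _) = fun=> 0) //; apply/funext => u; rewrite big_nil.
have [Pi|Pi] := boolP (P i); last first.
  by rewrite (_ : (fun u => _) = fun u => \sum_(j <- s | P j) B j u) //;
    apply/funext => u; rewrite big_cons (negPf Pi).
rewrite (_ : (fun u => _) = fun u => B i u + \sum_(j <- s | P j) B j u).
  by apply: admD => //; apply: hB.
by apply/funext => u; rewrite big_cons Pi.
Qed.

(** The equation u_tau = F u with initial data phi on the hyperplane; the bounds
   for the data and for F hold for all large L. *)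
Lemma cauchy_convergent (T : finType) (F : T -> (T -> jet) -> jet) (phi : T -> jet) :
  (\forall L \near +oo, 1 <= L -> forall i, admissible tau L 1 (F i)) ->
  (forall i, convergent (phi i)) -> (forall i, jderiv tau (phi i) = 0) ->
  exists u : T -> jet, [/\ forall i, convergent (u i),
    forall i, agr 1 (u i) (phi i) & forall i, jderiv tau (u i) = F i u].
Proof.
move=> admF cphi dphi.
have [K [K0 hphi]] : exists K : R, 0 <= K /\ \forall L \near +oo,
    forall i, wball tau 0 L 1 K (phi i).
  pose Q i (K : R) := 0 <= K /\ \forall L \near +oo, wball tau 0 L 1 K (phi i).
  have hQ i : exists K, Q i K.
    have [L0 [K [L01 K0 h]]] := convergent_wball tau (cphi i); exists K; split=> //.
    by near=> L; apply: h; near: L; exact/nbhs_pinfty_ge/num_real.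
  pose K i := sval (cid (hQ i)).
  have QK i : Q i (K i) by rewrite /K; case: cid.
  exists (\sum_i K i); split; first by apply: sumr_ge0 => i _; case: (QK i).
  near=> L; have L1 : 1 <= L by near: L; exact/nbhs_pinfty_ge/num_real.
  move=> i; apply: (@wball_le _ _ _ _ L1 _ (lexx 1) 0 (K i)).
    by rewrite (bigD1 i) //= lerDl; apply: sumr_ge0 => j _; case: (QK j).
  by move: i; near: L; apply: filter_forall => i; case: (QK i).
near (pinfty_nbhs R) => L.
have L1 : 1 <= L by near: L; exact/nbhs_pinfty_ge/num_real.
have [|||u [kap [kap1 uE ub]]] := @cauchy_kovalevskaya R n tau L L1 T F phi K.
- by move: L1; near: L.
- exact: K0.
- by near: L.
exists u; split=> i.
- by apply: wball_convergent (ub i) => //; rewrite addr_ge0.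
- move=> w w0; rewrite uE jcoefD /=; have -> : (tau \in w) = false.
    by apply: negbTE; rewrite -has_pred1 has_count -leqNgt -ltnS.
  by rewrite addr0.
- by rewrite {1}uE jderivD dphi add0r jderiv_jint.
Unshelve. all: by end_near. Qed.

Lemma transport_exists v phi : (forall j, convergent (v j)) -> v tau = 1 ->
  convergent phi -> jderiv tau phi = 0 ->
  exists X, [/\ convergent X, agr 1 X phi & lie v X = 0].
Proof.
move=> cv vt cphi dphi.
pose F (_ : unit) (u : unit -> jet) := - \sum_(j | j != tau) v j * jderiv j (u tt).
have [|//|//|u [cu au du]] := @cauchy_convergent unit F (fun=> phi).
  near=> L => L1 i; apply: admN; apply: (adm_sum L1) => // j jt.
  apply: (admM L1); last exact: adm_deriv.
  move: j {jt}; near: L; apply: filter_forall => j. exact: near_adm_const.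
exists (u tt); split=> //; rewrite -[LHS](subrK (\sum_(j | j != tau) v j * jderiv j (u tt))).
by rewrite -(lie_split _ vt) du addNr.
Unshelve. all: by end_near. Qed.

End Fields.

(** * Integrable pairs of vector fields and their first integrals *)

Section Leaves.
Context {R : realType} {n : nat}.
Local Notation I := 'I_n.+1.
Local Notation jet := (jet R n).
Variables (tau : I) (E1 E2 F1 F2 : I -> jet) (N b D : jet).
Local Notation agr := (@agree R n (count_mem tau)).

(** The sum of b E1 + E2 - D F2 and l (F1 - N E1 - b F2), both in the kernel of
   the form. *)
Definition field_xi (l : jet) (j : I) : jet :=
  (b - l * N) * E1 j + E2 j + l * F1 j - (D + l * b) * F2 j.
(** Equal to E1 + l F2 - m (F1 - N E1 - b F2). *)
Definition field_eta (l m : jet) (j : I) : jet :=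
  (1 + m * N) * E1 j - m * F1 j + (l + m * b) * F2 j.

Lemma lie_xi l X : lie (field_xi l) X =
  (b - l * N) * lie E1 X + lie E2 X + l * lie F1 X - (D + l * b) * lie F2 X.
Proof.
rewrite /lie !mulr_sumr -sumrN -!big_split /=; apply: eq_bigr => j _.
by rewrite /field_xi; ring.
Qed.

Lemma lie_eta l m X : lie (field_eta l m) X =
  (1 + m * N) * lie E1 X - m * lie F1 X + (l + m * b) * lie F2 X.
Proof.
rewrite /lie !mulr_sumr -sumrN -!big_split /=; apply: eq_bigr => j _.
by rewrite /field_eta; ring.
Qed.

Definition rho l m := m * lie (field_xi l) N + l * lie (field_eta l m) N - lie (field_eta l m) b.

Hypotheses (cE1 : forall j, convergent (E1 j)) (cE2 : forall j, convergent (E2 j)).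
Hypotheses (cF1 : forall j, convergent (F1 j)) (cF2 : forall j, convergent (F2 j)).
Hypotheses (cN : convergent N) (cb : convergent b) (cD : convergent D).
Hypotheses (E1t : E1 tau = 0) (E2t : E2 tau = 1) (F1t : F1 tau = 0) (F2t : F2 tau = 0).

Lemma xi_tau l : field_xi l tau = 1.
Proof. by rewrite /field_xi E1t E2t F1t F2t; ring. Qed.

Lemma eta_tau l m : field_eta l m tau = 0.
Proof. by rewrite /field_eta E1t F1t F2t; ring. Qed.

Lemma lie_eta_split l m X :
  lie (field_eta l m) X = \sum_(j | j != tau) field_eta l m j * jderiv j X.
Proof. by rewrite /lie (bigD1 tau) //= eta_tau mul0r add0r. Qed.

(** The integrability equations for l and m. As the component of xi along tau is 1
   and that of eta is 0, they can be solved for the derivatives along tau. *)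
Lemma integrable_pair : exists l m : jet, [/\ convergent l, convergent m,
  agr 1 l 0, agr 1 m 0 &
  lie (field_xi l) l = rho l m * l - m * lie (field_xi l) b -
     lie (field_eta l m) D - l * lie (field_eta l m) b /\
  lie (field_xi l) m = rho l m * m - lie (field_eta l m) l].
Proof.
pose S (t : bool) (u : bool -> jet) :=
  \sum_(j | j != tau) field_xi (u true) j * jderiv j (u t).
pose S' (u : bool -> jet) :=
  \sum_(j | j != tau) field_eta (u true) (u false) j * jderiv j (u true).
pose r (u : bool -> jet) := rho (u true) (u false).
pose F (t : bool) (u : bool -> jet) := - S t u + (if t then
  r u * u true - u false * lie (field_xi (u true)) b -
  lie (field_eta (u true) (u false)) D - u true * lie (field_eta (u true) (u false)) b
  else r u * u false - S' u).
have c0 : convergent (0 : jet) by exact: (convergent_const 0).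
have [|//|i|u [cu au du]] := @cauchy_convergent R n tau bool F (fun=> 0); last first.
- exists (u true), (u false); split=> //.
  have xiE t : lie (field_xi (u true)) (u t) = jderiv tau (u t) + S t u.
    by rewrite (lie_split (u t) (xi_tau (u true))) /S subrK.
  rewrite !xiE !du (lie_eta_split _ _ (u true)) -/(S' u) -/(r u) [F true u]/F [F false u]/F.
  by split; [ring|ring].
- by rewrite raddf0.
have cst X : convergent X -> \forall L \near +oo, admissible tau L 0 (fun _ : bool -> jet => X).
  exact: near_adm_const.
near=> L => L1.
have a1 j : admissible tau L 0 (fun _ : bool -> jet => E1 j).
  by move: j; near: L; apply: filter_forall => j; apply/cst/cE1.
have a2 j : admissible tau L 0 (fun _ : bool -> jet => E2 j).
  by move: j; near: L; apply: filter_forall => j; apply/cst/cE2.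
have a3 j : admissible tau L 0 (fun _ : bool -> jet => F1 j).
  by move: j; near: L; apply: filter_forall => j; apply/cst/cF1.
have a4 j : admissible tau L 0 (fun _ : bool -> jet => F2 j).
  by move: j; near: L; apply: filter_forall => j; apply/cst/cF2.
have aN : admissible tau L 0 (fun _ : bool -> jet => N) by near: L; exact: cst.
have ab : admissible tau L 0 (fun _ : bool -> jet => b) by near: L; exact: cst.
have aD : admissible tau L 0 (fun _ : bool -> jet => D) by near: L; exact: cst.
have ao : admissible tau L 0 (fun _ : bool -> jet => 1).
  by near: L; apply/cst/(convergent_const 1).
have adN j : admissible tau L 0 (fun _ : bool -> jet => jderiv j N).
  by move: j; near: L; apply: filter_forall => j; apply/cst/convergent_deriv.
have adb j : admissible tau L 0 (fun _ : bool -> jet => jderiv j b).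
  by move: j; near: L; apply: filter_forall => j; apply/cst/convergent_deriv.
have adD j : admissible tau L 0 (fun _ : bool -> jet => jderiv j D).
  by move: j; near: L; apply: filter_forall => j; apply/cst/convergent_deriv.
have p t : admissible tau L 0 (fun u : bool -> jet => u t) by exact: adm_proj.
have axi j : admissible tau L 0 (fun u : bool -> jet => field_xi (u true) j).
  rewrite /field_xi.
  by do ?[exact: a1|exact: a2|exact: a3|exact: a4|exact: aN|exact: ab|exact: aD
         |exact: p|apply: admD|apply: admN|apply: (admM L1)].
have aeta j : admissible tau L 0 (fun u : bool -> jet => field_eta (u true) (u false) j).
  rewrite /field_eta.
  by do ?[exact: a1|exact: a2|exact: a3|exact: a4|exact: aN|exact: ab|exact: ao
         |exact: p|apply: admD|apply: admN|apply: (admM L1)].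
have lxi X : (forall j, admissible tau L 0 (fun _ : bool -> jet => jderiv j X)) ->
    admissible tau L 0 (fun u : bool -> jet => lie (field_xi (u true)) X).
  by move=> aX; apply: (adm_sum L1) => // j _; apply: (admM L1); [exact: axi|exact: aX].
have leta X : (forall j, admissible tau L 0 (fun _ : bool -> jet => jderiv j X)) ->
    admissible tau L 0 (fun u : bool -> jet => lie (field_eta (u true) (u false)) X).
  by move=> aX; apply: (adm_sum L1) => // j _; apply: (admM L1); [exact: aeta|exact: aX].
have ar : admissible tau L 0 r.
  by rewrite /r /rho; do ?[exact: p|exact: lxi|exact: leta|apply: admD|apply: admN|apply: (admM L1)].
have aS t : admissible tau L 1 (S t).
  apply: (adm_sum L1) => // j jt; apply: (admM L1); [exact: axi|exact: adm_deriv].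
have aS' : admissible tau L 1 S'.
  apply: (adm_sum L1) => // j jt; apply: (admM L1); [exact: aeta|exact: adm_deriv].
case; (apply: admD; first by apply: admN; exact: aS).
  apply: (adm_up L1).
  by do ?[exact: p|exact: ar|exact: lxi|exact: leta|apply: admD|apply: admN|apply: (admM L1)].
apply: admD; last exact: admN.
by apply: (adm_up L1); apply: (admM L1); [exact: ar|exact: p].
Unshelve. all: by end_near. Qed.

Hypothesis delta : exists d : jet -> jet,
  (forall X, lie E1 (lie F1 X) = lie F1 (lie E1 X) - d X) /\
  (forall X, lie E2 (lie F2 X) = lie F2 (lie E2 X) - d X).
Hypothesis comm12 : forall X, lie E1 (lie E2 X) = lie E2 (lie E1 X).
Hypothesis comm14 : forall X, lie E1 (lie F2 X) = lie F2 (lie E1 X).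
Hypothesis comm23 : forall X, lie E2 (lie F1 X) = lie F1 (lie E2 X).
Hypothesis comm34 : forall X, lie F1 (lie F2 X) = lie F2 (lie F1 X).

(** Transport phi along xi. Then eta X solves a homogeneous transport equation,
   and its initial value is that of E1 phi = 0, because l and m vanish on the
   hyperplane and eta is tangent to it. *)
Theorem leaf_functions : exists l m : jet, [/\ convergent l, convergent m,
  agr 1 l 0, agr 1 m 0 &
  forall phi, convergent phi -> jderiv tau phi = 0 -> lie E1 phi = 0 ->
  exists X, [/\ convergent X, agr 1 X phi, lie (field_xi l) X = 0 &
    lie (field_eta l m) X = 0]].
Proof.
have [l [m [cl cm al am [xl xm]]]] := integrable_pair.
exists l, m; split=> // phi cphi dphi e1phi.
have cxi j : convergent (field_xi l j).
  by rewrite /field_xi; do ?[exact: cE1|exact: cE2|exact: cF1|exact: cF2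
    |by []|apply: convergentD|apply: convergentN|apply: convergentM].
have [X [cX aX xX]] := transport_exists cxi (xi_tau l) cphi dphi.
exists X; split=> //.
apply: (@transport_unique _ _ tau (field_xi l) (rho l m)); first exact: xi_tau.
  have [d [c11 c22]] := delta.
  have := @bracket_xi_eta jet (lie E1) (lie E2) (lie F1) (lie F2) N b D l m
    (lie_derivation _) (lie_derivation _) (lie_derivation _) (lie_derivation _).
  rewrite -?lie_xi -?lie_eta => /(_ xl xm X (d X) (c11 X) (c22 X) (comm12 X)
    (comm14 X) (comm23 X) (comm34 X)).
  rewrite -!lie_xi -!lie_eta => ->.
  rewrite xX; have -> : lie (field_eta l m) 0 = 0.
    by rewrite /lie big1 // => j _; rewrite raddf0 mulr0.
  by rewrite addr0.
have E0 : \sum_(j | j != tau) E1 j * jderiv j phi = 0.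
  by rewrite -[RHS]e1phi /lie [RHS](bigD1 tau) //= E1t mul0r add0r.
rewrite -E0.
rewrite lie_eta_split; apply: agree_sum => j jt.
apply: agreeM; last exact: agree_deriv_neq.
have -> : E1 j = field_eta 0 0 j by rewrite /field_eta; ring.
rewrite /field_eta; do ?[apply: agreeD|apply: agreeN|apply: agreeM|done].
Qed.

End Leaves.

(** * Differentials of functions with continuous partial derivatives *)

Section C1.
Context {R : realType} {n : nat}.
Local Notation pt := 'rV[R]_n.+1.
Local Notation e i := (delta_mx 0 i : pt).

Lemma common_radius (T : finType) (Q : T -> R -> Prop) :
  (forall i, exists2 s, 0 < s & Q i s) ->
  (forall i s s', s' <= s -> Q i s -> Q i s') ->
  exists2 s, 0 < s & forall i, Q i s.
Proof.
move=> hQ mQ; pose s i := sval (cid2 (hQ i)).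
have s0 i : 0 < s i by rewrite /s; case: cid2.
have Qs i : Q i (s i) by rewrite /s; case: cid2.
exists (\big[Num.min/1]_i s i) => [|i]; first exact: lt_bigmin.
by apply: mQ (Qs i); apply: bigmin_le.
Qed.

Lemma linear_form_derive (a : 'I_n.+1 -> R) (x : pt) i :
  is_derive x (e i) (fun v : pt => \sum_i v 0 i * a i) (a i).
Proof.
have := is_derive_sum' (fun k => is_derive_mul (is_derive_coord x i k) (is_derive_cst (a k) x (e i))).
rewrite (_ : \sum_k _ = a i) // (bigD1 i) //= eqxx mulr0 mul1r add0r big1 ?addr0 // => k ki.
by rewrite mulr0 add0r eq_sym (negPf ki) mul0r.
Qed.

Lemma linear_form_continuous (a : 'I_n.+1 -> R) :
  continuous (fun v : pt => \sum_i v 0 i * a i).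
Proof.
move=> x.
have d (y : pt) i (_ : `|y - x| < 1) := linear_form_derive a y i.
have b (y : pt) (i : 'I_n.+1) (_ : `|y - x| < 1) : `|a i| <= \sum_i `|a i|.
  by rewrite (bigD1 i) //= lerDl sumr_ge0.
exact: partial_continuous ltr01 d b.
Qed.

(** Subtracting the candidate differential gives a function with small partial
   derivatives, which is Lipschitz with a small constant. *)
Lemma C1_differential (f : pt -> R) (df : 'I_n.+1 -> pt -> R) (x0 : pt) (r : R) :
  0 < r -> (forall x i, `|x - x0| < r -> is_derive x (e i) f (df i x)) ->
  (forall i, {for x0, continuous (df i)}) ->
  differentiable f x0 /\ forall v, 'd f x0 v = \sum_i v 0 i * df i x0.
Proof.
move=> r0 fd dfc; pose a i := df i x0.
pose l (v : pt) := \sum_i v 0 i * a i.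
have llin : linear l.
  move=> k u v; rewrite /l scaler_sumr -big_split /=; apply: eq_bigr => i _.
  by rewrite !mxE mulrDl /GRing.scale /= mulrA.
pose lM := GRing.isLinear.Build _ _ _ _ _ llin.
pose L : {linear pt -> R} := HB.pack l lM.
have ld x i := linear_form_derive a x i.
have Lc : continuous L by exact: linear_form_continuous.
have E : f \o shift x0 = cst (f x0) + L +o_ (0 : pt) id.
  apply/eqaddoP => eps eps0.
  have n0 : 0 < n.+1%:R :> R by [].
  have [s s0 hs] : exists2 s : R, 0 < s & forall x i, `|x - x0| < s -> `|df i x - a i| <= eps / n.+1%:R.
    have hi i : exists2 s : R, 0 < s & forall x, `|x - x0| < s -> `|df i x - a i| <= eps / n.+1%:R.
      have dc : df i @ x0 --> df i x0 := dfc i.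
      have /cvgrPdist_le /(_ _ (divr_gt0 eps0 n0)) /nbhs_ballP[s /= s0 hs] := dc.
      exists s => // x xs; rewrite distrC; apply: hs.
      by rewrite -ball_normE /= distrC.
    have [|s s0 hs] := common_radius hi; last by exists s => // x i; apply: hs.
    by move=> i s s' ss h x xs; apply: h; apply: lt_le_trans xs ss.
  apply/nbhs_ballP; exists (Num.min r s); first by rewrite /= lt_min r0.
  move=> h; rewrite -ball_normE /= sub0r normrN lt_min => /andP[hr hs'].
  pose m := Num.min r s; have hm : `|h| < m by rewrite lt_min hr.
  have m0 : 0 < m by rewrite lt_min r0.
  have gd x i : `|x - x0| < m ->
      is_derive x (e i) (fun y => f y - l y) (df i x - a i).
    by rewrite lt_min => /andP[xr _]; exact: is_deriveB (fd _ _ xr) (ld x i).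
  have gb x i : `|x - x0| < m -> `|df i x - a i| <= eps / n.+1%:R.
    by rewrite lt_min => /andP[_]; apply: hs.
  have x0m : `|x0 - x0| < m by rewrite subrr normr0.
  have xm : `|h + x0 - x0| < m by rewrite addrK.
  have H := partial_lipschitz gd gb x0m xm.
  have lD : l (h + x0) = l h + l x0 by have := llin 1 h x0; rewrite !scale1r.
  have nE : n.+1%:R * (eps / n.+1%:R) = eps by rewrite mulrC divfK ?gt_eqF.
  rewrite addrK nE lD in H; apply: le_trans H.
  rewrite (_ : f (h + x0) - _ - _ = f (h + x0) - (f x0 + l h)) //.
  by ring.
have dE : 'd f x0 = L :> (pt -> R) by apply: diff_unique.
split; last by move=> v; rewrite dE.
by apply/diff_locallyP; rewrite dE.
Qed.

End C1.

(** * Closure properties of smooth functions *)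

Section Smooth.
Context {R : realType} {n : nat}.
Local Notation pt := 'rV[R]_n.+1.
Local Notation e i := (delta_mx 0 i : pt).
Implicit Types (V W : set pt) (f g : pt -> R) (F G : pt -> pt).

Lemma open_ball V x : open V -> V x ->
  exists2 r : R, 0 < r & forall y, `|y - x| < r -> V y.
Proof.
move=> oV Vx; have /nbhs_ballP[r /= r0 h] : nbhs x V by apply: open_nbhs_nbhs.
by exists r => // y yr; apply: h; rewrite -ball_normE /= distrC.
Qed.

Lemma near_open V x : open V -> V x -> \forall y \near x, V y.
Proof. by move=> oV Vx; apply: open_nbhs_nbhs. Qed.

Lemma smooth_partial V f i : smooth_on V f -> smooth_on V (fun x => 'D_(e i) f x).
Proof.
move=> sf s x Vx; have := sf (rcons s i) x Vx.
by rewrite /iter_partial foldr_rcons.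
Qed.

Lemma smooth_continuous V f x : smooth_on V f -> V x -> {for x, continuous f}.
Proof. by move=> sf Vx; have [] := sf [::] x Vx. Qed.

Lemma smooth_derive V f x i : smooth_on V f -> V x -> is_derive x (e i) f ('D_(e i) f x).
Proof. by move=> sf Vx; have [_ h] := sf [::] x Vx; split; first exact: h. Qed.

Lemma smooth_differential V f x : open V -> smooth_on V f -> V x ->
  differentiable f x /\ forall v, 'd f x v = \sum_i v 0 i * 'D_(e i) f x.
Proof.
move=> oV sf Vx; have [r r0 hr] := open_ball oV Vx.
apply: (@C1_differential _ _ f (fun i y => 'D_(e i) f y) x r r0) => [y i yr|i].
  by apply: smooth_derive sf _; apply: hr.
exact: smooth_continuous (smooth_partial i sf) Vx.
Qed.

Lemma map_differentiable F x : (forall i, differentiable (fun y => F y 0 i) x) ->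
  differentiable F x /\ forall v i, ('d F x v) 0 i = 'd (fun y => F y 0 i) x v.
Proof.
move=> dF.
have FE : F = \sum_(i < n.+1) (fun y => F y 0 i *: e i).
  apply/funext => y; rewrite fct_sumE [LHS]row_sum_delta.
  by apply: eq_bigr => i _.
have dFx : differentiable F x.
  by rewrite FE; apply: differentiable_sum => i; apply: differentiableZl.
split=> // v i; rewrite -!deriveE // derive_mx ?mxE //.
exact: diff_derivable.
Qed.

Lemma smooth_map_differential V F x : open V -> smooth_map_on V F -> V x ->
  differentiable F x /\ forall v i, ('d F x v) 0 i = \sum_j v 0 j * 'D_(e j) (fun y => F y 0 i) x.
Proof.
move=> oV sF Vx; have [i|dF FE] := @map_differentiable F x.
  by have [] := smooth_differential oV (sF i) Vx.
split=> // v i; rewrite FE.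
by have [_ ->] := smooth_differential oV (sF i) Vx.
Qed.

(** The least class that contains the smooth functions and is closed under the
   operations considered. It is also closed under partial derivatives, so
   [smooth_coind] proves all the closure properties at once. *)
Inductive smooth_alg V : (pt -> R) -> Prop :=
| SmBase f : smooth_on V f -> smooth_alg V f
| SmConst c : smooth_alg V (fun=> c)
| SmAdd f g : smooth_alg V f -> smooth_alg V g -> smooth_alg V (fun x => f x + g x)
| SmMul f g : smooth_alg V f -> smooth_alg V g -> smooth_alg V (fun x => f x * g x)
| SmInv f : (forall x, V x -> f x != 0) -> smooth_alg V f ->
    smooth_alg V (fun x => (f x)^-1)
| SmComp W f F : open W -> smooth_on W f -> smooth_map_on V F ->
    (forall x, V x -> W (F x)) -> smooth_alg V (fun x => f (F x)).

Lemma smooth_alg_sum V (T : finType) (f : T -> pt -> R) :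
  (forall i, smooth_alg V (f i)) -> smooth_alg V (fun x => \sum_i f i x).
Proof.
move=> hf; rewrite /index_enum; elim: (Finite.enum T) => [|i s IH].
  rewrite (_ : (fun x => _) = fun=> 0); first exact: SmConst.
  by apply/funext => x; rewrite big_nil.
rewrite (_ : (fun x => _) = fun x => f i x + \sum_(j <- s) f j x); first exact: SmAdd.
by apply/funext => x; rewrite big_cons.
Qed.

Lemma smooth_alg_smooth V f : open V -> smooth_alg V f -> smooth_on V f.
Proof.
move=> oV; apply: smooth_coind => // {}f; elim=> {f}.
- move=> f sf; split=> [x|i]; first exact: smooth_continuous sf.
  exists (fun x => 'D_(e i) f x); first exact/SmBase/smooth_partial.
  by move=> x; apply: smooth_derive.
- move=> c; split=> [x _|i]; first exact: cst_continuous.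
  by exists (fun=> 0) => [|x _]; [exact: SmConst|exact: is_derive_cst].
- move=> f g _ [cf df] _ [cg dg]; split=> [x Vx|i].
    exact: (continuousD (cf _ Vx) (cg _ Vx)).
  have [f' sf' ff'] := df i; have [g' sg' gg'] := dg i.
  exists (fun x => f' x + g' x) => [|x Vx]; first exact: SmAdd.
  exact: is_deriveD (ff' _ Vx) (gg' _ Vx).
- move=> f g sf [cf df] sg [cg dg]; split=> [x Vx|i].
    exact: (continuousM (cf _ Vx) (cg _ Vx)).
  have [f' sf' ff'] := df i; have [g' sg' gg'] := dg i.
  exists (fun x => f x * g' x + f' x * g x) => [|x Vx].
    by apply: SmAdd; apply: SmMul.
  exact: is_derive_mul (ff' _ Vx) (gg' _ Vx).
- move=> f f0 sf [cf df]; split=> [x Vx|i].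
    exact: (continuousV (f0 _ Vx) (cf _ Vx)).
  have [f' sf' ff'] := df i.
  exists (fun x => (- 1) * (f x * f x)^-1 * f' x) => [|x Vx].
    apply: SmMul => //; apply: SmMul; first exact: SmConst.
    by apply: SmInv; [move=> x Vx; rewrite mulf_neq0 ?f0|exact: SmMul].
  have [d1 d2] := ff' _ Vx; split; first exact: derivableV (f0 _ Vx) d1.
  by rewrite deriveV ?f0 // d2 /GRing.scale /= mulN1r expr2.
- move=> W f F oW sf sF VW; split=> [x Vx|i].
    suff : {for x, continuous (f \o F)} by [].
    apply: continuous_comp; last exact: smooth_continuous sf (VW _ Vx).
    by apply: differentiable_continuous; have [] := smooth_map_differential oV sF Vx.
  exists (fun x => \sum_j 'D_(e i) (fun y => F y 0 j) x * 'D_(e j) f (F x)) => [|x Vx].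
    apply: smooth_alg_sum => j; apply: SmMul; first exact/SmBase/smooth_partial.
    exact: (@SmComp V W (fun y => 'D_(e j) f y) F) (smooth_partial j sf) sF VW.
  have [dF FE] := smooth_map_differential oV sF Vx.
  have [df fE] := smooth_differential oW sf (VW _ Vx).
  have dfF : differentiable (f \o F) x by apply: differentiable_comp.
  split; first by apply: (@diff_derivable _ _ _ (f \o F) x (e i)).
  transitivity ('D_(e i) (f \o F) x); first by [].
  rewrite (deriveE (e i) dfF) (diff_comp dF df) /= fE.
  apply: eq_bigr => j _; rewrite FE (bigD1 i) //= big1 ?addr0.
    by rewrite mxE !eqxx mul1r.
  by move=> k ki; rewrite mxE eqxx (negPf ki) mul0r.
Qed.

Lemma smooth_eq V f g : open V -> (forall x, V x -> f x = g x) ->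
  smooth_on V f -> smooth_on V g.
Proof.
move=> oV fg sf; pose K h := exists2 k, smooth_on V k & forall x, V x -> k x = h x.
apply: (@smooth_coind _ _ V K oV); last by exists f.
move=> h [k sk kh].
have nkh x : V x -> \near x, k x = h x.
  by move=> Vx; have := near_open oV Vx; apply: filterS => y /kh.
split=> [x Vx|i].
  have kx : k @ x --> k x := smooth_continuous sk Vx.
  rewrite (kh _ Vx) in kx; apply: cvg_trans kx.
  by apply: (@near_eq_cvg _ _ (nbhs x) _ k h); exact: nkh.
exists (fun x => 'D_(e i) k x).
  by exists (fun x => 'D_(e i) k x); [exact: smooth_partial|move=> x _].
by move=> x Vx; apply: near_eq_is_derive (nkh _ Vx) (smooth_derive i sk Vx).
Qed.

Section Closure.
Variables (V : set pt) (oV : open V).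

Lemma smooth_const c : smooth_on V (fun=> c).
Proof. exact: smooth_alg_smooth oV (SmConst V c). Qed.

Lemma smoothD f g : smooth_on V f -> smooth_on V g -> smooth_on V (fun x => f x + g x).
Proof. by move=> sf sg; apply: (smooth_alg_smooth oV); apply: SmAdd; apply: SmBase. Qed.

Lemma smoothM f g : smooth_on V f -> smooth_on V g -> smooth_on V (fun x => f x * g x).
Proof. by move=> sf sg; apply: (smooth_alg_smooth oV); apply: SmMul; apply: SmBase. Qed.

Lemma smoothN f : smooth_on V f -> smooth_on V (fun x => - f x).
Proof.
move=> sf; rewrite (_ : (fun x => - f x) = fun x => (-1) * f x).
  exact: smoothM (smooth_const _) sf.
by apply/funext => x; rewrite mulN1r.
Qed.

Lemma smoothB f g : smooth_on V f -> smooth_on V g -> smooth_on V (fun x => f x - g x).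
Proof. by move=> sf sg; exact: smoothD sf (smoothN sg). Qed.

Lemma smoothV f : (forall x, V x -> f x != 0) -> smooth_on V f ->
  smooth_on V (fun x => (f x)^-1).
Proof. by move=> f0 sf; apply: (smooth_alg_smooth oV); apply: SmInv => //; apply: SmBase. Qed.

Lemma smooth_sum (T : finType) (f : T -> pt -> R) :
  (forall i, smooth_on V (f i)) -> smooth_on V (fun x => \sum_i f i x).
Proof.
by move=> sf; apply: (smooth_alg_smooth oV); apply: smooth_alg_sum => i; apply: SmBase.
Qed.

Lemma smooth_prod m (f : 'I_m -> pt -> R) :
  (forall i, smooth_on V (f i)) -> smooth_on V (fun x => \prod_(i < m) f i x).
Proof.
elim: m f => [|m IH] f sf.
  rewrite (_ : (fun x => _) = fun=> 1); first exact: smooth_const.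
  by apply/funext => x; rewrite big_ord0.
rewrite (_ : (fun x => _) = fun x => f ord0 x * \prod_(i < m) f (lift ord0 i) x).
  by apply: smoothM; [exact: sf|apply: IH => i; exact: sf].
by apply/funext => x; rewrite big_ord_recl.
Qed.

Lemma smooth_det m (M : pt -> 'M[R]_m) :
  (forall i j, smooth_on V (fun x => M x i j)) -> smooth_on V (fun x => \det (M x)).
Proof.
move=> sM; apply: smooth_sum => s; apply: smoothM; first exact: smooth_const.
by apply: smooth_prod => i; exact: sM.
Qed.

Lemma smooth_inv m (M : pt -> 'M[R]_m) i j :
  (forall i j, smooth_on V (fun x => M x i j)) ->
  (forall x, V x -> M x \in unitmx) -> smooth_on V (fun x => invmx (M x) i j).
Proof.
move=> sM uM.
apply: (@smooth_eq V (fun x => (\det (M x))^-1 * cofactor (M x) j i) _ oV).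
  by move=> x Vx; rewrite /invmx uM // !mxE.
apply: smoothM.
  apply: smoothV; last exact: smooth_det.
  by move=> x Vx; have := uM _ Vx; rewrite unitmxE unitfE.
apply: smoothM; first exact: smooth_const.
by apply: smooth_det => k l; under eq_fun do rewrite !mxE; exact: sM.
Qed.

Lemma smooth_comp W f F : open W -> smooth_on W f -> smooth_map_on V F ->
  (forall x, V x -> W (F x)) -> smooth_on V (fun x => f (F x)).
Proof. by move=> oW sf sF VW; apply: (smooth_alg_smooth oV); apply: (SmComp oW). Qed.

Lemma smooth_coord i : smooth_on V (fun x => x 0 i).
Proof.
pose K (f : pt -> R) := f = (fun x => x 0 i) \/ exists c, f = fun=> c.
apply: (@smooth_coind _ _ V K oV); last by left.
move=> f [->|[c ->]]; split=> [x _|j].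
- exact: coord_continuous.
- by exists (fun=> (j == i)%:R) => [|x _]; [right; exists (j == i)%:R|exact: is_derive_coord].
- exact: cst_continuous.
- by exists (fun=> 0) => [|x _]; [right; exists 0|exact: is_derive_cst].
Qed.

End Closure.

Lemma smooth_sub V V' f : V' `<=` V -> smooth_on V f -> smooth_on V' f.
Proof. by move=> VV sf s x Vx; apply: sf; apply: VV. Qed.

End Smooth.

(** * The inverse function theorem *)

HB.instance Definition _ (R : realType) (m n : nat) := Complete.on 'M[R]_(m.+1, n.+1).

Section InverseFunction.
Context {R : realType} {n : nat}.
Local Notation pt := 'rV[R]_n.+1.
Local Notation e i := (delta_mx 0 i : pt).

(** Transposed with respect to the usual convention, since vectors are rows. *)
Definition jac (F : pt -> pt) (x : pt) : 'M[R]_n.+1 :=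
  \matrix_(j, i) 'D_(e j) (fun y => F y 0 i) x.

Lemma differential_jac V F x : open V -> smooth_map_on V F -> V x ->
  forall v, 'd F x v = v *m jac F x.
Proof.
move=> oV sF Vx v; apply/rowP => i.
have [_ ->] := smooth_map_differential oV sF Vx.
by rewrite mxE; apply: eq_bigr => j _; rewrite mxE.
Qed.

Lemma norm_mulmx (B : 'M[R]_n.+1) : exists2 C : R, 0 < C &
  forall v : pt, `|v *m B| <= C * `|v|.
Proof.
exists (\sum_k \sum_i `|B k i| + 1) => [|v].
  by rewrite ltr_wpDl // sumr_ge0 // => k _; apply: sumr_ge0.
apply: norm_le_coord => [|i].
  by rewrite mulr_ge0 // addr_ge0 // sumr_ge0 // => k _; apply: sumr_ge0.
rewrite mxE; apply: le_trans (ler_norm_sum _ _ _) _.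
apply: (@le_trans _ _ (\sum_k \sum_i `|B k i| * `|v|)); last first.
  by under eq_bigr do rewrite -mulr_suml; rewrite -mulr_suml ler_wpM2r // lerDl.
apply: ler_sum => k _; rewrite normrM mulrC (bigD1 i) //= ler_wpDr //.
  by apply: sumr_ge0 => j _; rewrite mulr_ge0.
by rewrite ler_wpM2l // coord_le_norm.
Qed.

Lemma open_norm (A : set pt) :
  (forall x, A x -> exists2 s : R, 0 < s & forall y, `|y - x| < s -> A y) -> open A.
Proof.
move=> hA; rewrite openE => x /hA[s s0 hs]; apply/nbhs_ballP; exists s => // y.
by rewrite -ball_normE /= distrC; exact: hs.
Qed.

Section Local.
Variables (V0 : set pt) (F : pt -> pt) (x0 : pt).
Hypotheses (oV0 : open V0) (sF : smooth_map_on V0 F) (V0x0 : V0 x0).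
Hypothesis injF : forall x, V0 x -> forall v, 'd F x v = 0 -> v = 0.

Lemma jac_unit x : V0 x -> jac F x \in unitmx.
Proof.
move=> Vx; rewrite -row_free_unit -kermx_eq0; apply/eqP/row_matrixP => i.
rewrite row0; apply: (injF Vx); rewrite (differential_jac oV0 sF Vx).
by apply/sub_kermxP; apply: row_sub.
Qed.

Let B := invmx (jac F x0).
Let H x : pt := x - F x *m B.

(** The differential of H vanishes at x0, so its partial derivatives are small
   nearby. *)
Lemma contraction_ball : exists2 r : R, 0 < r &
  (forall x, `|x - x0| < r -> V0 x) /\
  forall x y, `|x - x0| < r -> `|y - x0| < r -> `|H y - H x| <= 2^-1 * `|y - x|.
Proof.
have sH i : smooth_on V0 (fun x => H x 0 i).
  rewrite (_ : (fun x => _) = fun x : pt => x 0 i - \sum_k F x 0 k * B k i).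
    apply: (smoothB oV0); first exact: smooth_coord.
    by apply: (smooth_sum oV0) => k; apply: (smoothM oV0); [exact: sF|exact: smooth_const].
  by apply/funext => x; rewrite !mxE.
have dH0 i j : 'D_(e j) (fun x => H x 0 i) x0 = 0.
  have h1 : is_derive x0 (e j) (fun x => H x 0 i)
     ((j == i)%:R - \sum_k (F x0 0 k * 0 + 'D_(e j) (fun y => F y 0 k) x0 * B k i)).
    rewrite (_ : (fun x => _) = (fun x : pt => x 0 i) - (fun x => \sum_k F x 0 k * B k i)).
      apply: is_deriveB; first exact: is_derive_coord.
      apply: is_derive_sum' => k.
      exact: is_derive_mul (smooth_derive j (sF k) V0x0) (is_derive_cst (B k i) x0 (e j)).
    by apply/funext => x; rewrite !mxE.
  have [_ ->] := h1; apply/eqP; rewrite subr_eq0; apply/eqP.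
  have := mulmxV (jac_unit V0x0) => /matrixP /(_ j i); rewrite !mxE => <-.
  by apply: eq_bigr => k _; rewrite mulr0 add0r mxE.
have [r1 r10 hr1] := open_ball oV0 V0x0.
(* [partial_lipschitz] loses a factor n + 1. *)
pose c : R := 2^-1 / n.+1%:R; have c0 : 0 < c by rewrite divr_gt0.
have [||s s0 hs] := @common_radius R ('I_n.+1 * 'I_n.+1)%type (fun p s => forall x, `|x - x0| < s ->
   `|'D_(e p.2) (fun x => H x 0 p.1) x| <= c).
- move=> [i j] /=.
  have cj := smooth_continuous (smooth_partial j (sH i)) V0x0.
  have cj' : (fun x => 'D_(e j) (fun x => H x 0 i) x) @ x0 --> (0 : R).
    by rewrite -[X in _ --> X](dH0 i j); exact: cj.
  have /cvgrPdist_le /(_ _ c0) /nbhs_ballP[s /= s0 hs] := cj'.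
  exists s => // x xs; have := hs x; rewrite sub0r normrN; apply.
  by rewrite -ball_normE /= distrC.
- by move=> p s s' ss h x xs; apply: h; apply: lt_le_trans xs ss.
exists (Num.min r1 s); first by rewrite lt_min r10.
split=> [x|x y xr yr]; first by rewrite lt_min => /andP[/hr1].
apply: norm_le_coord => [|i]; first by rewrite mulr_ge0.
have gd z j : `|z - x0| < Num.min r1 s ->
    is_derive z (e j) (fun x => H x 0 i) ('D_(e j) (fun x => H x 0 i) z).
  by rewrite lt_min => /andP[/hr1 V0z _]; apply: smooth_derive (sH i) V0z.
have gb z j : `|z - x0| < Num.min r1 s -> `|'D_(e j) (fun x => H x 0 i) z| <= c.
  by rewrite lt_min => /andP[_ zs]; exact: (hs (i, j)).
have := partial_lipschitz gd gb xr yr.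
by rewrite /c [n.+1%:R * _]mulrC divfK ?gt_eqF // !mxE.
Qed.

(** Solving F x = y amounts to finding a fixed point of the contraction
   x |-> H x + y B. The inverse G is Lipschitz, hence differentiable, and its
   partial derivatives are smooth functions of the point G y; smoothness follows
   by coinduction over the functions y |-> h (G y) with h smooth. *)
Theorem inverse_function : exists V W : set pt,
  [/\ V x0, V `<=` V0 & diffeo V W F].
Proof.
have [r r0 [ballV lipH]] := contraction_ball.
have [CB CB0 hCB] := norm_mulmx B.
pose y0 := F x0.
(* For y in W the map Phi below preserves the ball of radius r / 2, since
   1 / 2 * r / 2 + r / 4 = r / 2. *)
pose W : set pt := [set y | `|(y - y0) *m B| < r / 4].
pose V : set pt := [set x | `|x - x0| < r /\ W (F x)].
have Bu : B \in unitmx by rewrite unitmx_inv jac_unit.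
have FH x y : (F y - F x) *m B = (y - x) - (H y - H x).
  by rewrite mulmxBl /H; apply/rowP => i; rewrite !mxE; ring.
have expand x y : `|x - x0| < r -> `|y - x0| < r -> `|y - x| <= 2 * `|(F y - F x) *m B|.
  move=> xr yr; have := lipH x y xr yr; rewrite FH.
  have := ler_normD ((y - x) - (H y - H x)) (H y - H x); rewrite subrK; lra.
have inj x y : `|x - x0| < r -> `|y - x0| < r -> F x = F y -> x = y.
  move=> xr yr Fxy; have := expand x y xr yr.
  rewrite Fxy subrr mul0mx normr0 mulr0 => h.
  by apply/eqP; rewrite eq_sym -subr_eq0 -normr_eq0 eq_le h normr_ge0.
have surj y : W y -> exists2 x, `|x - x0| < r & F x = y.
  move=> Wy; pose U : set pt := [set x | `|x - x0| <= r / 2].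
  pose Phi x : pt := H x + y *m B.
  have Ur x : U x -> `|x - x0| < r by rewrite /U /= => h; lra.
  have PhiU x : U x -> U (Phi x).
    move=> Ux; rewrite /U /=.
    have -> : Phi x - x0 = (H x - H x0) + (y - y0) *m B.
      by rewrite /Phi /H mulmxBl; apply/rowP => i; rewrite !mxE /y0; ring.
    have x00 : `|x0 - x0| < r by rewrite subrr normr0.
    have := lipH x0 x x00 (Ur _ Ux); have := ler_normD (H x - H x0) ((y - y0) *m B).
    by move: Ux Wy; rewrite /U /W /=; lra.
  pose PhiM := isFun.Build _ _ U U Phi PhiU.
  pose Phif : {fun U >-> U} := HB.pack Phi PhiM.
  have q0 : 0 <= 2^-1 :> R by [].
  have ctr : is_contraction Phif.
    exists (NngNum q0); split; first by rewrite /= invf_lt1 // ltr1n.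
    move=> [a b] [/= Ua Ub]; rewrite /Phi opprD addrACA subrr addr0.
    by apply: lipH; apply: Ur.
  have U0 : U !=set0 by exists x0; rewrite /U /= subrr normr0 divr_ge0 // ltW.
  have clU : closed U.
    rewrite (_ : U = closed_ball x0 (r / 2)); first exact: closed_ball_closed.
    rewrite closed_ballE ?divr_gt0 //; apply/seteqP.
    by split => z; rewrite /U /closed_ball_ /= distrC.
  have [x Ux xE] := banach_fixed_point ctr clU U0.
  exists x; first exact: Ur.
  have : F x *m B = y *m B.
    have E : x = H x + y *m B := xE.
    rewrite /H in E; move: (F x *m B) (y *m B) E => p q E.
    by apply/rowP => i; have /rowP/(_ i) := E; rewrite !mxE; lra.
  by move/(congr1 (mulmx^~ (jac F x0))); rewrite !mulmxKV ?jac_unit.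
pose G y : pt := xget x0 [set x | `|x - x0| < r /\ F x = y].
have GP y : W y -> `|G y - x0| < r /\ F (G y) = y.
  move=> /surj[x xr xy]; rewrite /G; case: xgetP => [z -> //|/(_ x)].
  by case; split.
have oW : open W.
  apply: open_norm => y Wy; exists ((r / 4 - `|(y - y0) *m B|) / CB).
    by rewrite divr_gt0 // subr_gt0.
  move=> y'; rewrite ltr_pdivlMr // => yy.
  have -> : y' = (y' - y) + y by rewrite subrK.
  rewrite /W /= -addrA mulmxDl; apply: le_lt_trans (ler_normD _ _) _.
  by have := hCB (y' - y); lra.
have oV : open V.
  apply: open_norm => x [xr WFx].
  have d0 : 0 < r / 4 - `|(F x - y0) *m B| by rewrite subr_gt0.
  exists (Num.min (r - `|x - x0|) ((r / 4 - `|(F x - y0) *m B|) / 2)).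
    by rewrite lt_min subr_gt0 xr divr_gt0.
  move=> x'; rewrite lt_min => /andP[h1 h2].
  have x'r : `|x' - x0| < r.
    have -> : x' - x0 = (x' - x) + (x - x0) by rewrite subrKA.
    by apply: le_lt_trans (ler_normD _ _) _; lra.
  split=> //; rewrite /W /=.
  have -> : F x' - y0 = (F x' - F x) + (F x - y0) by rewrite subrKA.
  rewrite mulmxDl; apply: le_lt_trans (ler_normD _ _) _.
  have := lipH x x' xr x'r; rewrite FH.
  have := ler_normB (x' - x) (H x' - H x); lra.
have GF x : V x -> G (F x) = x.
  by move=> [xr WFx]; have [gr ge] := GP _ WFx; apply: inj.
have VG y : W y -> V (G y) by move=> Wy; have [gr ge] := GP _ Wy; split=> //; rewrite ge.
have Glip y y' : W y -> W y' -> `|G y' - G y| <= 2 * CB * `|y' - y|.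
  move=> Wy Wy'; have [gr ge] := GP _ Wy; have [gr' ge'] := GP _ Wy'.
  apply: le_trans (expand _ _ gr gr') _; rewrite ge ge' -mulrA ler_wpM2l //.
have sVF : smooth_map_on V F by move=> i; apply: smooth_sub (sF i) => x [/ballV].
exists V, W; split.
- by split; rewrite /W /= ?subrr ?mul0mx normr0 ?divr_gt0.
- by move=> x [/ballV].
split=> //; first by move=> x [].
exists G; split=> //; last by move=> y Wy; have [] := GP _ Wy.
have V0G y : W y -> V0 (G y) by move=> /GP[/ballV].
have JG y (Wy : W y) : jac F (G y) \in unitmx by apply/jac_unit/V0G.
pose K i j (y : pt) := invmx (jac F (G y)) j i.
have ne1 (t : R) j : `|t *: e j| <= `|t|.
  apply: norm_le_coord => // k; rewrite !mxE eqxx /= normrM.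
  by rewrite ler_piMr // normr_nat; case: eqP.
have dG y i j : W y -> is_derive y (e j) (fun y => G y 0 i) (K i j y).
  move=> Wy; have [CJ CJ0 hCJ] := norm_mulmx (invmx (jac F (G y))).
  have [dF _] := smooth_map_differential oV0 sF (V0G _ Wy).
  have [d d0 hd] := open_ball oW Wy.
  have cv : h^-1 *: (((fun y => G y 0 i) \o shift y) (h *: e j) - G y 0 i) @[h --> 0^'] --> K i j y.
    apply/cvgrPdist_le => eps eps0.
    pose eps' := eps / (CJ * (2 * CB)).
    have eps'0 : 0 < eps' by rewrite divr_gt0 // !mulr_gt0.
    have /eqaddoP/(_ _ eps'0)/nbhs_ballP[s /= s0 hs] := diff_locally dF.
    near=> t.
    have t0 : t != 0 by near: t; exact: nbhs_dnbhs_neq.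
    have td : `|t| < d by near: t; exact: dnbhs0_lt.
    have ts : `|t| < s / (2 * CB).
      by near: t; apply: dnbhs0_lt; rewrite divr_gt0 // mulr_gt0.
    have Wt : W (t *: e j + y).
      by apply: hd; rewrite addrK; apply: le_lt_trans (ne1 t j) td.
    pose h := G (t *: e j + y) - G y.
    have ht : `|h| <= 2 * CB * `|t|.
      apply: le_trans (Glip _ _ Wy Wt) _; rewrite addrK ler_wpM2l ?ne1 //.
      by rewrite mulr_ge0 // ltW.
    have hs' : `|h| < s.
      by apply: le_lt_trans ht _; rewrite mulrC -ltr_pdivlMr // mulr_gt0.
    have := hs h; rewrite -ball_normE /= sub0r normrN => /(_ hs').
    rewrite -![(_ + _ : _ -> _) _]/(_ + _) -![(- _ : _ -> _) _]/(- _) /=.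
    rewrite -![(_ + _ : _ -> _) _]/(_ + _) /= subrK.
    have [_ ->] := GP _ Wt; have [_ ->] := GP _ Wy.
    rewrite (differential_jac oV0 sF (V0G _ Wy)) => H1.
    have H2 : t *: e j + y - (y + h *m jac F (G y)) = t *: e j - h *m jac F (G y).
      by rewrite opprD addrA addrK.
    rewrite H2 in H1.
    have H3 := hCJ (t *: e j - h *m jac F (G y)).
    rewrite mulmxBl mulmxK ?JG // -scalemxAl in H3.
    have -> : K i j y = (e j *m invmx (jac F (G y))) 0 i.
      by rewrite -rowE mxE.
    move: (e j *m _) H3 => v H3.
    have -> : v 0 i - t^-1 *: (G (t *: e j + y) 0 i - G y 0 i) = t^-1 * (t *: v - h) 0 i.
      by rewrite /h !mxE /GRing.scale /=; field.
    rewrite normrM normfV ler_pdivrMl ?normr_gt0 //.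
    apply: le_trans (coord_le_norm _ _) _; apply: le_trans H3 _.
    apply: (@le_trans _ _ (CJ * (eps' * (2 * CB * `|t|)))).
      rewrite ler_wpM2l ?(ltW CJ0) //; apply: le_trans H1 _.
      by rewrite ler_wpM2l // ltW.
    rewrite le_eqVlt /eps'; apply/orP; left; apply/eqP; field.
    by rewrite !gt_eqF.
  by split; [apply/cvg_ex; exists (K i j y)|apply: cvg_lim].
have cG y : W y -> {for y, continuous G}.
  move=> Wy; have [d d0 hd] := open_ball oW Wy.
  suff : G @ y --> G y by [].
  apply/(@cvgrPdist_le _ _ _ (nbhs y)) => eps eps0; apply/nbhs_ballP.
  exists (Num.min d (eps / (2 * CB))); first by rewrite /= lt_min d0 divr_gt0 // mulr_gt0.
  move=> z; rewrite -ball_normE /= lt_min => /andP[zd]; rewrite ltr_pdivlMr ?mulr_gt0 // => zs.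
  have Wz : W z by apply: hd; rewrite distrC.
  by apply: le_trans (Glip _ _ Wz Wy) _; rewrite mulrC ltW.
(* Closed under partial derivatives: D_j (h o G) is the sum over i of
   (K i j) * (D_i h) o G, where K i j is itself a smooth function of G. *)
pose C (g : pt -> R) := exists2 h, smooth_on V0 h & g = fun y => h (G y).
suff sG g : C g -> smooth_on W g.
  move=> i; apply: sG; exists (fun x => x 0 i) => //.
  exact: smooth_coord.
move: g; apply: (smooth_coind oW) => _ [h sh ->].
have cC h' : smooth_on V0 h' -> forall y, W y -> {for y, continuous (fun y => h' (G y))}.
  move=> sh' y Wy; suff : {for y, continuous (h' \o G)} by [].
  by apply: continuous_comp; [exact: cG|exact: smooth_continuous sh' (V0G _ Wy)].
have sK i j : smooth_on V0 (fun x => invmx (jac F x) j i).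
  apply: (smooth_inv oV0) => [k l|x]; last exact: jac_unit.
  rewrite (_ : (fun x => _) = fun x => 'D_(e k) (fun y => F y 0 l) x).
    exact/smooth_partial/sF.
  by apply/funext => x; rewrite mxE.
have dGi y i : W y -> differentiable (fun y => G y 0 i) y.
  move=> Wy; have [s s0 hs] := open_ball oW Wy.
  have A z k (zs : `|z - y| < s) := dG z i k (hs _ zs).
  have B' k : {for y, continuous (K i k)} := cC _ (sK i k) _ Wy.
  by have [] := C1_differential s0 A B'.
split=> [|j]; first exact: cC.
exists (fun y => \sum_i K i j y * 'D_(e i) h (G y)).
  exists (fun x => \sum_i invmx (jac F x) j i * 'D_(e i) h x); last by [].
  by apply: (smooth_sum oV0) => i; exact: (smoothM oV0 (sK i j) (smooth_partial i sh)).
move=> y Wy.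
have [dGy dGE] := map_differentiable (fun i => dGi y i Wy).
have [dh hE] := smooth_differential oV0 sh (V0G _ Wy).
have dhG : differentiable (h \o G) y by apply: differentiable_comp.
split; first by apply: (@diff_derivable _ _ _ (h \o G) y (e j)).
transitivity ('D_(e j) (h \o G) y); first by [].
rewrite (deriveE (e j) dhG) (diff_comp dGy dh) /= hE.
apply: eq_bigr => i _; rewrite dGE; congr (_ * _).
have [_ d2] := dG y i j Wy; rewrite -d2.
exact: (esym (deriveE (e j) (dGi y i Wy))).
Unshelve. all: by end_near. Qed.

End Local.
End InverseFunction.

(** * Symplectic frames of the contact planes *)

Section ContactAlgebra.
Context {R : realType}.
Local Notation pt := 'rV[R]_5.
Implicit Types (t u v w : pt).

Definition mk5 (a b c d e : R) : pt := \row_i nth 0 [:: a; b; c; d; e] i.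

Lemma row5P v w : cx v = cx w -> cy v = cy w -> cz v = cz w -> cp v = cp w ->
  cq v = cq w -> v = w.
Proof.
move=> h0 h1 h2 h3 h4; apply/rowP.
by case=> [[|[|[|[|[|//]]]]] i]; [have := h0|have := h1|have := h2|have := h3|have := h4];
  rewrite /cx /cy /cz /cp /cq; rewrite (bool_irrelevance i isT).
Qed.

Lemma mk5E a b c d e : (cx (mk5 a b c d e) = a) * (cy (mk5 a b c d e) = b) *
  (cz (mk5 a b c d e) = c) * (cp (mk5 a b c d e) = d) * (cq (mk5 a b c d e) = e).
Proof. by rewrite /cx /cy /cz /cp /cq !mxE. Qed.

Lemma coordD v w : (cx (v + w) = cx v + cx w) * (cy (v + w) = cy v + cy w) *
  (cz (v + w) = cz v + cz w) * (cp (v + w) = cp v + cp w) * (cq (v + w) = cq v + cq w).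
Proof. by rewrite /cx /cy /cz /cp /cq !mxE. Qed.

Lemma coordZ a v : (cx (a *: v) = a * cx v) * (cy (a *: v) = a * cy v) *
  (cz (a *: v) = a * cz v) * (cp (a *: v) = a * cp v) * (cq (a *: v) = a * cq v).
Proof. by rewrite /cx /cy /cz /cp /cq !mxE. Qed.

(** The differential of the contact form. *)
Definition Om v w : R := cx v * cp w - cp v * cx w + (cy v * cq w - cq v * cy w).

(** The Reeb field of the contact form, which is constant in these coordinates. *)
Definition ez : pt := mk5 0 0 1 0 0.

Definition symplectic_frame t (h x f s : pt) :=
  [/\ contact_form t h = 0, contact_form t x = 0, contact_form t f = 0 & contact_form t s = 0] /\
  [/\ Om h f = 1, Om x s = 1, Om h x = 0, Om h s = 0 & Om x f = 0 /\ Om f s = 0].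

(** The matrix of the frame is symplectic, so its right inverse is also a left
   inverse; the coordinates of a vector are its pairings with the frame. *)
Lemma symplectic_expand t h x f s : symplectic_frame t h x f s -> forall v,
  v = contact_form t v *: ez + Om v f *: h + Om v s *: x + Om h v *: f + Om x v *: s.
Proof.
move=> [[ch cx' cf cs] [hf xs hx hs [xf fs]]] v.
pose rw (k : 'I_4) := nth 0 [:: h; x; f; s] k.
pose cm (a : 'I_4) (u : pt) := nth 0 [:: cx u; cy u; cp u; cq u] a.
pose kk (k : 'I_4) (u : pt) := nth 0 [:: Om u f; Om u s; Om h u; Om x u] k.
pose bas (a : 'I_4) : pt := nth 0 [:: mk5 1 0 0 0 0; mk5 0 1 0 0 0; mk5 0 0 0 1 0; mk5 0 0 0 0 1] a.
pose M := \matrix_(k < 4, a < 4) cm a (rw k).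
pose K := \matrix_(a < 4, k < 4) kk k (bas a).
have MK : M *m K = 1%:M.
  apply/matrixP => i j; rewrite !mxE !big_ord_recl big_ord0 !mxE.
  move: hf xs hx hs xf fs; rewrite /Om => hf xs hx hs xf fs.
  case: i => [[|[|[|[|//]]]] ?]; case: j => [[|[|[|[|//]]]] ?];
    rewrite /cm /kk /rw /bas /Om /= !mk5E; lra.
have KM := mulmx1C MK.
have E (a b : 'I_4) : \sum_k kk k (bas a) * cm b (rw k) = (a == b)%:R.
  move/matrixP: KM => /(_ a b); rewrite !mxE => <-.
  by apply: eq_bigr => k _; rewrite !mxE.
have L (k : 'I_4) : kk k v = \sum_a cm a v * kk k (bas a).
  rewrite !big_ord_recl big_ord0.
  by case: k => [[|[|[|[|//]]]] ?]; rewrite /kk /cm /bas /Om /= !mk5E; ring.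
have C (b : 'I_4) : cm b v = \sum_k kk k v * cm b (rw k).
  transitivity (\sum_a cm a v * (a == b)%:R).
    rewrite (bigD1 b) //= eqxx mulr1 big1 ?addr0 // => a /negPf ab.
    by rewrite ab mulr0.
  under eq_bigr do rewrite -E mulr_sumr.
  rewrite exchange_big /=; apply: eq_bigr => k _.
  by rewrite L mulr_suml; apply: eq_bigr => a _; rewrite mulrA.
have := C (@Ordinal 4 0 isT); have := C (@Ordinal 4 1 isT).
have := C (@Ordinal 4 2 isT); have := C (@Ordinal 4 3 isT).
rewrite !big_ord_recl !big_ord0 /cm /kk /rw /= => C3 C2 C1 C0.
apply: row5P; rewrite !coordD !coordZ /ez !mk5E.
- by rewrite {1}C0; ring.
- by rewrite {1}C1; ring.
- move: ch cx' cf cs; rewrite /contact_form => ch cx' cf cs.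
  have -> : cz h = cp t * cx h + cq t * cy h by lra.
  have -> : cz x = cp t * cx x + cq t * cy x by lra.
  have -> : cz f = cp t * cx f + cq t * cy f by lra.
  have -> : cz s = cp t * cx s + cq t * cy s by lra.
  by rewrite {1}C0 {1}C1; ring.
- by rewrite {1}C2; ring.
- by rewrite {1}C3; ring.
Qed.

End ContactAlgebra.

(** * Differentials in coordinates *)

Section Differentials.
Context {R : realType} {n : nat}.
Local Notation pt := 'rV[R]_n.+1.
Local Notation e i := (delta_mx 0 i : pt).
Implicit Types (V : set pt) (f g : pt -> R).

(** Coordinate expression of the differential of f at t. It is linear in v
   by construction, even where f is not differentiable. *)
Definition dd f t (v : pt) : R := \sum_i v 0 i * 'D_(e i) f t.

Lemma dd_scalar f t : scalar (dd f t).
Proof.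
move=> a u v; rewrite /dd mulr_sumr -big_split /=; apply: eq_bigr => i _.
by rewrite !mxE; ring.
Qed.

Lemma ddDr f t u v : dd f t (u + v) = dd f t u + dd f t v.
Proof. by have := dd_scalar f t 1 u v; rewrite scale1r mul1r. Qed.

Lemma ddZr f t a v : dd f t (a *: v) = a * dd f t v.
Proof.
have := dd_scalar f t a v 0; rewrite !addr0 => ->.
by rewrite [dd f t 0]big1 ?addr0 // => i _; rewrite mxE mul0r.
Qed.

Section OnV.
Variables (V : set pt) (oV : open V).

Lemma dd_differential f t v : smooth_on V f -> V t -> 'd f t v = dd f t v.
Proof. by move=> sf Vt; have [_ ->] := smooth_differential oV sf Vt. Qed.

Lemma dd_map F t v i : smooth_map_on V F -> V t ->
  ('d F t v : pt) 0 i = dd (fun y => F y 0 i) t v.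
Proof. by move=> sF Vt; have [_ ->] := smooth_map_differential oV sF Vt. Qed.

Lemma ddD f g t v : smooth_on V f -> smooth_on V g -> V t ->
  dd (fun x => f x + g x) t v = dd f t v + dd g t v.
Proof.
move=> sf sg Vt; rewrite /dd -big_split /=; apply: eq_bigr => i _; rewrite -mulrDr.
by have [_ <-] := is_deriveD (smooth_derive i sf Vt) (smooth_derive i sg Vt).
Qed.

Lemma ddM f g t v : smooth_on V f -> smooth_on V g -> V t ->
  dd (fun x => f x * g x) t v = f t * dd g t v + dd f t v * g t.
Proof.
move=> sf sg Vt; rewrite /dd mulr_sumr mulr_suml -big_split /=.
apply: eq_bigr => i _.
by have [_ ->] := is_derive_mul (smooth_derive i sf Vt) (smooth_derive i sg Vt); ring.
Qed.

Lemma dd_const c t v : dd (fun=> c) t v = 0.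
Proof. by rewrite /dd big1 // => i _; rewrite derive_cst mulr0. Qed.

Lemma ddN f t v : smooth_on V f -> V t -> dd (fun x => - f x) t v = - dd f t v.
Proof.
move=> sf Vt; rewrite /dd -sumrN; apply: eq_bigr => i _; rewrite -mulrN.
by have [_ <-] := is_deriveN (smooth_derive i sf Vt).
Qed.

Lemma ddB f g t v : smooth_on V f -> smooth_on V g -> V t ->
  dd (fun x => f x - g x) t v = dd f t v - dd g t v.
Proof. by move=> sf sg Vt; rewrite (ddD v sf (smoothN oV sg) Vt) (ddN v sg Vt). Qed.

Lemma dd_eq f g t v : (forall x, V x -> f x = g x) -> V t -> dd f t v = dd g t v.
Proof.
move=> fg Vt; apply: eq_bigr => i _; congr (_ * _); apply: near_eq_derive.
by have := near_open oV Vt; apply: filterS => x /fg.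
Qed.

Lemma dd_coord i t v : dd (fun x => x 0 i) t v = v 0 i.
Proof.
rewrite /dd (bigD1 i) //= big1 ?addr0 => [|k ki].
  by have [_ ->] := is_derive_coord t i i; rewrite eqxx mulr1.
by have [_ ->] := is_derive_coord t k i; rewrite (negPf ki) mulr0.
Qed.

Lemma dd_smooth f (v : pt -> pt) : smooth_on V f -> smooth_map_on V v ->
  smooth_on V (fun t => dd f t (v t)).
Proof.
move=> sf sv; apply: (smooth_sum oV) => i; apply: (smoothM oV); first exact: sv.
exact: smooth_partial.
Qed.

Lemma dd_dd f t v w : smooth_on V f -> V t ->
  dd (fun x => dd f x w) t v =
  \sum_i \sum_j v 0 i * w 0 j * 'D_(e i) (fun x => 'D_(e j) f x) t.
Proof.
move=> sf Vt; apply: eq_bigr => i _.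
have h j := is_derive_mul (is_derive_cst (w 0 j) t (e i))
   (smooth_derive i (smooth_partial j sf) Vt).
have [_ ->] := is_derive_sum' h; rewrite mulr_sumr; apply: eq_bigr => j _.
by rewrite mul0r addr0 mulrA.
Qed.

Lemma smooth_pullback1 W (a : form1 R n) F : open W -> smooth_map_on V F ->
  (forall t, V t -> W (F t)) -> smooth_form1 W a -> smooth_form1 V (pullback1 F a).
Proof.
move=> oW sF VW sa; split=> [t Vt b u v|v].
  by rewrite /pullback1 linearP; have [al _] := sa; rewrite al //; exact: VW.
apply: (@smooth_eq _ _ V (fun t => \sum_i dd (fun y => F y 0 i) t v * a (F t) (e i)) _ oV).
  move=> t Vt; have [al _] := sa.
  pose lM := GRing.isLinear.Build _ _ _ _ _ (al _ (VW _ Vt)).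
  pose L : {linear pt -> R^o} := HB.pack (a (F t)) lM.
  rewrite /pullback1 -[a (F t) _]/(L _) [X in L X]row_sum_delta linear_sum.
  by apply: eq_bigr => i _; rewrite linearZ (dd_map _ _ sF Vt).
apply: (smooth_sum oV) => i; apply: (smoothM oV).
  by apply: dd_smooth; [exact: sF|move=> j; exact: smooth_const].
by have [_ as_] := sa; exact: (smooth_comp oV oW (as_ (e i)) sF VW).
Qed.

End OnV.

(** The chain rule applied to F o G = id. *)
Lemma inverse_differential V W F G y w : open V -> open W ->
  smooth_map_on V F -> smooth_map_on W G -> (forall y, W y -> V (G y)) ->
  (forall y, W y -> F (G y) = y) -> W y -> 'd F (G y) ('d G y w) = w.
Proof.
move=> oV oW sF sG WV FG Wy.
have [dF _] := smooth_map_differential oV sF (WV _ Wy).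
have [dG _] := smooth_map_differential oW sG Wy.
have dFG : differentiable (F \o G) y by apply: differentiable_comp.
have E := diff_comp dG dF.
transitivity ('d (F \o G) y w); first exact: (esym (congr1 (fun h => h w) E)).
rewrite -(deriveE w dFG) -[RHS](derive_id y w); apply: near_eq_derive.
by have := near_open oW Wy; apply: filterS => z /FG.
Qed.

End Differentials.

(** * Transport of exterior differential systems *)

Section Eds.
Context {R : realType}.
Local Notation pt := 'rV[R]_5.
Implicit Types (V W : set pt) (t u v w : pt).

Lemma smooth_cx V : open V -> [/\ smooth_on V cx, smooth_on V cy, smooth_on V cz,
  smooth_on V cp & smooth_on V (cq : pt -> R)].
Proof. by move=> oV; split; apply: smooth_coord. Qed.

Lemma smooth_contact V v : open V -> smooth_on V (fun t => contact_form t v).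
Proof.
move=> oV; have [_ _ _ sp sq] := smooth_cx oV.
have sc c := smooth_const oV c.
exact: (smoothB oV (smoothB oV (sc _) (smoothM oV sp (sc _))) (smoothM oV sq (sc _))).
Qed.

Lemma dd_contact t v w : dd (fun y => contact_form y w) t v = - (cp v * cx w) - cq v * cy w.
Proof.
have oT : open [set: pt] by exact: openT.
have [_ _ _ sp sq] := smooth_cx oT.
have sc c := smooth_const oT c.
have spx := smoothM oT sp (sc (cx w)); have sqy := smoothM oT sq (sc (cy w)).
rewrite /contact_form.
rewrite (ddB oT _ (smoothB oT (sc (cz w)) spx) sqy) //.
rewrite (ddB oT _ (sc (cz w)) spx) //.
rewrite (ddM _ sp (sc _)) // (ddM _ sq (sc _)) // !dd_const.
by rewrite /cp /cq !dd_coord; ring.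
Qed.

Lemma ext_deriv_contact t v w : ext_deriv contact_form t v w = Om v w.
Proof.
have oT : open [set: pt] by exact: openT.
rewrite /ext_deriv.
have D u u' : 'D_u (fun y => contact_form y u') t = dd (fun y => contact_form y u') t u.
  have [d _] := smooth_differential oT (smooth_contact u' oT) (I : setT t).
  by rewrite (deriveE u d) (dd_differential oT _ (smooth_contact u' oT)).
by rewrite !D !dd_contact /Om; ring.
Qed.

Lemma contact_scalar t : scalar (contact_form t).
Proof. by move=> a u v; rewrite /contact_form !coordD !coordZ; ring. Qed.

Section Carry.
Variables (V W : set pt) (F G : pt -> pt) (E E' : ma_equation R).
Variables (ell sig : pt -> R) (zeta : form1 R 4).
Hypotheses (oV : open V) (oW : open W) (sF : smooth_map_on V F) (sG : smooth_map_on W G).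
Hypotheses (VW : forall t, V t -> W (F t)) (WV : forall y, W y -> V (G y)).
Hypothesis FG : forall y, W y -> F (G y) = y.
Hypotheses (sell : smooth_on V ell) (ell0 : forall t, V t -> ell t != 0).
Hypotheses (ssig : smooth_on V sig) (sig0 : forall t, V t -> sig t != 0).
Hypothesis szeta : smooth_form1 V zeta.
Hypothesis FU : forall t v, V t -> contact_form (F t) ('d F t v) = ell t * contact_form t v.
Hypothesis FdU : forall t v w, V t -> Om ('d F t v) ('d F t w) =
  ell t * Om v w + wedge (dd ell t) (contact_form t) v w.
Hypothesis Fom : forall t v w, V t -> ma_form E' (F t) ('d F t v) ('d F t w) =
  sig t * ma_form E t v w + wedge (zeta t) (contact_form t) v w.

(** F multiplies the generators U and om by invertible functions modulo the ideal.
   Hence pullback by F maps the ideal of E' into that of E, and the formulas can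
   be inverted with the inverse diffeomorphism G. *)
Lemma carries_edsP : carries_eds V W F E E'.
Proof.
have comp f : smooth_on V f -> smooth_on W (fun y => f (G y)).
  by move=> sf; exact: (smooth_comp oW oV sf sG WV).
have comp' f : smooth_on W f -> smooth_on V (fun y => f (F y)).
  by move=> sf; exact: (smooth_comp oV oW sf sF VW).
have dGK y w : W y -> 'd F (G y) ('d G y w) = w.
  by move=> Wy; apply: (inverse_differential _ oV oW sF sG WV FG).
have FU' t v u : V t -> 'd F t v = u -> contact_form (F t) u = ell t * contact_form t v.
  by move=> Vt <-; exact: FU.
have FdU' t v w u u' : V t -> 'd F t v = u -> 'd F t w = u' -> Om u u' =
    ell t * Om v w + wedge (dd ell t) (contact_form t) v w.
  by move=> Vt <- <-; exact: FdU.
have Fom' t v w u u' : V t -> 'd F t v = u -> 'd F t w = u' -> ma_form E' (F t) u u' =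
    sig t * ma_form E t v w + wedge (zeta t) (contact_form t) v w.
  by move=> Vt <- <-; exact: Fom.
have pb1 (a : form1 R 4) t v u y : F t = y -> 'd F t v = u -> pullback1 F a t v = a y u.
  by move=> <- <-.
have pb2 (b : form2 R 4) t v w u u' y : F t = y -> 'd F t v = u -> 'd F t w = u' ->
    pullback2 F b t v w = b y u u'.
  by move=> <- <- <-.
have UG y v : W y -> contact_form y v = ell (G y) * contact_form (G y) ('d G y v).
  move=> Wy; have := FU' _ _ _ (WV Wy) (dGK _ v Wy).
  by rewrite (FG Wy) => ->.
have dUG y v w : W y -> Om v w = ell (G y) * Om ('d G y v) ('d G y w)
    + wedge (dd ell (G y)) (contact_form (G y)) ('d G y v) ('d G y w).
  by move=> Wy; exact: (FdU' _ _ _ _ _ (WV Wy) (dGK _ v Wy) (dGK _ w Wy)).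
have omG y v w : W y -> ma_form E' y v w = sig (G y) * ma_form E (G y) ('d G y v) ('d G y w)
    + wedge (zeta (G y)) (contact_form (G y)) ('d G y v) ('d G y w).
  move=> Wy; have := Fom' _ _ _ _ _ (WV Wy) (dGK _ v Wy) (dGK _ w Wy).
  by rewrite (FG Wy) => ->.
have siell := smoothV oV ell0 sell; have sisig := smoothV oV sig0 ssig.
have sdell v : smooth_on V (fun t => dd ell t v).
  by apply: (dd_smooth oV sell) => i; exact: (smooth_const oV).
split=> [a sa|b sb]; split.
- move=> [f sf fE]; exists (fun t => f (F t) * ell t).
    exact: (smoothM oV (comp' _ sf) sell).
  move=> t Vt v; rewrite /pullback1 (fE _ (VW Vt)) (FU v Vt) mulrA; exact: erefl.
- move=> [f sf fE]; exists (fun y => f (G y) / ell (G y)).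
    exact: (comp (fun t => f t / ell t) (smoothM oV sf siell)).
  move=> y Wy v; have := fE _ (WV Wy) ('d G y v).
  rewrite (pb1 a _ _ _ _ (FG Wy) (dGK _ v Wy)) (UG _ v Wy) => ->.
  have l0 := ell0 (WV Wy).
  by rewrite mulrA divfK.
- move=> [f [g [eta [sf sg se bE]]]].
  have se' := smooth_pullback1 oV oW sF VW se.
  exists (fun t => f (F t) * sig t), (fun t => g (F t) * ell t),
    (fun t v => f (F t) * zeta t v + g (F t) * dd ell t v + ell t * pullback1 F eta t v).
  have cf := comp' _ sf; have cg := comp' _ sg.
  have [zl zs] := szeta; have [el es] := se'.
  split; [exact: (smoothM oV cf ssig)|exact: (smoothM oV cg sell)| |].
    split=> [t Vt c u v|v].
      by rewrite (zl _ Vt) (el _ Vt) (dd_scalar ell t); ring.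
    exact: (smoothD oV (smoothD oV (smoothM oV cf (zs v)) (smoothM oV cg (sdell v)))
      (smoothM oV sell (es v))).
  move=> t Vt v w; rewrite ext_deriv_contact /pullback2 (bE _ (VW Vt)) ext_deriv_contact.
  rewrite (Fom v w Vt) (FdU v w Vt) /wedge (FU v Vt) (FU w Vt) /pullback1.
  move: (eta _ _) (eta _ _) (zeta _ _) (zeta _ _) (ma_form _ _ _ _) (Om _ _).
  move: (contact_form _ _) (contact_form _ _) (dd _ _ _) (dd _ _ _) (f _) (g _) (sig _) (ell _).
  move=> *; ring.
- move=> [f [g [eta [sf sg se bE]]]].
  pose chi : form1 R 4 := fun t v =>
    (eta t v - f t / sig t * zeta t v - g t / ell t * dd ell t v) / ell t.
  have schi : smooth_form1 V chi.
    have [zl zs] := szeta; have [el es] := se.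
    split=> [t Vt c u v|v].
      by rewrite /chi (zl _ Vt) (el _ Vt) (dd_scalar ell t); ring.
    exact: (smoothM oV (smoothB oV (smoothB oV (es v) (smoothM oV (smoothM oV sf sisig) (zs v)))
      (smoothM oV (smoothM oV sg siell) (sdell v))) siell).
  exists (fun y => f (G y) / sig (G y)), (fun y => g (G y) / ell (G y)), (pullback1 G chi).
  split.
  - exact: (comp (fun t => f t / sig t) (smoothM oV sf sisig)).
  - exact: (comp (fun t => g t / ell t) (smoothM oV sg siell)).
  - exact: (smooth_pullback1 oW oV sG WV schi).
  move=> y Wy v' w'; have Vt := WV Wy.
  have := bE _ Vt ('d G y v') ('d G y w').
  rewrite (pb2 b _ _ _ _ _ _ (FG Wy) (dGK _ v' Wy) (dGK _ w' Wy)) => ->.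
  rewrite !ext_deriv_contact (omG _ v' w' Wy) (dUG _ v' w' Wy).
  rewrite /wedge (UG _ v' Wy) (UG _ w' Wy) /pullback1 /chi.
  have l0 := ell0 Vt; have s0 := sig0 Vt.
  by field; rewrite l0 s0.
Qed.

End Carry.
End Eds.

(** * Contact maps built from first integrals *)

Section Geometry.
Context {R : realType}.
Local Notation pt := 'rV[R]_5.
Local Notation e i := (delta_mx 0 i : pt).

Lemma open_neq0 (V : set pt) (f : pt -> R) : open V -> smooth_on V f ->
  open (V `&` [set t | f t != 0]).
Proof.
move=> oV sf; rewrite openE => t [Vt ft].
have ct : f @ t --> f t := smooth_continuous sf Vt.
have n0 : \forall y \near f t, y != 0.
  by apply: open_nbhs_nbhs; split=> //; exact: open_neq.
have nf : \forall x \near t, f x != 0 := ct _ n0.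
have nV := near_open oV Vt.
by apply: filterS2 nV nf => x.
Qed.

Section MaForm.
Variables (E : ma_equation R) (t : pt).
Lemma ma_formDl u v w : ma_form E t (u + v) w = ma_form E t u w + ma_form E t v w.
Proof. by rewrite /ma_form /wedge !coordD; ring. Qed.
Lemma ma_formZl a u w : ma_form E t (a *: u) w = a * ma_form E t u w.
Proof. by rewrite /ma_form /wedge !coordZ; ring. Qed.
Lemma ma_formC u w : ma_form E t u w = - ma_form E t w u.
Proof. by rewrite /ma_form /wedge; ring. Qed.
Lemma ma_formDr u v w : ma_form E t w (u + v) = ma_form E t w u + ma_form E t w v.
Proof. by rewrite /ma_form /wedge !coordD; ring. Qed.
Lemma ma_formZr a u w : ma_form E t w (a *: u) = a * ma_form E t w u.
Proof. by rewrite /ma_form /wedge !coordZ; ring. Qed.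
Lemma ma_form_ez w : ma_form E t ez w = 0.
Proof. by rewrite /ma_form /wedge /ez !mk5E; ring. Qed.
Lemma ma_form_self u : ma_form E t u u = 0.
Proof. by rewrite /ma_form /wedge; ring. Qed.
End MaForm.

Lemma span2P (a b v : pt) : reflect (exists c d, v = c *: a + d *: b)
  (v \in (<[a]> + <[b]>)%VS).
Proof.
apply: (iffP memv_addP) => [[_ /vlineP[c ->] [_ /vlineP[d ->] ->]]|[c [d ->]]].
  by exists c, d.
exists (c *: a); first by apply/vlineP; exists c.
by exists (d *: b) => //; apply/vlineP; exists d.
Qed.

Lemma dim_span2 (a b : pt) : (forall c d, c *: a + d *: b = 0 -> c = 0 /\ d = 0) ->
  \dim (<[a]> + <[b]>)%VS = 2%N.
Proof.
move=> h.
have a0 : a != 0.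
  apply/eqP => a0; have [] := h 1 0; first by rewrite a0 !scaler0 add0r scale0r.
  by move/eqP; rewrite oner_eq0.
have b0 : b != 0.
  apply/eqP => b0; have [] := h 0 1; first by rewrite b0 !scaler0 addr0 scale0r.
  by move=> _ /eqP; rewrite oner_eq0.
rewrite dimv_disjoint_sum ?dim_vline ?a0 ?b0 //.
apply/eqP; rewrite -subv0; apply/subvP => v; rewrite memv_cap memv0.
move=> /andP[/vlineP[c ->] /vlineP[d cd]].
have [] := h c (- d); first by rewrite cd scaleNr subrr.
by move=> ->; rewrite scale0r.
Qed.

(** Exchange of second partial derivatives. It is a hypothesis in this part,
   established for sums of series, where it is immediate. *)
Definition second_sym (V : set pt) (f : pt -> R) := forall t i j, V t ->
  'D_(e i) (fun x => 'D_(e j) f x) t = 'D_(e j) (fun x => 'D_(e i) f x) t.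

Section ContactMap.
Variables (V : set pt) (X Y Z P Q ell : pt -> R).
Hypotheses (oV : open V) (sX : smooth_on V X) (sY : smooth_on V Y) (sZ : smooth_on V Z)
  (sP : smooth_on V P) (sQ : smooth_on V Q) (sell : smooth_on V ell).
Hypotheses (yX : second_sym V X) (yY : second_sym V Y) (yZ : second_sym V Z).
Hypothesis ell0 : forall t, V t -> ell t != 0.
Hypothesis theta : forall t v, V t ->
  dd Z t v - P t * dd X t v - Q t * dd Y t v = ell t * contact_form t v.

Let sdd (f : pt -> R) (v : pt) : smooth_on V f -> smooth_on V (fun t => dd f t v).
Proof. by move=> sf; apply: (dd_smooth oV sf) => i; exact: smooth_const. Qed.

(** The exterior derivative of dZ - P dX - Q dY = ell U. *)
Lemma theta_derivative t v w : V t ->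
  - wedge (dd P t) (dd X t) v w - wedge (dd Q t) (dd Y t) v w =
  wedge (dd ell t) (contact_form t) v w + ell t * Om v w.
Proof.
move=> Vt.
have key u u' : dd (fun x => dd Z x u') t u
   - (P t * dd (fun x => dd X x u') t u + dd P t u * dd X t u')
   - (Q t * dd (fun x => dd Y x u') t u + dd Q t u * dd Y t u') =
   ell t * (- (cp u * cx u') - cq u * cy u') + dd ell t u * contact_form t u'.
  have sX' := sdd u' sX; have sY' := sdd u' sY; have sZ' := sdd u' sZ.
  have sPX := smoothM oV sP sX'; have sQY := smoothM oV sQ sY'.
  have E1 := ddM u sP sX' Vt.
  have E2 := ddM u sQ sY' Vt.
  have E3 := ddB oV u sZ' sPX Vt.
  have E4 := ddB oV u (smoothB oV sZ' sPX) sQY Vt.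
  have E5 := dd_eq oV u (fun x Vx => theta u' Vx) Vt.
  have E6 := ddM u sell (smooth_contact u' oV) Vt.
  have L := etrans E4 (congr2 (fun a b : R => a - b)
    (etrans E3 (congr1 (fun a => dd (fun x => dd Z x u') t u - a) E1)) E2).
  have M := etrans E6 (congr1 (fun a => ell t * a + dd ell t u * contact_form t u')
    (dd_contact t u u')).
  exact: (etrans (esym L) (etrans E5 M)).
have sym f : smooth_on V f -> second_sym V f ->
    dd (fun x => dd f x w) t v = dd (fun x => dd f x v) t w.
  move=> sf yf; rewrite !(dd_dd _ _ sf Vt) exchange_big /=.
  apply: eq_bigr => i _; apply: eq_bigr => j _.
  by rewrite (yf _ _ _ Vt); ring.
have h1 := key v w; have := key w v.
rewrite -(sym _ sX yX) -(sym _ sY yY) -(sym _ sZ yZ) => h2.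
rewrite /wedge /Om; move: h1 h2.
generalize (dd (fun x => dd Z x w) t v) (dd (fun x => dd X x w) t v)
  (dd (fun x => dd Y x w) t v) (dd P t v) (dd P t w) (dd Q t v) (dd Q t w)
  (dd X t v) (dd X t w) (dd Y t v) (dd Y t w) (dd ell t v) (dd ell t w)
  (contact_form t v) (contact_form t w).
by move=> *; lra.
Qed.

Definition contact_map t : pt := mk5 (X t) (Y t) (Z t) (P t) (Q t).
Local Notation F := contact_map.

Let F_coord (i : 'I_5) : (fun y => F y 0 i) =
  nth (fun=> 0) [:: X; Y; Z; P; Q] i.
Proof.
by apply/funext => y; rewrite mxE; case: i => [[|[|[|[|[|//]]]]] i].
Qed.

Lemma contact_map_smooth : smooth_map_on V F.
Proof.
move=> i; rewrite F_coord; case: i => [[|[|[|[|[|m]]]]] i].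
- exact: sX.
- exact: sY.
- exact: sZ.
- exact: sP.
- exact: sQ.
- by exfalso.
Qed.

Lemma contact_map_diff t v : V t ->
  'd F t v = mk5 (dd X t v) (dd Y t v) (dd Z t v) (dd P t v) (dd Q t v).
Proof.
move=> Vt; apply/rowP => i; rewrite (dd_map oV _ _ contact_map_smooth Vt) [RHS]mxE.
by rewrite F_coord; case: i => [[|[|[|[|[|//]]]]] i].
Qed.

Lemma contact_map_contact t v : V t -> contact_form (F t) ('d F t v) = ell t * contact_form t v.
Proof. by move=> Vt; rewrite contact_map_diff // -theta // /contact_form !mk5E. Qed.

Lemma contact_map_Om t v w : V t -> Om ('d F t v) ('d F t w) =
  ell t * Om v w + wedge (dd ell t) (contact_form t) v w.
Proof.
move=> Vt; rewrite !contact_map_diff // [RHS]addrC -theta_derivative //.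
rewrite /Om !mk5E /wedge.
generalize (dd P t v) (dd P t w) (dd Q t v) (dd Q t w)
  (dd X t v) (dd X t w) (dd Y t v) (dd Y t w).
by move=> *; ring.
Qed.

(** A vector killed by dF is killed by U, since ell is nonzero; then it pairs to
   zero with the whole contact plane under the nondegenerate form dU. *)
Lemma contact_map_inj t h x f s : symplectic_frame t h x f s -> V t ->
  forall v, 'd F t v = 0 -> v = 0.
Proof.
move=> fr Vt v dv; have l0 := ell0 Vt.
have O0 w : Om 0 w = 0 by rewrite /Om /cx /cy /cp /cq !mxE; ring.
have U0 : contact_form t v = 0.
  apply: (mulfI l0); rewrite -contact_map_contact // dv mulr0.
  by rewrite /contact_form /cx /cy /cz !mxE; ring.
have Ov w : contact_form t w = 0 -> Om v w = 0.
  move=> cw; have := contact_map_Om v w Vt; rewrite dv O0 /wedge U0 cw !mulr0 subrr addr0.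
  by move/esym/eqP; rewrite mulf_eq0 (negPf l0) => /eqP.
have Oc (u w : pt) : Om u w = - Om w u by rewrite /Om; ring.
have [[c1 c2 c3 c4] _] := fr.
rewrite (symplectic_expand fr v) U0 (Oc h) (Oc x) !Ov //.
by rewrite !oppr0 !scale0r !addr0.
Qed.

End ContactMap.
End Geometry.

(** * Reduction to the normal form *)

Section NormalForm.
Context {R : realType}.
Local Notation pt := 'rV[R]_5.
Local Notation e i := (delta_mx 0 i : pt).

(** A decomposable form and om that have the same kernel {x, f} in the contact
   planes are proportional there; the remaining difference is divisible by U. *)
Lemma wedge_frame (E : ma_equation R) t h x f s (a1 a2 : pt -> R) :
  symplectic_frame t h x f s -> scalar a1 -> scalar a2 ->
  a1 h = 0 -> a1 x = 0 -> a1 f = 0 -> a2 x = 0 -> a2 f = 0 ->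
  [/\ ma_form E t x h = 0, ma_form E t x f = 0, ma_form E t x s = 0,
      ma_form E t f h = 0 & ma_form E t f s = 0] -> ma_form E t h s != 0 ->
  forall v w, wedge a1 a2 v w = - a1 s * a2 h / ma_form E t h s * ma_form E t v w
    + wedge (fun u => a1 u * a2 ez - a1 ez * a2 u) (contact_form t) v w.
Proof.
move=> fr l1 l2 a1h a1x a1f a2x a2f [xh xf xs fh fs] hs0 v w.
have D1 u u' : a1 (u + u') = a1 u + a1 u' by have := l1 1 u u'; rewrite scale1r mul1r.
have D2 u u' : a2 (u + u') = a2 u + a2 u' by have := l2 1 u u'; rewrite scale1r mul1r.
have Z1 c u : a1 (c *: u) = c * a1 u.
  have z : a1 0 = 0 by have := D1 0 0; rewrite addr0; lra.
  by have := l1 c u 0; rewrite z !addr0.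
have Z2 c u : a2 (c *: u) = c * a2 u.
  have z : a2 0 = 0 by have := D2 0 0; rewrite addr0; lra.
  by have := l2 c u 0; rewrite z !addr0.
have A1 u : a1 u = contact_form t u * a1 ez + Om x u * a1 s.
  rewrite {1}(symplectic_expand fr u) !D1 !Z1 a1h a1x a1f; ring.
have A2 u : a2 u = contact_form t u * a2 ez + Om u f * a2 h + Om x u * a2 s.
  rewrite {1}(symplectic_expand fr u) !D2 !Z2 a2x a2f; ring.
have mez z : ma_form E t z ez = 0 by rewrite ma_formC ma_form_ez oppr0.
have M u u' : ma_form E t u u' = (Om u f * Om x u' - Om x u * Om u' f) * ma_form E t h s.
  have m1 z : ma_form E t z u' = Om u' f * ma_form E t z h + Om u' s * ma_form E t z x
      + Om h u' * ma_form E t z f + Om x u' * ma_form E t z s.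
    by rewrite {1}(symplectic_expand fr u') !ma_formDr !ma_formZr mez; ring.
  rewrite {1}(symplectic_expand fr u) !ma_formDl !ma_formZl ma_form_ez !m1.
  rewrite !ma_form_self xh xf xs fh fs.
  rewrite (ma_formC _ _ h x) (ma_formC _ _ h f) (ma_formC _ _ f x) xh fh xf.
  rewrite (ma_formC _ _ s h) (ma_formC _ _ s x) (ma_formC _ _ s f) xs fs; ring.
rewrite /wedge /= (A1 v) (A1 w) (A2 v) (A2 w) (M v w).
move: hs0; generalize (ma_form E t h s) (contact_form t v) (contact_form t w) (a1 ez) (a2 ez)
 (Om x v) (Om x w) (Om v f) (Om w f) (a1 s) (a2 s) (a2 h).
by move=> *; field.
Qed.

End NormalForm.

Section Reduction.
Context {R : realType}.
Local Notation pt := 'rV[R]_5.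
Local Notation e i := (delta_mx 0 i : pt).

Lemma ma_form_smooth (E : ma_equation R) V (u v : pt -> pt) : open V ->
  smooth_on V (Defs.coefN E) -> smooth_on V (Defs.coefA E) -> smooth_on V (Defs.coefB E) ->
  smooth_on V (Defs.coefC E) -> smooth_on V (Defs.coefD E) ->
  smooth_map_on V u -> smooth_map_on V v -> smooth_on V (fun t => ma_form E t (u t) (v t)).
Proof.
move=> oV sN sA sB sC sD su sv.
have w i j : smooth_on V (fun t => wedge (fun y : pt => y 0 i) (fun y : pt => y 0 j) (u t) (v t)).
  exact: (smoothB oV (smoothM oV (su i) (sv j)) (smoothM oV (sv i) (su j))).
have sB2 := smoothM oV sB (smooth_const oV 2^-1).
exact: (smoothD oV (smoothB oV (smoothB oV (smoothD oV (smoothD oV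
  (smoothM oV sD (w _ _)) (smoothM oV sB2 (w _ _))) (smoothM oV sC (w _ _)))
  (smoothM oV sA (w _ _))) (smoothM oV sB2 (w _ _))) (smoothM oV sN (w _ _))).
Qed.

Section OnV.
Variables (E : ma_equation R) (V : set pt) (t0 : pt) (X Y Z P Q ell : pt -> R).
Variables (eta xi phi psi : pt -> pt).
Hypotheses (oV : open V) (Vt0 : V t0).
Hypotheses (sN : smooth_on V (Defs.coefN E)) (sA : smooth_on V (Defs.coefA E))
  (sB : smooth_on V (Defs.coefB E)) (sC : smooth_on V (Defs.coefC E))
  (sD : smooth_on V (Defs.coefD E)).
Hypotheses (sX : smooth_on V X) (sY : smooth_on V Y) (sZ : smooth_on V Z)
  (sP : smooth_on V P) (sQ : smooth_on V Q) (sell : smooth_on V ell).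
Hypotheses (seta : smooth_map_on V eta) (sphi : smooth_map_on V phi) (spsi : smooth_map_on V psi).
Hypotheses (yX : second_sym V X) (yY : second_sym V Y) (yZ : second_sym V Z).
Hypothesis ell0 : forall t, V t -> ell t != 0.
Hypothesis theta : forall t v, V t ->
  dd Z t v - P t * dd X t v - Q t * dd Y t v = ell t * contact_form t v.
Hypothesis frame : forall t, V t -> symplectic_frame t (eta t) (xi t) (phi t) (psi t).
Hypothesis Xxi : forall t, V t -> dd X t (xi t) = 0 /\ dd Y t (xi t) = 0.
Hypothesis Xeta : forall t, V t -> dd X t (eta t) = 0 /\ dd Y t (eta t) = 0.
Hypothesis om0 : forall t, V t ->
  [/\ ma_form E t (xi t) (eta t) = 0, ma_form E t (xi t) (phi t) = 0,
      ma_form E t (xi t) (psi t) = 0, ma_form E t (phi t) (eta t) = 0 &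
      ma_form E t (phi t) (psi t) = 0].
Hypothesis omC : forall t, V t -> ma_form E t (eta t) (psi t) != 0.
Hypothesis fY0 : forall t, V t -> dd Y t (phi t) != 0.
Hypothesis Delta0 : forall t, V t ->
  dd X t (phi t) * dd Y t (psi t) - dd Y t (phi t) * dd X t (psi t) != 0.

Local Notation F := (contact_map X Y Z P Q).

Let slope t := - (dd X t (phi t) / dd Y t (phi t)).
Let drift t := (dd Q t (phi t) - slope t * dd P t (phi t)) / dd Y t (phi t).
Let al1 t v := dd X t v + slope t * dd Y t v.
Let al2 t v := dd Q t v - slope t * dd P t v - drift t * dd Y t v.

Let sslope : smooth_on V slope.
Proof.
exact: (smoothN oV (smoothM oV (dd_smooth oV sX sphi) (smoothV oV fY0 (dd_smooth oV sY sphi)))).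
Qed.
Let sdrift : smooth_on V drift.
Proof.
exact: (smoothM oV (smoothB oV (dd_smooth oV sQ sphi) (smoothM oV sslope (dd_smooth oV sP sphi)))
  (smoothV oV fY0 (dd_smooth oV sY sphi))).
Qed.
Let sal1 u : smooth_map_on V u -> smooth_on V (fun t => al1 t (u t)).
Proof.
move=> su.
exact: (smoothD oV (dd_smooth oV sX su) (smoothM oV sslope (dd_smooth oV sY su))).
Qed.
Let sal2 u : smooth_map_on V u -> smooth_on V (fun t => al2 t (u t)).
Proof.
move=> su.
exact: (smoothB oV (smoothB oV (dd_smooth oV sQ su) (smoothM oV sslope (dd_smooth oV sP su)))
  (smoothM oV sdrift (dd_smooth oV sY su))).
Qed.

Let al1_scalar t : scalar (al1 t).
Proof.
move=> a u v; rewrite /al1 (dd_scalar X t) (dd_scalar Y t).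
generalize (dd X t u) (dd X t v) (dd Y t u) (dd Y t v) (slope t); move=> *; ring.
Qed.
Let al2_scalar t : scalar (al2 t).
Proof.
move=> a u v; rewrite /al2 (dd_scalar Q t) (dd_scalar P t) (dd_scalar Y t).
generalize (dd Q t u) (dd Q t v) (dd P t u) (dd P t v) (dd Y t u) (dd Y t v)
  (slope t) (drift t); move=> *; ring.
Qed.

Let al_frame t : V t -> [/\ al1 t (eta t) = 0, al1 t (xi t) = 0 & al1 t (phi t) = 0] /\
  [/\ al2 t (xi t) = 0, al2 t (phi t) = 0, al1 t (psi t) != 0 & al2 t (eta t) != 0].
Proof.
move=> Vt; rewrite /al1 /al2.
have [x1 x2] := Xxi Vt; have [h1 h2] := Xeta Vt.
have [[ch cx' cf cs] [hf xs hx hs [xf fs]]] := frame Vt.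
(* Only the pairs (xi, phi) and (eta, phi) are needed. *)
have T u := theta_derivative oV sX sY sZ sP sQ sell yX yY yZ theta u (phi t) Vt.
have Tx := T (xi t); have Th := T (eta t).
have := Delta0 Vt; move: (ell0 Vt) (fY0 Vt) Tx Th; rewrite /wedge x1 x2 h1 h2 cx' ch cf hf xf /drift /slope.
generalize (dd X t (phi t)) (dd Y t (phi t)) (dd P t (xi t)) (dd Q t (xi t))
  (dd P t (eta t)) (dd Q t (eta t)) (dd P t (phi t)) (dd Q t (phi t)) (dd X t (psi t))
  (dd Y t (psi t)) (ell t) (dd ell t (xi t)) (dd ell t (eta t)) (dd ell t (phi t)).
move=> fX fY Px Qx Pe Qe Pf Qf pX pY l lx le lf l0 g0 Tx Th d0.
have Qxe : Qx = - (fX / fY) * Px.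
  by apply: (mulIf g0); rewrite mulrAC mulNr divfK //; lra.
have Qee : Qe = - (fX / fY) * Pe - l / fY.
  by apply: (mulIf g0); rewrite mulrBl divfK // mulrAC mulNr divfK //; lra.
split; split.
- ring.
- ring.
- by field.
- by rewrite Qxe; ring.
- by field.
- have -> : pX + - (fX / fY) * pY = - (fX * pY - fY * pX) / fY by field.
  by rewrite mulf_neq0 ?invr_neq0 ?oppr_eq0.
- have -> : Qe - - (fX / fY) * Pe - (Qf - - (fX / fY) * Pf) / fY * 0 = - (l / fY).
    by rewrite Qee; ring.
  by rewrite oppr_eq0 mulf_neq0 ?invr_neq0.
Qed.

(** In the target the form of the equation is (dx + a dy) /\ (dq - a dp - b dy).
   The pullback by F of the first factor is al1 and that of the second is al2,
   with a = slope and b = drift transported by the inverse of F. *)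
Lemma reduction : exists (V' W : set pt) (a b : pt -> R),
  [/\ V' t0, V' `<=` V, smooth_on W a, smooth_on W b & reduces_on V' W F E (normal_form a b)].
Proof.
have sF := contact_map_smooth sX sY sZ sP sQ.
have injF t (Vt : V t) := contact_map_inj oV sX sY sZ sP sQ sell yX yY yZ ell0 theta (frame Vt) Vt.
have [V' [W [V't0 V'V dF]]] := inverse_function oV sF Vt0 injF.
have [oV' oW sF' VW [G [sG WV GF FG]]] := dF.
have s' (f : pt -> R) : smooth_on V f -> smooth_on V' f by exact: smooth_sub.
have sc (v : pt) : smooth_map_on V (fun=> v) by move=> i; exact: smooth_const.
exists V', W, (fun y => slope (G y)), (fun y => drift (G y)); split=> //.
- exact: (smooth_comp oW oV' (s' _ sslope) sG WV).
- exact: (smooth_comp oW oV' (s' _ sdrift) sG WV).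
have FU t v (Vt : V' t) := contact_map_contact oV sX sY sZ sP sQ theta v (V'V _ Vt).
have FdU t v w (Vt : V' t) :=
  contact_map_Om oV sX sY sZ sP sQ sell yX yY yZ theta v w (V'V _ Vt).
split; first split=> // t Vt v.
  rewrite (FU t v Vt); split=> [->|/eqP]; first by rewrite mulr0.
  by rewrite mulf_eq0 (negPf (ell0 (V'V _ Vt))) => /eqP.
pose sig t := - al1 t (psi t) * al2 t (eta t) / ma_form E t (eta t) (psi t).
pose zeta t u := al1 t u * al2 t ez - al1 t ez * al2 t u.
have sig0 t : V' t -> sig t != 0.
  move=> /V'V Vt; have [_ [_ _ a0 b0]] := al_frame Vt.
  by rewrite /sig !mulf_neq0 ?oppr_eq0 ?invr_neq0 ?omC.
have ssig : smooth_on V sig.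
  exact: (smoothM oV (smoothM oV (smoothN oV (sal1 spsi)) (sal2 seta))
    (smoothV oV omC (ma_form_smooth oV sN sA sB sC sD seta spsi))).
have szeta : smooth_form1 V' zeta.
  split=> [t _ c u v|v].
    rewrite /zeta (al1_scalar t) (al2_scalar t).
    generalize (al1 t u) (al1 t v) (al2 t u) (al2 t v) (al1 t ez) (al2 t ez).
    by move=> *; ring.
  exact/s'/(smoothB oV (smoothM oV (sal1 (sc v)) (sal2 (sc ez)))
    (smoothM oV (sal1 (sc ez)) (sal2 (sc v)))).
apply: (carries_edsP oV' oW sF' sG VW WV FG (s' _ sell) (fun t Vt => ell0 (V'V _ Vt))
  (s' _ ssig) sig0 szeta FU FdU) => t v w Vt.
have [[a1 a2 a3] [b1 b2 _ _]] := al_frame (V'V _ Vt).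
rewrite -(wedge_frame (frame (V'V _ Vt)) (al1_scalar t) (al2_scalar t) a1 a2 a3 b1 b2
  (om0 (V'V _ Vt)) (omC (V'V _ Vt)) v w).
have dF5 u := contact_map_diff oV sX sY sZ sP sQ u (V'V _ Vt).
rewrite (dF5 v) (dF5 w) /ma_form /normal_form /= (GF _ Vt) /wedge !mk5E /al1 /al2.
generalize (dd X t v) (dd X t w) (dd Y t v) (dd Y t w) (dd Z t v) (dd Z t w)
  (dd P t v) (dd P t w) (dd Q t v) (dd Q t w) (slope t) (drift t).
by move=> *; field.
Qed.

End OnV.
End Reduction.

(** * The complete integral *)

Section CompleteIntegral.
Context {R : realType}.
Local Notation pt := 'rV[R]_5.
Variables (E : ma_equation R) (V : set pt) (X Y Z P Q ell : pt -> R).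
Variables (eta xi phi psi : pt -> pt).
Hypotheses (oV : open V).
Hypotheses (sX : smooth_on V X) (sY : smooth_on V Y) (sZ : smooth_on V Z)
  (sP : smooth_on V P) (sQ : smooth_on V Q) (sell : smooth_on V ell).
Hypotheses (yX : second_sym V X) (yY : second_sym V Y) (yZ : second_sym V Z).
Hypothesis ell0 : forall t, V t -> ell t != 0.
Hypothesis theta : forall t v, V t ->
  dd Z t v - P t * dd X t v - Q t * dd Y t v = ell t * contact_form t v.
Hypothesis frame : forall t, V t -> symplectic_frame t (eta t) (xi t) (phi t) (psi t).
Hypothesis Xxi : forall t, V t -> dd X t (xi t) = 0 /\ dd Y t (xi t) = 0.
Hypothesis Xeta : forall t, V t -> dd X t (eta t) = 0 /\ dd Y t (eta t) = 0.
Hypothesis om0 : forall t, V t -> ma_form E t (xi t) (eta t) = 0.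
Hypothesis Delta0 : forall t, V t ->
  dd X t (phi t) * dd Y t (psi t) - dd Y t (phi t) * dd X t (psi t) != 0.

(** The planes spanned by xi and eta are the common kernels of dX, dY, dZ: a vector
   killed by these is killed by U, and its components along phi and psi solve
   a linear system with determinant Delta. *)
Lemma leaf_tangentP t v : V t ->
  (exists c d, v = c *: xi t + d *: eta t) <->
  [/\ dd X t v = 0, dd Y t v = 0 & dd Z t v = 0].
Proof.
move=> Vt; have fr := frame Vt.
have [[ch cx' cf cs] [hf xs hx hs [xf fs]]] := fr.
have [x1 x2] := Xxi Vt; have [h1 h2] := Xeta Vt.
have Z0 u : contact_form t u = 0 -> dd X t u = 0 -> dd Y t u = 0 -> dd Z t u = 0.
  by move=> u0 uX uY; have := theta u Vt; rewrite u0 uX uY !mulr0 !subr0.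
split=> [[c [d ->]]|[dX dY dZ]].
  rewrite !ddDr !ddZr x1 x2 h1 h2 (Z0 _ cx' x1 x2) (Z0 _ ch h1 h2) !mulr0 addr0.
  by split.
have U0 : contact_form t v = 0.
  have := theta v Vt; rewrite dX dY dZ !mulr0 !subr0 => /esym/eqP.
  by rewrite mulf_eq0 (negPf (ell0 Vt)) => /eqP.
have ev := symplectic_expand fr v; rewrite U0 scale0r add0r in ev.
have d0 := Delta0 Vt.
have {dX}dX : Om (eta t) v * dd X t (phi t) + Om (xi t) v * dd X t (psi t) = 0.
  by move: dX; rewrite {1}ev !ddDr !ddZr x1 h1 !mulr0 !add0r.
have {dY}dY : Om (eta t) v * dd Y t (phi t) + Om (xi t) v * dd Y t (psi t) = 0.
  by move: dY; rewrite {1}ev !ddDr !ddZr x2 h2 !mulr0 !add0r.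
have hv : Om (eta t) v = 0.
  apply: (mulIf d0); rewrite mul0r; move: dX dY.
  generalize (dd X t (phi t)) (dd X t (psi t)) (dd Y t (phi t)) (dd Y t (psi t))
    (Om (eta t) v) (Om (xi t) v) => fX pX fY pY a b h k.
  have -> : a * (fX * pY - fY * pX) = (a * fX + b * pX) * pY - (a * fY + b * pY) * pX by ring.
  by rewrite h k !mul0r subrr.
have xv : Om (xi t) v = 0.
  apply: (mulIf d0); rewrite mul0r; move: dX dY.
  generalize (dd X t (phi t)) (dd X t (psi t)) (dd Y t (phi t)) (dd Y t (psi t))
    (Om (eta t) v) (Om (xi t) v) => fX pX fY pY a b h k.
  have -> : b * (fX * pY - fY * pX) = (a * fY + b * pY) * fX - (a * fX + b * pX) * fY by ring.
  by rewrite h k !mul0r subrr.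
exists (Om v (psi t)), (Om v (phi t)).
by rewrite {1}ev hv xv !scale0r !addr0 addrC.
Qed.

(** (P, Q, X, Y, Z) are flat coordinates of the distribution. *)
Lemma leaf_complete_integral : complete_integral V E (fun t => (<[xi t]> + <[eta t]>)%VS).
Proof.
split.
- move=> t Vt; have [_ [hf xs hx hs [xf fs]]] := frame Vt; apply: dim_span2 => c d cd0.
  have O (w : pt) : c * Om (xi t) w + d * Om (eta t) w = 0.
    transitivity (Om (c *: xi t + d *: eta t) w).
      by rewrite /Om !coordD !coordZ; ring.
    by rewrite cd0 /Om /cx /cy /cp /cq !mxE; ring.
  split; first by have := O (psi t); rewrite xs hs mulr1 mulr0 addr0.
  by have := O (phi t); rewrite hf xf mulr1 mulr0 add0r.
- move=> x0 Vx0.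
  have su := contact_map_smooth sP sQ sX sY sZ.
  have du t v (Vt : V t) := contact_map_diff oV sP sQ sX sY sZ v Vt.
  have dF t v (Vt : V t) := contact_map_diff oV sX sY sZ sP sQ v Vt.
  have inj t : V t -> forall v, 'd (contact_map P Q X Y Z) t v = 0 -> v = 0.
    move=> Vt v; rewrite (du _ _ Vt) => k.
    apply: (contact_map_inj oV sX sY sZ sP sQ sell yX yY yZ ell0 theta (frame Vt) Vt).
    rewrite (dF _ _ Vt); move: k.
    generalize (dd X t v) (dd Y t v) (dd Z t v) (dd P t v) (dd Q t v) => a b c p q k.
    have [h0 h1 h2 h3 h4] : [/\ p = 0, q = 0, a = 0, b = 0 & c = 0].
      have z (f : pt -> R) : f 0 = f (mk5 p q a b c) by rewrite k.
      have := z cx; have := z cy; have := z cz; have := z cp; have := z cq.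
      by rewrite !mk5E /cx /cy /cz /cp /cq !mxE.
    by rewrite h0 h1 h2 h3 h4; apply: row5P; rewrite mk5E /cx /cy /cz /cp /cq !mxE.
  have [V' [W [V'x0 V'V dfu]]] := inverse_function oV su Vx0 inj.
  exists V', W, (contact_map P Q X Y Z); split=> // t V't v; have Vt := V'V _ V't.
  rewrite (du _ _ Vt); apply: (iff_trans (iff_sym (rwP (span2P _ _ _)))).
  apply: (iff_trans (leaf_tangentP v Vt)).
  generalize (dd X t v) (dd Y t v) (dd Z t v) (dd P t v) (dd Q t v) => a b c p q.
  split=> [[-> -> ->] i|k].
    by rewrite mxE; case: i => [[|[|[|[|[|//]]]]] i].
  have := k (@Ordinal 5 2 isT) isT; have := k (@Ordinal 5 3 isT) isT.
  by have := k (@Ordinal 5 4 isT) isT; rewrite !mxE.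
- move=> t Vt v /span2P[c [d ->]]; have [[ch cx' _ _] _] := frame Vt.
  by rewrite contact_scalar -[d *: _]addr0 contact_scalar ch cx' /contact_form /cx /cy /cz !mxE; ring.
- move=> t Vt v w /span2P[c [d ->]] /span2P[c' [d' ->]].
  rewrite !ma_formDl !ma_formZl !ma_formDr !ma_formZr !ma_form_self (ma_formC _ _ (eta t)) om0 //.
  by ring.
Qed.

End CompleteIntegral.

(** * Both conclusions from three first integrals *)

Section FromIntegrals.
Context {R : realType}.
Local Notation pt := 'rV[R]_5.
Variables (E : ma_equation R) (V0 : set pt) (t0 : pt) (X Y Z : pt -> R).
Variables (eta xi phi psi : pt -> pt).
Hypotheses (oV0 : open V0) (V0t0 : V0 t0).
Hypotheses (sN : smooth_on V0 (Defs.coefN E)) (sA : smooth_on V0 (Defs.coefA E))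
  (sB : smooth_on V0 (Defs.coefB E)) (sC : smooth_on V0 (Defs.coefC E))
  (sD : smooth_on V0 (Defs.coefD E)).
Hypotheses (sX : smooth_on V0 X) (sY : smooth_on V0 Y) (sZ : smooth_on V0 Z).
Hypotheses (seta : smooth_map_on V0 eta) (sphi : smooth_map_on V0 phi)
  (spsi : smooth_map_on V0 psi).
Hypotheses (yX : second_sym V0 X) (yY : second_sym V0 Y) (yZ : second_sym V0 Z).
Hypothesis frame : forall t, V0 t -> symplectic_frame t (eta t) (xi t) (phi t) (psi t).
Hypothesis Xxi : forall t, V0 t -> [/\ dd X t (xi t) = 0, dd Y t (xi t) = 0 & dd Z t (xi t) = 0].
Hypothesis Xeta : forall t, V0 t ->
  [/\ dd X t (eta t) = 0, dd Y t (eta t) = 0 & dd Z t (eta t) = 0].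
Hypothesis om0 : forall t, V0 t ->
  [/\ ma_form E t (xi t) (eta t) = 0, ma_form E t (xi t) (phi t) = 0,
      ma_form E t (xi t) (psi t) = 0, ma_form E t (phi t) (eta t) = 0 &
      ma_form E t (phi t) (psi t) = 0].
Hypothesis omC : forall t, V0 t -> ma_form E t (eta t) (psi t) != 0.
Hypothesis fY0 : dd Y t0 (phi t0) != 0.
Hypothesis Delta0 :
  dd X t0 (phi t0) * dd Y t0 (psi t0) - dd Y t0 (phi t0) * dd X t0 (psi t0) != 0.
Hypothesis ez0 : [/\ dd X t0 ez = 0, dd Y t0 ez = 0 & dd Z t0 ez != 0].

(** P and Q solve the two linear equations that make dZ - P dX - Q dY vanish on phi
   and psi; it vanishes on xi and eta anyway, so it is a multiple of U. *)
Lemma integrals_reduce :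
  (exists (V : set pt) (Dh : pt -> {vspace pt}),
     [/\ open V, V t0, V `<=` V0 & complete_integral V E Dh]) /\
  (exists (V W : set pt) (F : pt -> pt) (a b : pt -> R),
     [/\ V t0, V `<=` V0, smooth_on W a, smooth_on W b & reduces_on V W F E (normal_form a b)]).
Proof.
have sfX := dd_smooth oV0 sX sphi; have spX := dd_smooth oV0 sX spsi.
have sfY := dd_smooth oV0 sY sphi; have spY := dd_smooth oV0 sY spsi.
have sfZ := dd_smooth oV0 sZ sphi; have spZ := dd_smooth oV0 sZ spsi.
pose Delta t := dd X t (phi t) * dd Y t (psi t) - dd Y t (phi t) * dd X t (psi t).
have sDelta : smooth_on V0 Delta.
  exact: (smoothB oV0 (smoothM oV0 sfX spY) (smoothM oV0 sfY spX)).
pose g t := Delta t * dd Y t (phi t).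
have sg : smooth_on V0 g by exact: (smoothM oV0 sDelta sfY).
pose V1 := V0 `&` [set t | g t != 0].
have oV1 : open V1 := open_neq0 oV0 sg.
have V10 : V1 `<=` V0 by move=> t [].
have D1 t : V1 t -> Delta t != 0.
  by move=> [_] /=; rewrite /g mulf_eq0 negb_or => /andP[].
have fY1 t : V1 t -> dd Y t (phi t) != 0.
  by move=> [_] /=; rewrite /g mulf_eq0 negb_or => /andP[].
have s10 (f : pt -> R) : smooth_on V0 f -> smooth_on V1 f by exact: smooth_sub.
pose P t := (dd Z t (phi t) * dd Y t (psi t) - dd Y t (phi t) * dd Z t (psi t)) / Delta t.
pose Q t := (dd X t (phi t) * dd Z t (psi t) - dd Z t (phi t) * dd X t (psi t)) / Delta t.
have sP : smooth_on V1 P.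
  exact: (smoothM oV1 (s10 _ (smoothB oV0 (smoothM oV0 sfZ spY) (smoothM oV0 sfY spZ)))
    (smoothV oV1 D1 (s10 _ sDelta))).
have sQ : smooth_on V1 Q.
  exact: (smoothM oV1 (s10 _ (smoothB oV0 (smoothM oV0 sfX spZ) (smoothM oV0 sfZ spX)))
    (smoothV oV1 D1 (s10 _ sDelta))).
pose ell t := dd Z t ez - P t * dd X t ez - Q t * dd Y t ez.
have sez : smooth_map_on V0 (fun=> ez : pt) by move=> i; exact: (smooth_const oV0).
have sell : smooth_on V1 ell.
  exact: (smoothB oV1 (smoothB oV1 (s10 _ (dd_smooth oV0 sZ sez))
    (smoothM oV1 sP (s10 _ (dd_smooth oV0 sX sez))))
    (smoothM oV1 sQ (s10 _ (dd_smooth oV0 sY sez)))).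
have theta t v : V1 t ->
    dd Z t v - P t * dd X t v - Q t * dd Y t v = ell t * contact_form t v.
  move=> Vt; have := D1 _ Vt; rewrite /ell /P /Q /Delta.
  rewrite {1 2 3}(symplectic_expand (frame (V10 _ Vt)) v) !ddDr !ddZr.
  have [-> -> ->] := Xxi (V10 _ Vt); have [-> -> ->] := Xeta (V10 _ Vt).
  generalize (dd X t (phi t)) (dd Y t (phi t)) (dd Z t (phi t)) (dd X t (psi t))
    (dd Y t (psi t)) (dd Z t (psi t)) (dd X t ez) (dd Y t ez) (dd Z t ez)
    (contact_form t v) (Om v (phi t)) (Om v (psi t)) (Om (eta t) v) (Om (xi t) v).
  by move=> *; field.
pose V := V1 `&` [set t | ell t != 0].
have oV : open V := open_neq0 oV1 sell.
have VV1 : V `<=` V1 by move=> t [].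
have VV0 : V `<=` V0 by move=> t /VV1/V10.
have Vt0 : V t0.
  have [a b c] := ez0; split; first by split=> //=; rewrite /g mulf_neq0.
  by rewrite /= /ell a b !mulr0 !subr0.
have s1 (f : pt -> R) : smooth_on V1 f -> smooth_on V f by exact: smooth_sub.
have s0 (f : pt -> R) : smooth_on V0 f -> smooth_on V f by exact: smooth_sub.
have sm (f : pt -> pt) : smooth_map_on V0 f -> smooth_map_on V f by move=> sf i; exact/s0/sf.
have y0 f : second_sym V0 f -> second_sym V f by move=> yf t i j /VV0; exact: yf.
have ell0 t : V t -> ell t != 0 by case.
have theta' t v : V t -> _ := fun Vt => theta t v (VV1 _ Vt).
have frame' t : V t -> _ := fun Vt => frame (VV0 _ Vt).
have om0' t : V t -> _ := fun Vt => om0 (VV0 _ Vt).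
have omC' t : V t -> _ := fun Vt => omC (VV0 _ Vt).
have D' t : V t -> Delta t != 0 := fun Vt => D1 _ (VV1 _ Vt).
have f' t : V t -> _ := fun Vt => fY1 _ (VV1 _ Vt).
have Xxi' t : V t -> dd X t (xi t) = 0 /\ dd Y t (xi t) = 0 by move=> /VV0/Xxi[].
have Xeta' t : V t -> dd X t (eta t) = 0 /\ dd Y t (eta t) = 0 by move=> /VV0/Xeta[].
split.
  exists V, (fun t => (<[xi t]> + <[eta t]>)%VS); split=> //.
  apply: (leaf_complete_integral oV (s0 _ sX) (s0 _ sY) (s0 _ sZ) (s1 _ sP) (s1 _ sQ)
    (s1 _ sell) (y0 _ yX) (y0 _ yY) (y0 _ yZ) ell0 theta' frame' Xxi' Xeta' _ D').
  by move=> t Vt; have [] := om0' _ Vt.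
have [V' [W [a [b [V't0 V'V sa sb red]]]]] := reduction oV Vt0 (s0 _ sN) (s0 _ sA) (s0 _ sB)
  (s0 _ sC) (s0 _ sD) (s0 _ sX) (s0 _ sY) (s0 _ sZ) (s1 _ sP) (s1 _ sQ) (s1 _ sell)
  (sm _ seta) (sm _ sphi) (sm _ spsi) (y0 _ yX) (y0 _ yY) (y0 _ yZ) ell0 theta' frame' Xxi' Xeta'
  om0' omC' f' D'.
by exists V', W, (contact_map X Y Z P Q), a, b; split=> // t /V'V/VV0.
Qed.

End FromIntegrals.

(** * Contact vector fields with constant symplectic components *)

Section FrameJets.
Context {R : realType}.
Local Notation pt := 'rV[R]_5.
Local Notation jet := (jet R 4).
Local Notation e i := (delta_mx 0 i : pt).
Local Notation ix := (@Ordinal 5 0 isT).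
Local Notation iy := (@Ordinal 5 1 isT).
Local Notation iz := (@Ordinal 5 2 isT).
Local Notation ip := (@Ordinal 5 3 isT).
Local Notation iq := (@Ordinal 5 4 isT).
Local Notation c := (@jconst R 4).

Lemma sum5 (A : nmodType) (f : 'I_5 -> A) :
  \sum_i f i = f ix + f iy + f iz + f ip + f iq.
Proof.
rewrite !big_ord_recl big_ord0 addr0 !addrA.
by do !congr (_ + _); congr f; exact: val_inj.
Qed.

Lemma jconst_is_monoid : monoid_morphism c.
Proof.
split=> // a b; apply: jetP; case=> [|j w]; first by rewrite jcoefM_nil.
by rewrite jcoefM_cons !jderiv_const mul0r mulr0 jcoef0 addr0.
Qed.
Lemma jconst_is_zmod : zmod_morphism c.
Proof. by move=> a b; apply: jetP; case=> [//|j w] /=; rewrite subr0. Qed.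
HB.instance Definition _ := GRing.isZmodMorphism.Build R jet c jconst_is_zmod.
HB.instance Definition _ := GRing.isMonoidMorphism.Build R jet c jconst_is_monoid.

Variable t0 : pt.

Definition jp : jet := c (cp t0) + jcoord ip.
Definition jq : jet := c (cq t0) + jcoord iq.

(** The lift to the contact planes, at the varying point, of a vector with constant
   components in the directions x, y, p, q. Its z component is p dx + q dy. *)
Definition jlift (v : pt) (j : 'I_5) : jet :=
  if j == iz then c (cx v) * jp + c (cy v) * jq else c (v 0 j).

Lemma lie_jlift v X : lie (jlift v) X = c (cx v) * jderiv ix X + c (cy v) * jderiv iy X +
  (c (cx v) * jp + c (cy v) * jq) * jderiv iz X + c (cp v) * jderiv ip X + c (cq v) * jderiv iq X.
Proof.
by rewrite /lie sum5 /jlift /cx /cy /cp /cq.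
Qed.

(** Two such fields commute up to the Reeb field, with factor given by dU. *)
Lemma lie_jlift_comm v w X : lie (jlift v) (lie (jlift w) X) =
  lie (jlift w) (lie (jlift v) X) - c (Om v w) * jderiv iz X.
Proof.
have cO : c (Om v w) = c (cx v) * c (cp w) - c (cp v) * c (cx w) +
    (c (cy v) * c (cq w) - c (cq v) * c (cy w)).
  by rewrite /Om rmorphD !rmorphB !rmorphM.
rewrite cO !lie_jlift !raddfD /= !jderiv_mul !raddfD /= !jderiv_mul !jderiv_const.
rewrite /jp /jq !raddfD /= !jderiv_const !jderiv_coord /=.
rewrite !rmorph0 !rmorph1.
rewrite (jderivC iy ix) (jderivC iz ix) (jderivC ip ix) (jderivC iq ix).
rewrite (jderivC iz iy) (jderivC ip iy) (jderivC iq iy).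
rewrite (jderivC ip iz) (jderivC iq iz) (jderivC iq ip).
generalize (jderiv ix (jderiv ix X)) (jderiv ix (jderiv iy X)) (jderiv ix (jderiv iz X))
 (jderiv ix (jderiv ip X)) (jderiv ix (jderiv iq X)) (jderiv iy (jderiv iy X))
 (jderiv iy (jderiv iz X)) (jderiv iy (jderiv ip X)) (jderiv iy (jderiv iq X))
 (jderiv iz (jderiv iz X)) (jderiv iz (jderiv ip X)) (jderiv iz (jderiv iq X))
 (jderiv ip (jderiv ip X)) (jderiv ip (jderiv iq X)) (jderiv iq (jderiv iq X))
 (jderiv ix X) (jderiv iy X) (jderiv iz X) (jderiv ip X) (jderiv iq X)
 (c (cx v)) (c (cy v)) (c (cp v)) (c (cq v)) (c (cx w)) (c (cy w)) (c (cp w)) (c (cq w))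
 (c (cp t0) + jcoord ip) (c (cq t0) + jcoord iq).
by move=> *; ring.
Qed.

End FrameJets.

Section Basis.
Context {R : realType}.
Local Notation pt := 'rV[R]_5.
Local Notation jet := (jet R 4).
Local Notation e i := (delta_mx 0 i : pt).
Local Notation ix := (@Ordinal 5 0 isT).
Local Notation iy := (@Ordinal 5 1 isT).
Local Notation iz := (@Ordinal 5 2 isT).
Local Notation ip := (@Ordinal 5 3 isT).
Local Notation iq := (@Ordinal 5 4 isT).
Local Notation c := (@jconst R 4).

(** A symplectic basis of the x, y, p, q space with e2 the unit vector of the
   coordinate tau and the other vectors tangent to {tau = const}. The two last
   conditions make the initial value of Z in [leaf_jets] constant along e1 and
   independent of tau. *)
Record adapted_basis (tau : 'I_5) (e1 e2 f1 f2 : pt) : Prop := AdaptedBasis {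
  ab_tau : tau != iz;
  ab_e2 : e2 = e tau;
  ab_e1f1 : Om e1 f1 = 1;
  ab_e2f2 : Om e2 f2 = 1;
  ab_e1e2 : Om e1 e2 = 0;
  ab_e1f2 : Om e1 f2 = 0;
  ab_e2f1 : Om e2 f1 = 0;
  ab_f1f2 : Om f1 f2 = 0;
  ab_ntau : [/\ e1 0 tau = 0, f1 0 tau = 0 & f2 0 tau = 0];
  ab_pure : cx e1 * cp e1 + cy e1 * cq e1 = 0;
  ab_pure2 : cx e1 * cp e2 + cy e1 * cq e2 = 0 }.

Lemma OmC (v w : pt) : Om v w = - Om w v. Proof. by rewrite /Om; ring. Qed.
Lemma Om_self (v : pt) : Om v v = 0. Proof. by rewrite /Om; ring. Qed.
Lemma OmDl (u v w : pt) : Om (u + v) w = Om u w + Om v w.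
Proof. by rewrite /Om !coordD; ring. Qed.
Lemma OmZl a (u w : pt) : Om (a *: u) w = a * Om u w.
Proof. by rewrite /Om !coordZ; ring. Qed.
Lemma OmDr (u v w : pt) : Om w (u + v) = Om w u + Om w v.
Proof. by rewrite /Om !coordD; ring. Qed.
Lemma OmZr a (u w : pt) : Om w (a *: u) = a * Om w u.
Proof. by rewrite /Om !coordZ; ring. Qed.

(** The linear function Om v, a Hamiltonian for v: constant vectors act on it by
   their pairing with v. *)
Definition jpair (v : pt) : jet :=
  c (cx v) * jcoord ip - c (cp v) * jcoord ix + (c (cy v) * jcoord iq - c (cq v) * jcoord iy).

Lemma jderiv_jpair j v : jderiv j (jpair v) = c (Om v (e j)).
Proof.
rewrite /jpair raddfD !raddfB /= !jderiv_mul !jderiv_const !jderiv_coord !mul0r !add0r.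
by rewrite -!rmorphM -!rmorphB -rmorphD /Om /cx /cy /cp /cq !mxE /= !(eq_sym j).
Qed.

Lemma Om_delta (v : pt) : [/\ Om v (e ix) = - cp v, Om v (e iy) = - cq v, Om v (e iz) = 0,
  Om v (e ip) = cx v & Om v (e iq) = cy v].
Proof. by rewrite /Om /cx /cy /cp /cq !mxE /=; split; ring. Qed.

Variable t0 : pt.
Local Notation L := (jlift t0).

Lemma lie_jpair v w : lie (L w) (jpair v) = c (Om v w).
Proof.
have cO : c (Om v w) = c (cx v) * c (cp w) - c (cp v) * c (cx w) +
    (c (cy v) * c (cq w) - c (cq v) * c (cy w)).
  by rewrite /Om rmorphD !rmorphB !rmorphM.
have [h1 h2 h3 h4 h5] := Om_delta v.
by rewrite cO lie_jlift !jderiv_jpair h1 h2 h3 h4 h5 !rmorphN rmorph0; ring.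
Qed.

Definition jslope (v : pt) : jet := c (cx v) * jp t0 + c (cy v) * jq t0.

Lemma jderiv_jslope j v : jderiv j (jslope v) = c (cx v * cp (e j) + cy v * cq (e j)).
Proof.
rewrite /jslope /jp /jq !raddfD /= !jderiv_mul !raddfD /= !jderiv_const !jderiv_coord.
rewrite !mul0r !add0r.
by rewrite -!rmorphM /cp /cq !mxE /= !(eq_sym j).
Qed.

Lemma lie_jslope v w : lie (L w) (jslope v) = c (cx v * cp w + cy v * cq w).
Proof.
rewrite lie_jlift !jderiv_jslope /cp /cq /cx /cy !mxE /=.
by rewrite !(mulr0, mulr1, addr0, add0r, rmorph0, rmorphD, rmorphM) /=; ring.
Qed.

Variables (tau : 'I_5) (e1 e2 f1 f2 : pt) (N b D : jet).
Hypothesis basis : adapted_basis tau e1 e2 f1 f2.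
Hypotheses (cN : convergent N) (cb : convergent b) (cD : convergent D).

Definition jxi l := field_xi (L e1) (L e2) (L f1) (L f2) N b D l.
Definition jeta l m := field_eta (L e1) (L f1) (L f2) N b l m.

Lemma convergent_jlift v j : convergent (L v j).
Proof.
rewrite /jlift; case: ifP => _; last exact: convergent_const.
have cp' : convergent (jp t0) := convergentD (convergent_const _) (convergent_coord _).
have cq' : convergent (jq t0) := convergentD (convergent_const _) (convergent_coord _).
exact: convergentD (convergentM (convergent_const _) cp') (convergentM (convergent_const _) cq').
Qed.

Lemma convergent_jpair v : convergent (jpair v).
Proof.
by do ?[apply: convergentD|apply: convergentN|apply: convergentM|exact: convergent_const
  |exact: convergent_coord].
Qed.

(** The initial values are the linear functions Om e2 for X and Om e1 for Y, both
   killed by e1 and e2, and z plus a correction by Om f1 for Z. *)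
Lemma leaf_jets : exists l m X Y Z : jet,
  [/\ convergent l /\ l [::] = 0, convergent m /\ m [::] = 0,
    [/\ convergent X, lie (jxi l) X = 0, lie (jeta l m) X = 0 &
      forall j, j != tau -> X [:: j] = Om e2 (e j)],
    [/\ convergent Y, lie (jxi l) Y = 0, lie (jeta l m) Y = 0 &
      forall j, j != tau -> Y [:: j] = Om e1 (e j)] &
    [/\ convergent Z, lie (jxi l) Z = 0, lie (jeta l m) Z = 0 & Z [:: iz] = 1]].
Proof.
case: basis => ntau e2E e1f1 e2f2 e1e2 e1f2 e2f1 f1f2 [t1 t3 t4] pure pure2.
have lt v : L v tau = c (v 0 tau) by rewrite /jlift (negPf ntau).
have c0 : c 0 = 0 by rewrite rmorph0.
have := @leaf_functions R 4 tau (L e1) (L e2) (L f1) (L f2) N b D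
  (convergent_jlift e1) (convergent_jlift e2) (convergent_jlift f1) (convergent_jlift f2)
  cN cb cD.
rewrite !lt t1 t3 t4 e2E !mxE !eqxx /= -e2E c0.
move=> /(_ erefl erefl erefl erefl) leaf.
have [|||||l [m [cl cm al am H]]] := leaf.
- exists (fun X => jderiv iz X); split=> X; rewrite lie_jlift_comm ?e1f1 ?e2f2 mul1r //.
- by move=> X; rewrite lie_jlift_comm e1e2 c0 mul0r subr0.
- by move=> X; rewrite lie_jlift_comm e1f2 c0 mul0r subr0.
- by move=> X; rewrite lie_jlift_comm e2f1 c0 mul0r subr0.
- by move=> X; rewrite lie_jlift_comm f1f2 c0 mul0r subr0.
have dX v : Om v e2 = 0 -> jderiv tau (jpair v) = 0.
  by move=> h; rewrite jderiv_jpair -e2E h.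
have e1X v : Om v e1 = 0 -> lie (L e1) (jpair v) = 0 by move=> h; rewrite lie_jpair h.
have [X [cX aX xX yX]] := H _ (convergent_jpair e2) (dX _ (Om_self e2))
  (e1X e2 (etrans (OmC _ _) (etrans (congr1 -%R e1e2) (oppr0 _)))).
have [Y [cY aY xY yY]] := H _ (convergent_jpair e1) (dX _ e1e2) (e1X _ (Om_self e1)).
pose Z0 := jcoord iz + jslope e1 * jpair f1.
have cs v : convergent (jslope v).
  by do ?[apply: convergentD|apply: convergentM|exact: convergent_const |exact: convergent_coord].
have cZ0 : convergent Z0.
  exact: convergentD (convergent_coord _) (convergentM (cs _) (convergent_jpair _)).
have dZ0 : jderiv tau Z0 = 0.
  rewrite /Z0 raddfD /= jderiv_coord (negPf ntau) jderiv_mul jderiv_jslope jderiv_jpair -e2E pure2.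
  by rewrite (OmC f1) e2f1 oppr0 c0 mul0r mulr0 !addr0.
have eZ0 : lie (L e1) Z0 = 0.
  have [lD lM] := lie_derivation (L e1).
  rewrite /Z0 lD lM lie_jslope lie_jpair pure c0 mul0r add0r (OmC f1) e1f1.
  have -> : lie (L e1) (jcoord iz) = jslope e1.
    by rewrite lie_jlift !jderiv_coord /= /jslope !rmorph0 rmorph1; ring.
  by rewrite rmorphN rmorph1; ring.
have [Z [cZ aZ xZ yZ]] := H _ cZ0 dZ0 eZ0.
have ag j (U V : jet) : j != tau -> agree (count_mem tau) 1 U V -> U [:: j] = V [:: j].
  by move=> jt a; apply: a; rewrite /= (negPf jt).
exists l, m, X, Y, Z; split.
- by split=> //; rewrite al.
- by split=> //; rewrite am.
- split=> // j jt; rewrite (ag _ _ _ jt aX).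
  by have /(congr1 (fun U : jet => U [::])) := jderiv_jpair j e2.
- split=> // j jt; rewrite (ag _ _ _ jt aY).
  by have /(congr1 (fun U : jet => U [::])) := jderiv_jpair j e1.
split=> //; rewrite (ag iz _ _ _ aZ) 1?eq_sym //.
have : jderiv iz Z0 = c 1.
  have [_ _ h _ _] := Om_delta f1.
  rewrite /Z0 raddfD /= jderiv_coord jderiv_mul jderiv_jslope jderiv_jpair h.
  by rewrite /cp /cq !mxE /= !(mulr0, mul0r, addr0, rmorph0).
by move/(congr1 (fun U : jet => U [::])).
Qed.

End Basis.

(** * Functions defined by series *)

Section Realization.
Context {R : realType} {n : nat}.
Local Notation I := 'I_n.+1.
Local Notation jet := (jet R n).
Local Notation pt := 'rV[R]_n.+1.
Local Notation e i := (delta_mx 0 i : pt).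

Definition realize (x0 : pt) (U : jet) (t : pt) : R := jsum U (t - x0).
Definition realize_field (x0 : pt) (v : I -> jet) (t : pt) : pt := \row_i realize x0 (v i) t.

Variables (L r : R) (x0 : pt).
Hypotheses (L0 : 0 <= L) (r0 : 0 < r) (Lr : n.+1%:R * L * r <= 8^-1).
Local Notation B := [set t : pt | `|t - x0| < r].
Local Notation s := (realize x0).

Lemma realizeD U V t : gevrey L U -> gevrey L V -> B t -> s (U + V) t = s U t + s V t.
Proof. by move=> gU gV /ltW Bt; exact: (jsumD L0 r0 Lr gU gV Bt). Qed.
Lemma realizeN U t : gevrey L U -> B t -> s (- U) t = - s U t.
Proof. by move=> gU /ltW Bt; exact: (jsumN L0 r0 Lr gU Bt). Qed.
Lemma realizeM U V t : gevrey L U -> gevrey L V -> B t -> s (U * V) t = s U t * s V t.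
Proof. by move=> gU gV /ltW Bt; exact: (jsumM L0 r0 Lr gU gV Bt). Qed.
Lemma realize_const c t : s (jconst c) t = c. Proof. exact: jsum_const. Qed.
Lemma realize_coord i t : s (jcoord i) t = t 0 i - x0 0 i.
Proof. by rewrite /realize jsum_coord !mxE. Qed.

Lemma realize_center U : s U x0 = U [::].
Proof.
rewrite /realize subrr; apply: cvg_lim => //; rewrite -(cvg_shiftS (series _)) /=.
rewrite (_ : (fun N => _) = cst (U [::])); first exact: cvg_cst.
apply/funext => N; rewrite /series /= big_nat_recl // big1 ?addr0 // => d _.
by rewrite /= big1 ?mulr0 // => j _; rewrite mxE mul0r.
Qed.

Lemma realize_open : open B.
Proof.
rewrite (_ : B = ball x0 r); first exact: ball_open.
by apply/seteqP; split => y; rewrite -ball_normE /= distrC.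
Qed.

Lemma realize_smooth U : gevrey L U -> smooth_on B (s U).
Proof. exact: (jsum_smooth L0 r0 Lr). Qed.

Lemma realize_partial U t j : gevrey L U -> B t -> 'D_(e j) (s U) t = s (jderiv j U) t.
Proof.
move=> gU Bt; rewrite [RHS]/realize; have [_ <-] := jsum_derive L0 r0 Lr j gU Bt.
have E : (fun h : R => h^-1 *: ((s U \o shift t) (h *: e j) - s U t)) =
  (fun h : R => h^-1 *: ((jsum U \o shift (t - x0)) (h *: e j) - jsum U (t - x0))).
  by apply/funext => h; rewrite /realize /= addrA.
by rewrite /derive E.
Qed.

(** Differentiation of sums is differentiation of series, so exchange of second
   derivatives is inherited from the symmetry of jets. *)
Lemma realize_partial2 U t i j : gevrey L U -> B t ->
  'D_(e i) (fun x => 'D_(e j) (s U) x) t = s (jderiv i (jderiv j U)) t.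
Proof.
move=> gU Bt; rewrite -(realize_partial _ (gevrey_deriv L0 j gU) Bt).
apply: near_eq_derive; have := near_open realize_open Bt.
by apply: filterS => x Bx; exact: realize_partial.
Qed.

Lemma realize_field_smooth v : (forall i, gevrey L (v i)) -> smooth_map_on B (realize_field x0 v).
Proof.
move=> gv i; rewrite (_ : (fun x => _) = s (v i)); first exact: realize_smooth.
by apply/funext => x; rewrite mxE.
Qed.

Lemma realize_sum (f : I -> jet) t : (forall i, gevrey L (f i)) -> B t ->
  s (\sum_i f i) t = \sum_i s (f i) t.
Proof.
move=> gf Bt.
suff [_ //] : gevrey L (\sum_i f i) /\ s (\sum_i f i) t = \sum_i s (f i) t.
elim/big_rec2: _ => [|i y U _ [gU <-]].
  by split; [exact: (gevrey_const _ 0)|exact: realize_const].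
by split; [exact: (gevreyD L0)|exact: realizeD].
Qed.

(** This turns the identities lie v X = 0 between series into dX (v) = 0. *)
Lemma dd_realize v X t : (forall i, gevrey L (v i)) -> gevrey L X -> B t ->
  dd (s X) t (realize_field x0 v t) = s (lie v X) t.
Proof.
move=> gv gX Bt; rewrite /lie realize_sum //; last first.
  by move=> i; apply: (gevreyM L0) => //; exact: gevrey_deriv.
apply: eq_bigr => i _; rewrite mxE (realize_partial i gX Bt).
by rewrite (realizeM (gv i) (gevrey_deriv L0 i gX) Bt).
Qed.

End Realization.

(** * From series to functions *)

Section Combinations.
Context {R : realType}.
Local Notation pt := 'rV[R]_5.
Local Notation jet := (jet R 4).
Local Notation e i := (delta_mx 0 i : pt).
Local Notation iz := (@Ordinal 5 2 isT).

Definition lift5 (t v : pt) : pt :=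
  mk5 (cx v) (cy v) (cp t * cx v + cq t * cy v) (cp v) (cq v).

Lemma contact_lift5 t v : contact_form t (lift5 t v) = 0.
Proof. by rewrite /contact_form /lift5 !mk5E; ring. Qed.

Lemma Om_lift5 t v w : Om (lift5 t v) (lift5 t w) = Om v w.
Proof. by rewrite /Om /lift5 !mk5E. Qed.

Lemma ma_form_lift5 (E : ma_equation R) t v w :
  ma_form E t (lift5 t v) (lift5 t w) = ma_form E t v w.
Proof. by rewrite /ma_form /wedge /lift5 !mk5E. Qed.

Lemma lift5_neq_z t v i : i != iz -> lift5 t v 0 i = v 0 i.
Proof.
by case: i => [[|[|[|[|[|//]]]]] i] h //; rewrite mxE /= /cx /cy /cp /cq; congr (v _ _); exact: val_inj.
Qed.

Lemma lift5_z t v : lift5 t v 0 iz = cp t * cx v + cq t * cy v.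
Proof. by rewrite mxE. Qed.

Variables (tau : 'I_5) (e1 e2 f1 f2 : pt).
Hypothesis basis : adapted_basis tau e1 e2 f1 f2.

Definition comb (a b c d : R) : pt := a *: e1 + b *: e2 + c *: f1 + d *: f2.

Lemma Om_comb a b c d a' b' c' d' :
  Om (comb a b c d) (comb a' b' c' d') = a * c' - c * a' + (b * d' - d * b').
Proof.
case: basis => _ _ e1f1 e2f2 e1e2 e1f2 e2f1 f1f2 _ _ _.
rewrite /comb !OmDl !OmZl !OmDr !OmZr !Om_self.
rewrite (OmC e2 e1) (OmC f1 e1) (OmC f1 e2) (OmC f2 e1) (OmC f2 e2) (OmC f2 f1).
by rewrite e1f1 e2f2 e1e2 e1f2 e2f1 f1f2; ring.
Qed.

Lemma ma_form_comb E t a b c d a' b' c' d' :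
  ma_form E t (comb a b c d) (comb a' b' c' d') =
  (a * b' - b * a') * ma_form E t e1 e2 + (a * c' - c * a') * ma_form E t e1 f1
  + (a * d' - d * a') * ma_form E t e1 f2 + (b * c' - c * b') * ma_form E t e2 f1
  + (b * d' - d * b') * ma_form E t e2 f2 + (c * d' - d * c') * ma_form E t f1 f2.
Proof.
rewrite /comb !ma_formDl !ma_formZl !ma_formDr !ma_formZr !ma_form_self.
rewrite (ma_formC _ _ e2 e1) (ma_formC _ _ f1 e1) (ma_formC _ _ f1 e2) (ma_formC _ _ f2 e1).
rewrite (ma_formC _ _ f2 e2) (ma_formC _ _ f2 f1).
generalize (ma_form E t e1 e2) (ma_form E t e1 f1) (ma_form E t e1 f2) (ma_form E t e2 f1)
  (ma_form E t e2 f2) (ma_form E t f1 f2).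
by move=> *; ring.
Qed.

Lemma comb_tau a c d : comb a 0 c d 0 tau = 0.
Proof. by case: basis => _ _ _ _ _ _ _ _ [h1 h3 h4] _ _; rewrite !mxE h1 h3 h4; ring. Qed.

Variables (L r : R) (t0 : pt).
Hypotheses (L0 : 0 <= L) (r0 : 0 < r) (Lr : 5%:R * L * r <= 8^-1).
Hypothesis gcoord : forall i, gevrey L (jcoord i : jet).
Local Notation B := [set t : pt | `|t - t0| < r].
Local Notation s := (realize t0).

Lemma gevrey_jlift v j : gevrey L (jlift t0 v j).
Proof.
rewrite /jlift; case: ifP => _; last exact: gevrey_const.
by do ?[exact: gcoord|exact: gevrey_const|apply: (gevreyD L0)|apply: (gevreyM L0)].
Qed.

Lemma realize_jlift v t j : B t -> s (jlift t0 v j) t = lift5 t v 0 j.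
Proof.
move=> Bt; rewrite /jlift; case: ifPn => [/eqP ->|jz]; last first.
  by rewrite (lift5_neq_z _ _ jz) realize_const.
have gj k i : gevrey L (jconst k + jcoord i : jet).
  by apply: (gevreyD L0); [exact: gevrey_const|exact: gcoord].
have gc k : gevrey L (jconst k : jet) by exact: gevrey_const.
have gm k k' i : gevrey L (jconst k * (jconst k' + jcoord i) : jet) := gevreyM L0 (gc k) (gj k' i).
rewrite lift5_z /jp /jq (realizeD L0 r0 Lr (gm _ _ _) (gm _ _ _) Bt).
rewrite !(realizeM L0 r0 Lr (gc _) (gj _ _) Bt) !(realizeD L0 r0 Lr (gc _) (gcoord _) Bt).
by rewrite !realize_const !realize_coord /cp /cq; ring.
Qed.

Definition jcomb (a b c d : jet) (j : 'I_5) : jet :=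
  a * jlift t0 e1 j + b * jlift t0 e2 j + c * jlift t0 f1 j + d * jlift t0 f2 j.

Lemma gevrey_jcomb a b c d j : gevrey L a -> gevrey L b -> gevrey L c -> gevrey L d ->
  gevrey L (jcomb a b c d j).
Proof.
by move=> ga gb gc gd; do ?apply: (gevreyD L0); apply: (gevreyM L0) => //; exact: gevrey_jlift.
Qed.

Lemma realize_jcomb a b c d t : gevrey L a -> gevrey L b -> gevrey L c -> gevrey L d -> B t ->
  realize_field t0 (jcomb a b c d) t = lift5 t (comb (s a t) (s b t) (s c t) (s d t)).
Proof.
move=> ga gb gc gd Bt; apply/rowP => j; rewrite mxE.
have g u (gu : gevrey L u) v := gevreyM L0 gu (gevrey_jlift v j).
rewrite (realizeD L0 r0 Lr (gevreyD L0 (gevreyD L0 (g _ ga _) (g _ gb _)) (g _ gc _)) (g _ gd _) Bt).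
rewrite (realizeD L0 r0 Lr (gevreyD L0 (g _ ga _) (g _ gb _)) (g _ gc _) Bt).
rewrite (realizeD L0 r0 Lr (g _ ga _) (g _ gb _) Bt).
rewrite (realizeM L0 r0 Lr ga (gevrey_jlift _ _) Bt) (realizeM L0 r0 Lr gb (gevrey_jlift _ _) Bt).
rewrite (realizeM L0 r0 Lr gc (gevrey_jlift _ _) Bt) (realizeM L0 r0 Lr gd (gevrey_jlift _ _) Bt).
rewrite !(realize_jlift _ _ Bt).
have [->|jz] := eqVneq j iz.
  by rewrite !lift5_z /comb !coordD !coordZ; ring.
by rewrite !(lift5_neq_z _ _ jz) !mxE; ring.
Qed.

End Combinations.

Lemma common_gevrey {R : realType} {n} (us : seq (jet R n)) :
  foldr (fun U P => convergent U /\ P) True us ->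
  exists2 L : R, 0 <= L & foldr (fun U P => gevrey L U /\ P) True us.
Proof.
move=> h; suff [L0 [L00 hL]] : exists L0 : R, 0 <= L0 /\ forall L, L0 <= L ->
    foldr (fun U P => gevrey L U /\ P) True us by exists L0 => //; exact: hL.
elim: us h => [|U us IH] /= h; first by exists 0.
have [cU cus] := h; have [L1 h1] := convergent_gevrey cU; have [L2 [L20 h2]] := IH cus.
exists (Num.max L1 L2); split=> [|L]; first by rewrite le_max L20 orbT.
by rewrite ge_max => /andP[a b]; split; [exact: h1|exact: h2].
Qed.

Section Adapted.
Context {R : realType}.
Local Notation pt := 'rV[R]_5.
Local Notation jet := (jet R 4).
Local Notation e i := (delta_mx 0 i : pt).
Local Notation iz := (@Ordinal 5 2 isT).
Local Notation jc := (@jconst R 4).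

Lemma analytic_ball (f : pt -> R) t0 : analytic_at f t0 ->
  exists2 U : jet, convergent U & exists2 r : R, 0 < r &
    forall t, `|t - t0| < r -> f t = realize t0 U t.
Proof.
move=> /analytic_jet[U cU [r r0 h]]; exists U => //; exists r => // t tr.
by rewrite /realize -h // addrC subrK.
Qed.

Variables (Omega : set pt) (E : ma_equation R) (t0 : pt).
Hypotheses (oOmega : open Omega) (Ot0 : Omega t0).
Hypothesis analytic : [/\ analytic_at (Defs.coefN E) t0, analytic_at (Defs.coefA E) t0,
  analytic_at (Defs.coefB E) t0, analytic_at (Defs.coefC E) t0 & analytic_at (Defs.coefD E) t0].
Variables (tau : 'I_5) (e1 e2 f1 f2 : pt).
Hypothesis basis : adapted_basis tau e1 e2 f1 f2.
Hypothesis skew : forall t, Omega t -> ma_form E t e2 f2 = - ma_form E t e1 f1.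
Hypothesis degenerate : forall t, Omega t -> - ma_form E t e2 f1 * ma_form E t e1 f2 =
  ma_form E t e1 f1 ^+ 2 + ma_form E t f1 f2 * ma_form E t e1 e2.
Hypothesis lead : ma_form E t0 e1 f2 != 0.

Definition jform (UN UA UB UC UD : jet) (v w : pt) : jet :=
  jc (wedge cx cy v w) * UD + jc (wedge cx cp v w / 2 - wedge cy cq v w / 2) * UB
  + jc (wedge cx cq v w) * UC + jc (- wedge cy cp v w) * UA + jc (wedge cp cq v w) * UN.

(** In an adapted basis in which the leading coefficient om (e1, f2) does not vanish
   at the base point, N, b and D are the other values of om divided by it;
   degeneracy then puts xi and phi in the kernel of om. The series for l, m, X,
   Y, Z provided by [leaf_jets] are realized on a common ball. *)
Lemma adapted_reduce :
  (exists (V : set pt) (Dh : pt -> {vspace pt}),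
     [/\ open V, V t0, V `<=` Omega & complete_integral V E Dh]) /\
  (exists (V W : set pt) (F : pt -> pt) (a b : pt -> R),
     [/\ V t0, V `<=` Omega, smooth_on W a, smooth_on W b & reduces_on V W F E (normal_form a b)]).
Proof.
have [aN aA aB aC aD] := analytic.
have [UN cN [rN rN0 EN]] := analytic_ball aN.
have [UA cA [rA rA0 EA]] := analytic_ball aA.
have [UB cB [rB rB0 EB]] := analytic_ball aB.
have [UC cC [rC rC0 EC]] := analytic_ball aC.
have [UD cD [rD rD0 ED]] := analytic_ball aD.
pose om v w := jform UN UA UB UC UD v w.
have com v w : convergent (om v w).
  by do ?[exact: cN|exact: cA|exact: cB|exact: cC|exact: cD|exact: convergent_const
    |apply: convergentD|apply: convergentM].
have center f U r (r0 : 0 < r) (h : forall t, `|t - t0| < r -> f t = realize t0 U t) :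
    U [::] = f t0.
  by rewrite h ?subrr ?normr0 // realize_center.
have om_center v w : om v w [::] = ma_form E t0 v w.
  rewrite /om /jform !(jcoefD, jcoefM_nil) /=.
  rewrite (center _ _ _ rN0 EN) (center _ _ _ rA0 EA) (center _ _ _ rB0 EB).
  rewrite (center _ _ _ rC0 EC) (center _ _ _ rD0 ED) /ma_form.
  generalize (wedge cx cy v w) (wedge cx cp v w) (wedge cx cq v w) (wedge cy cp v w)
    (wedge cy cq v w) (wedge cp cq v w); by move=> *; field.
have lead' : om e1 f2 [::] != 0 by rewrite om_center.
have [iC ciC CiC] := convergent_inv (com e1 f2) lead'.
(* The normalized coefficients, which describe the kernel of om. *)
pose N := om f1 f2 * iC; pose b := om e1 f1 * iC; pose D := om e1 e2 * iC.
have [l [m [X [Y [Z [[cl l0] [cm m0] [cX xX yX X0] [cY xY yY Y0] [cZ xZ yZ Z0]]]]]]] :=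
  leaf_jets t0 basis (convergentM (com f1 f2) ciC) (convergentM (com e1 f1) ciC)
    (convergentM (com e1 e2) ciC).
rewrite -/N -/b -/D in xX yX xY yY xZ yZ.
have [L L0 [gN [gA [gB [gC [gD [giC [gl [gm [gX [gY [gZ [g0 [g1 [g2 [g3 [g4 _]]]]]]]]]]]]]]]]] :=
  common_gevrey (us := [:: UN; UA; UB; UC; UD; iC; l; m; X; Y; Z;
     jcoord (@Ordinal 5 0 isT); jcoord (@Ordinal 5 1 isT); jcoord iz;
     jcoord (@Ordinal 5 3 isT); jcoord (@Ordinal 5 4 isT)])
  (conj cN (conj cA (conj cB (conj cC (conj cD (conj ciC (conj cl (conj cm (conj cX (conj cY
    (conj cZ (conj (convergent_coord _) (conj (convergent_coord _) (conj (convergent_coord _)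
    (conj (convergent_coord _) (conj (convergent_coord _) I)))))))))))))))).
have gcoord i : gevrey L (jcoord i : jet).
  case: i => [[|[|[|[|[|//]]]]] h];
   [move: g0|move: g1|move: g2|move: g3|move: g4]; congr (gevrey L (jcoord _)); exact: val_inj.
have [rO rO0 BO] := open_ball oOmega Ot0.
have [r [r0 Lr rO' rs]] : exists r : R, [/\ 0 < r, 5%:R * L * r <= 8^-1, r <= rO &
    [/\ r <= rN, r <= rA, r <= rB, r <= rC & r <= rD]].
  (* 40 = 5 * 8; L may be zero. *)
  pose q := (40 * (L + 1))^-1 : R.
  have q0 : 0 < q by rewrite invr_gt0; lra.
  exists (Num.min q (Num.min rO (Num.min rN (Num.min rA (Num.min rB (Num.min rC rD)))))).
  split; [by rewrite !lt_min q0 rO0 rN0 rA0 rB0 rC0 rD0| |by rewrite !ge_min lexx !orbT|].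
    apply: (@le_trans _ _ (5%:R * L * q)).
      by apply: ler_wpM2l; [rewrite mulr_ge0|rewrite ge_min lexx].
    have q1 : q * (40 * (L + 1)) = 1 by rewrite /q mulVf //; apply/eqP; lra.
    nra.
  by split; rewrite !ge_min lexx ?orbT.
have [rN' rA' rB' rC' rD'] := rs.
pose B := [set t : pt | `|t - t0| < r].
have oB : open B := @realize_open R 4 r t0.
have Bt0 : B t0 by rewrite /B /= subrr normr0.
have BOmega : B `<=` Omega by move=> t Bt; apply: BO; exact: lt_le_trans Bt rO'.
pose s := realize t0.
have {}EN t : B t -> Defs.coefN E t = s UN t by move=> Bt; apply: EN; exact: lt_le_trans Bt rN'.
have {}EA t : B t -> coefA E t = s UA t by move=> Bt; apply: EA; exact: lt_le_trans Bt rA'.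
have {}EB t : B t -> Defs.coefB E t = s UB t by move=> Bt; apply: EB; exact: lt_le_trans Bt rB'.
have {}EC t : B t -> Defs.coefC E t = s UC t by move=> Bt; apply: EC; exact: lt_le_trans Bt rC'.
have {}ED t : B t -> Defs.coefD E t = s UD t by move=> Bt; apply: ED; exact: lt_le_trans Bt rD'.
have sm U f : gevrey L U -> (forall t, B t -> f t = s U t) -> smooth_on B f.
  move=> gU h; apply: (smooth_eq oB _ (realize_smooth L0 r0 Lr gU)) => t Bt.
  by rewrite h.
have sN := sm _ _ gN EN; have sA := sm _ _ gA EA; have sB := sm _ _ gB EB.
have sC := sm _ _ gC EC; have sD := sm _ _ gD ED.
have gc k : gevrey L (jc k) by exact: gevrey_const.
have gk k U : gevrey L U -> gevrey L (jc k * U) by move=> gU; exact: (gevreyM L0).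
have gom v w : gevrey L (om v w).
  by do ?[exact: gk|apply: (gevreyD L0)].
have som v w t : B t -> s (om v w) t = ma_form E t v w.
  move=> Bt; rewrite /om /jform.
  have S k U : gevrey L U -> s (jc k * U) t = k * s U t.
    by move=> gU; rewrite /s (realizeM L0 r0 Lr (gc k) gU Bt) realize_const.
  rewrite /s (realizeD L0 r0 Lr (gevreyD L0 (gevreyD L0 (gevreyD L0 (gk _ _ gD) (gk _ _ gB))
    (gk _ _ gC)) (gk _ _ gA)) (gk _ _ gN) Bt).
  rewrite (realizeD L0 r0 Lr (gevreyD L0 (gevreyD L0 (gk _ _ gD) (gk _ _ gB)) (gk _ _ gC))
     (gk _ _ gA) Bt).
  rewrite (realizeD L0 r0 Lr (gevreyD L0 (gk _ _ gD) (gk _ _ gB)) (gk _ _ gC) Bt).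
  rewrite (realizeD L0 r0 Lr (gk _ _ gD) (gk _ _ gB) Bt) -/s !S //.
  rewrite /ma_form (EN _ Bt) (EA _ Bt) (EB _ Bt) (EC _ Bt) (ED _ Bt).
  generalize (wedge cx cy v w) (wedge cx cp v w) (wedge cx cq v w) (wedge cy cp v w)
    (wedge cy cq v w) (wedge cp cq v w) (s UN t) (s UA t) (s UB t) (s UC t) (s UD t); by move=> *; field.
have gN' : gevrey L N := gevreyM L0 (gom _ _) giC.
have gb' : gevrey L b := gevreyM L0 (gom _ _) giC.
have gD' : gevrey L D := gevreyM L0 (gom _ _) giC.
have siC t : B t -> ma_form E t e1 f2 * s iC t = 1.
  by move=> Bt; rewrite -(som _ _ _ Bt) -(realizeM L0 r0 Lr (gom _ _) giC Bt) CiC; exact: realize_const.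
have lead_B t : B t -> ma_form E t e1 f2 != 0.
  move=> Bt; apply/eqP => h; have := siC _ Bt; rewrite h mul0r => /eqP.
  by rewrite eq_sym oner_eq0.
have som_iC v w t : B t -> ma_form E t v w = s (om v w * iC) t * ma_form E t e1 f2.
  move=> Bt; rewrite [s _ t](realizeM L0 r0 Lr (gom _ _) giC Bt) -/s (som _ _ _ Bt).
  by rewrite -mulrA (mulrC (s iC t)) (siC _ Bt) mulr1.
have gN1 : gevrey L (- N) := gevreyN gN'.
have gxi1 : gevrey L (b - l * N) := gevreyB L0 gb' (gevreyM L0 gl gN').
have gDlb : gevrey L (D + l * b) := gevreyD L0 gD' (gevreyM L0 gl gb').
have gxi4 : gevrey L (- (D + l * b)) := gevreyN gDlb.
have g1' : gevrey L (1 : jet) by exact: (gc 1).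
have g0' : gevrey L (0 : jet) by exact: (gc 0).
have gmN : gevrey L (m * N) := gevreyM L0 gm gN'.
have geta1 : gevrey L (1 + m * N) := gevreyD L0 g1' gmN.
have geta3 : gevrey L (- m) := gevreyN gm.
have gmb : gevrey L (m * b) := gevreyM L0 gm gb'.
have geta4 : gevrey L (l + m * b) := gevreyD L0 gl gmb.
have gbN : gevrey L (- b) := gevreyN gb'.
pose J := @jcomb R e1 e2 f1 f2 t0.
have xiE : jxi t0 e1 e2 f1 f2 N b D l = J (b - l * N) 1 l (- (D + l * b)).
  by apply/funext => j; rewrite /jxi /field_xi /J /jcomb; ring.
have etaE : jeta t0 e1 f1 f2 N b l m = J (1 + m * N) 0 (- m) (l + m * b).
  by apply/funext => j; rewrite /jeta /field_eta /J /jcomb; ring.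
rewrite xiE etaE in xX yX xY yY xZ yZ.
pose rf := realize_field t0.
pose xi := rf (J (b - l * N) 1 l (- (D + l * b))).
pose eta := rf (J (1 + m * N) 0 (- m) (l + m * b)).
pose phi := rf (J (- N) 0 1 (- b)).
pose psi := rf (J 0 0 0 1).
have gJ a1 a2 a3 a4 (h1 : gevrey L a1) (h2 : gevrey L a2) (h3 : gevrey L a3)
   (h4 : gevrey L a4) j : gevrey L (J a1 a2 a3 a4 j) := gevrey_jcomb e1 e2 f1 f2 t0 L0 gcoord j h1 h2 h3 h4.
have sfield v : (forall j, gevrey L (v j)) -> smooth_map_on B (rf v).
  exact: (realize_field_smooth L0 r0 Lr).
have K a1 a2 a3 a4 t (h1 : gevrey L a1) (h2 : gevrey L a2) (h3 : gevrey L a3)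
   (h4 : gevrey L a4) (Bt : B t) := realize_jcomb e1 e2 f1 f2 L0 r0 Lr gcoord h1 h2 h3 h4 Bt.
have sM U V t : gevrey L U -> gevrey L V -> B t -> s (U * V) t = s U t * s V t.
  exact: (realizeM L0 r0 Lr).
have sDD U V t : gevrey L U -> gevrey L V -> B t -> s (U + V) t = s U t + s V t.
  exact: (realizeD L0 r0 Lr).
have sNN U t : gevrey L U -> B t -> s (- U) t = - s U t.
  exact: (realizeN L0 r0 Lr).
have s1 t : s 1 t = 1 by exact: realize_const.
have s0 t : s 0 t = 0 by exact: realize_const.
have xit t : B t -> xi t = lift5 t (comb e1 e2 f1 f2 (s b t - s l t * s N t) 1 (s l t)
    (- (s D t + s l t * s b t))).
  move=> Bt; rewrite /xi /rf (K _ _ _ _ _ gxi1 g1' gl gxi4 Bt) -/s s1.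
  rewrite (sDD _ _ _ gb' (gevreyN (gevreyM L0 gl gN')) Bt) (sNN _ _ (gevreyM L0 gl gN') Bt).
  rewrite (sM _ _ _ gl gN' Bt) (sNN _ _ gDlb Bt) (sDD _ _ _ gD' (gevreyM L0 gl gb') Bt).
  by rewrite (sM _ _ _ gl gb' Bt).
have etat t : B t -> eta t = lift5 t (comb e1 e2 f1 f2 (1 + s m t * s N t) 0 (- s m t)
    (s l t + s m t * s b t)).
  move=> Bt; rewrite /eta /rf (K _ _ _ _ _ geta1 g0' geta3 geta4 Bt) -/s s0.
  rewrite (sDD _ _ _ g1' gmN Bt) s1 (sM _ _ _ gm gN' Bt) (sNN _ _ gm Bt).
  by rewrite (sDD _ _ _ gl gmb Bt) (sM _ _ _ gm gb' Bt).
have phit t : B t -> phi t = lift5 t (comb e1 e2 f1 f2 (- s N t) 0 1 (- s b t)).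
  move=> Bt; rewrite /phi /rf (K _ _ _ _ _ gN1 g0' g1' gbN Bt) -/s s0 s1.
  by rewrite (sNN _ _ gN' Bt) (sNN _ _ gb' Bt).
have psit t : B t -> psi t = lift5 t (comb e1 e2 f1 f2 0 0 0 1).
  by move=> Bt; rewrite /psi /rf (K _ _ _ _ _ g0' g0' g0' g1' Bt) -/s s0 s1.
have seta : smooth_map_on B eta by exact/sfield/gJ.
have sphi : smooth_map_on B phi by exact/sfield/gJ.
have spsi : smooth_map_on B psi by exact/sfield/gJ.
have sym U : gevrey L U -> second_sym B (s U).
  move=> gU t i j Bt.
  exact: (etrans (realize_partial2 L0 r0 Lr i j gU Bt)
    (etrans (congr1 (fun V => s V t) (jderivC i j U)) (esym (realize_partial2 L0 r0 Lr j i gU Bt)))).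
have frame t : B t -> symplectic_frame t (eta t) (xi t) (phi t) (psi t).
  move=> Bt; rewrite (xit _ Bt) (etat _ Bt) (phit _ Bt) (psit _ Bt); split.
    by split; exact: contact_lift5.
  rewrite !Om_lift5 !(Om_comb basis).
  generalize (s b t) (s l t) (s N t) (s D t) (s m t) => *.
  by split; [ring|ring|ring|ring|split; ring].
have omv t : B t -> [/\ ma_form E t e1 e2 = s D t * ma_form E t e1 f2,
   ma_form E t e1 f1 = s b t * ma_form E t e1 f2, ma_form E t f1 f2 = s N t * ma_form E t e1 f2,
   ma_form E t e2 f2 = - s b t * ma_form E t e1 f2 &
   ma_form E t e2 f1 = - (s b t ^+ 2 + s N t * s D t) * ma_form E t e1 f2].
  move=> Bt; have h1 := som_iC e1 e2 _ Bt; have h2 := som_iC e1 f1 _ Bt.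
  have h3 := som_iC f1 f2 _ Bt; have h4 := skew (BOmega _ Bt).
  rewrite -/D in h1; rewrite -/b in h2; rewrite -/N in h3.
  split=> //; first by rewrite h4 h2 mulNr.
  have := degenerate (BOmega _ Bt); rewrite h1 h2 h3 => h5.
  apply: (mulIf (lead_B _ Bt)); move: h5.
  generalize (ma_form E t e2 f1) (ma_form E t e1 f2) (s b t) (s D t) (s N t).
  by move=> x y u v w h5; rewrite -[x * y]opprK -mulNr h5; ring.
have om0 t : B t ->
  [/\ ma_form E t (xi t) (eta t) = 0, ma_form E t (xi t) (phi t) = 0,
      ma_form E t (xi t) (psi t) = 0, ma_form E t (phi t) (eta t) = 0 &
      ma_form E t (phi t) (psi t) = 0].
  move=> Bt; rewrite (xit _ Bt) (etat _ Bt) (phit _ Bt) (psit _ Bt).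
  rewrite !ma_form_lift5 !ma_form_comb; have [-> -> -> -> ->] := omv _ Bt.
  generalize (s b t) (s l t) (s N t) (s D t) (s m t) (ma_form E t e1 f2) => *.
  by split; ring.
have omC t : B t -> ma_form E t (eta t) (psi t) != 0.
  move=> Bt; have := lead_B _ Bt; rewrite (etat _ Bt) (psit _ Bt).
  rewrite !ma_form_lift5 !ma_form_comb; have [-> -> -> -> ->] := omv _ Bt.
  generalize (s b t) (s l t) (s N t) (s D t) (s m t) (ma_form E t e1 f2) => bb ll nn dd' mm k.
  by congr (_ != 0); ring.
have dxi U : gevrey L U -> lie (J (b - l * N) 1 l (- (D + l * b))) U = 0 -> forall t, B t ->
    dd (s U) t (xi t) = 0.
  move=> gU h t Bt; rewrite /xi /rf (dd_realize L0 r0 Lr (gJ _ _ _ _ gxi1 g1' gl gxi4) gU Bt) h.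
  exact: s0.
have deta U : gevrey L U -> lie (J (1 + m * N) 0 (- m) (l + m * b)) U = 0 -> forall t, B t ->
    dd (s U) t (eta t) = 0.
  move=> gU h t Bt; rewrite /eta /rf (dd_realize L0 r0 Lr (gJ _ _ _ _ geta1 g0' geta3 geta4) gU Bt) h.
  exact: s0.
have partial0 U j : gevrey L U -> 'D_(e j) (s U) t0 = U [:: j].
  by move=> gU; rewrite (realize_partial L0 r0 Lr j gU Bt0) realize_center.
(* The first-order data of X and Y are known in all directions except tau, and
   phi, psi and the Reeb field have no component along tau. *)
have ddOm U (v u : pt) : gevrey L U -> (forall j, j != tau -> U [:: j] = Om v (e j)) -> u 0 tau = 0 ->
    dd (s U) t0 u = Om v u.
  move=> gU h ut; rewrite [X in Om v X]row_sum_delta.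
  have OmS (f : 'I_5 -> pt) : Om v (\sum_j f j) = \sum_j Om v (f j).
    elim/big_rec2: _ => [|j y1 y2 _ <-]; last exact: OmDr.
    by rewrite /Om /cx /cy /cp /cq !mxE; ring.
  rewrite OmS; apply: eq_bigr => j _; rewrite OmZr (partial0 _ _ gU).
  by have [->|jt] := eqVneq j tau; [rewrite ut !mul0r|rewrite h].
have nz : iz != tau by rewrite eq_sym (ab_tau basis).
have lift_tau v : lift5 t0 v 0 tau = v 0 tau by apply: lift5_neq_z; exact: (ab_tau basis).
have phi_tau : phi t0 0 tau = 0 by rewrite (phit _ Bt0) lift_tau (comb_tau basis).
have psi_tau : psi t0 0 tau = 0 by rewrite (psit _ Bt0) lift_tau (comb_tau basis).
have ez_e : ez = e iz.
  by apply: row5P; rewrite /ez mk5E /cx /cy /cz /cp /cq !mxE.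
have ez_tau : (ez : pt) 0 tau = 0 by rewrite ez_e mxE eq_sym (negPf nz) andbF.
have Om_lift (v w : pt) : Om v (lift5 t0 w) = Om v w by rewrite /Om /lift5 !mk5E.
have e1c : e1 = comb e1 e2 f1 f2 1 0 0 0 by rewrite /comb scale1r !scale0r !addr0.
have e2c : e2 = comb e1 e2 f1 f2 0 1 0 0 by rewrite /comb scale1r !scale0r !addr0 add0r.
have fX : dd (s X) t0 (phi t0) = - s b t0.
  rewrite (ddOm _ _ _ gX X0 phi_tau) (phit _ Bt0) Om_lift {1}e2c (Om_comb basis); ring.
have fY : dd (s Y) t0 (phi t0) = 1.
  rewrite (ddOm _ _ _ gY Y0 phi_tau) (phit _ Bt0) Om_lift {1}e1c (Om_comb basis); ring.
have pX : dd (s X) t0 (psi t0) = 1.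
  rewrite (ddOm _ _ _ gX X0 psi_tau) (psit _ Bt0) Om_lift {1}e2c (Om_comb basis); ring.
have pY : dd (s Y) t0 (psi t0) = 0.
  rewrite (ddOm _ _ _ gY Y0 psi_tau) (psit _ Bt0) Om_lift {1}e1c (Om_comb basis); ring.
have Om_ez (v : pt) : Om v ez = 0 by rewrite /Om /ez !mk5E; ring.
have := @integrals_reduce R E B t0 (s X) (s Y) (s Z) eta xi phi psi oB Bt0 sN sA sB sC sD
  (realize_smooth L0 r0 Lr gX) (realize_smooth L0 r0 Lr gY) (realize_smooth L0 r0 Lr gZ)
  seta sphi spsi (sym _ gX) (sym _ gY) (sym _ gZ) frame.
have Xxi t : B t -> [/\ dd (s X) t (xi t) = 0, dd (s Y) t (xi t) = 0 & dd (s Z) t (xi t) = 0].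
  by move=> Bt; split; [exact: dxi gX xX t Bt|exact: dxi gY xY t Bt|exact: dxi gZ xZ t Bt].
have Xeta t : B t ->
    [/\ dd (s X) t (eta t) = 0, dd (s Y) t (eta t) = 0 & dd (s Z) t (eta t) = 0].
  by move=> Bt; split; [exact: deta gX yX t Bt|exact: deta gY yY t Bt|exact: deta gZ yZ t Bt].
move=> /(_ Xxi Xeta om0 omC).
rewrite fX fY pX pY => /(_ (oner_neq0 _)).
have d0 : - s b t0 * 0 - 1 * 1 != 0 :> R.
  by rewrite mulr0 mulr1 add0r oppr_eq0 oner_neq0.
have ez0 : [/\ dd (s X) t0 ez = 0, dd (s Y) t0 ez = 0 & dd (s Z) t0 ez != 0].
  split.
  - by rewrite (ddOm _ _ _ gX X0 ez_tau) Om_ez.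
  - by rewrite (ddOm _ _ _ gY Y0 ez_tau) Om_ez.
  - have -> : dd (s Z) t0 ez = Z [:: iz]; last by rewrite Z0 oner_neq0.
    rewrite ez_e /dd (bigD1 iz) //= mxE !eqxx mul1r (partial0 _ _ gZ) big1 ?addr0 // => j jz.
    by rewrite mxE (negPf jz) mul0r.
move=> /(_ d0 ez0) [[V [Dh [h1 h2 h3 h4]]] [V' [W [F [a' [b' [k1 k2 k3 k4 k5]]]]]]].
split.
  by exists V, Dh; split=> // t /h3/BOmega.
by exists V', W, F, a', b'; split=> // t /k2/BOmega.
Qed.

End Adapted.

(** * The four choices of adapted basis *)

Section Bases.
Context {R : realType}.
Local Notation pt := 'rV[R]_5.

Ltac adapted := split;
  solve [by [] | by apply: row5P; rewrite mk5E /cx /cy /cz /cp /cq !mxE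
    | by rewrite /Om !mk5E; ring | by split; rewrite !mxE].

(** The leading coefficient om (e1, f2) of the four bases is C, - A, - D and N
   respectively: these bases amount to exchanging x and y and to partial Legendre
   transformations, which permute the coefficients up to sign. *)
Lemma basis_C : @adapted_basis R (@Ordinal 5 1 isT)
  (mk5 1 0 0 0 0) (mk5 0 1 0 0 0) (mk5 0 0 0 1 0) (mk5 0 0 0 0 1).
Proof. adapted. Qed.

Lemma basis_A : @adapted_basis R (@Ordinal 5 0 isT)
  (mk5 0 1 0 0 0) (mk5 1 0 0 0 0) (mk5 0 0 0 0 1) (mk5 0 0 0 1 0).
Proof. adapted. Qed.

Lemma basis_D : @adapted_basis R (@Ordinal 5 4 isT)
  (mk5 1 0 0 0 0) (mk5 0 0 0 0 1) (mk5 0 0 0 1 0) (mk5 0 (-1) 0 0 0).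
Proof. adapted. Qed.

Lemma basis_N : @adapted_basis R (@Ordinal 5 1 isT)
  (mk5 0 0 0 1 0) (mk5 0 1 0 0 0) (mk5 (-1) 0 0 0 0) (mk5 0 0 0 0 1).
Proof. adapted. Qed.

End Bases.

Unset Implicit Arguments.

Theorem theorem4p12 (R : realType) (Omega : set 'rV[R]_5) (E : ma_equation R)
    (openOmega : open Omega)
    (E_nz : nowhere_zero_on Omega E)
    (E_parabolic : parabolic_on Omega E)
    (E_analytic : analytic_coefs_on Omega E) :
  forall t0 : 'rV[R]_5, Omega t0 ->
    (exists (V : set 'rV[R]_5) (Dh : 'rV[R]_5 -> {vspace 'rV[R]_5}),
      [/\ open V, V t0, V `<=` Omega & complete_integral V E Dh]) /\
    (exists (V W : set 'rV[R]_5) (F : 'rV[R]_5 -> 'rV[R]_5)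
        (a b : 'rV[R]_5 -> R),
      [/\ V t0, V `<=` Omega, smooth_on W a, smooth_on W b &
        reduces_on V W F E (normal_form a b)]).
Proof.
move=> t0 Ot0.
have an : [/\ analytic_at (Defs.coefN E) t0, analytic_at (coefA E) t0,
    analytic_at (Defs.coefB E) t0, analytic_at (Defs.coefC E) t0 & analytic_at (Defs.coefD E) t0].
  by have [hN hA hB hC hD] := E_analytic; split; [apply: hN|apply: hA|apply: hB|apply: hC|apply: hD].
have par t : Omega t -> coefA E t * Defs.coefC E t =
    (Defs.coefB E t / 2) ^+ 2 + Defs.coefN E t * Defs.coefD E t.
  move=> /E_parabolic h; suff : 4 * (coefA E t * Defs.coefC E t) =
    4 * ((Defs.coefB E t / 2) ^+ 2 + Defs.coefN E t * Defs.coefD E t) by apply: mulfI; rewrite pnatr_eq0.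
  move: h; generalize (coefA E t * Defs.coefC E t) (Defs.coefN E t * Defs.coefD E t) => x y h.
  have -> : 4 * ((Defs.coefB E t / 2) ^+ 2 + y) = Defs.coefB E t ^+ 2 + 4 * y by field.
  lra.
have go tau e1 e2 f1 f2 := @adapted_reduce R Omega E t0 openOmega Ot0 an tau e1 e2 f1 f2.
have disc t (x y : R) : Omega t -> x - y = coefA E t * Defs.coefC E t -
    ((Defs.coefB E t / 2) ^+ 2 + Defs.coefN E t * Defs.coefD E t) -> x = y.
  by move=> Ot h; apply/eqP; rewrite -subr_eq0 h par // subrr.
have [C0|C0] := eqVneq (Defs.coefC E t0) 0; last first.
  apply: (go _ _ _ _ _ basis_C) => [t Ot|t Ot|]; rewrite /ma_form /wedge !mk5E.
  - by ring.
  - by apply: (disc _ _ _ Ot); field.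
  - by move: C0; congr (_ != 0); field.
have [A0|A0] := eqVneq (coefA E t0) 0; last first.
  apply: (go _ _ _ _ _ basis_A) => [t Ot|t Ot|]; rewrite /ma_form /wedge !mk5E.
  - by ring.
  - by apply: (disc _ _ _ Ot); field.
  - by move: A0; rewrite -oppr_eq0; congr (_ != 0); field.
have [D0|D0] := eqVneq (Defs.coefD E t0) 0; last first.
  apply: (go _ _ _ _ _ basis_D) => [t Ot|t Ot|]; rewrite /ma_form /wedge !mk5E.
  - by ring.
  - by apply: (disc _ _ _ Ot); field.
  - by move: D0; rewrite -oppr_eq0; congr (_ != 0); field.
have [N0|N0] := eqVneq (Defs.coefN E t0) 0; last first.
  apply: (go _ _ _ _ _ basis_N) => [t Ot|t Ot|]; rewrite /ma_form /wedge !mk5E.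
  - by ring.
  - by apply: (disc _ _ _ Ot); field.
  - by move: N0; congr (_ != 0); field.
case: (E_nz _ Ot0); split=> //; have := E_parabolic _ Ot0.
rewrite A0 N0 !mul0r !mulr0 subr0 addr0 => /eqP.
by rewrite expf_eq0 => /andP[_ /eqP].
Qed.
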